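(* If $G$ is any graph except $P_4$, $P_5$, $P_5^c$ or $T_{2,2}$, and $q(G)\le 4$ or $q(G^c)\le 4$, then $q(G)+q(G^c)\le |G|+2$.
   Context: All graphs are finite, undirected and simple; isomorphic graphs are identified; $|G|$ is the number of vertices of $G$, and $G^c$ is the complement of $G$. For a graph $G$ with vertex set $\{1,\dots,n\}$, $S(G)$ is the set of all real symmetric $n\times n$ matrices $A=(a_{ij})$ such that for $i\ne j$, $a_{ij}\neq 0$ if and only if $\{i,j\}$ is an edge of $G$ (no restriction on the diagonal). $q(A)$ is the number of distinct eigenvalues of $A$, and $q(G)=\min\{q(A): A\in S(G)\}$. $P_n$ is the path on $n$ vertices. $T_{2,2}$ is the graph on $5$ vertices obtained from the path with vertices $1,2,3,4,5$ in order by adding the edge $\{2,4\}$. *)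

(* Defs.v *)
From HB Require Import structures.
From mathcomp Require Import all_boot all_order all_algebra finmap.
From mathcomp Require Import boolp classical_sets functions cardinality reals.

Set Implicit Arguments.
Unset Strict Implicit.
Unset Printing Implicit Defensive.

Import GRing.Theory Num.Theory.
Local Open Scope ring_scope.

Record sgraph (n : nat) := SGraph {
  adj :> rel 'I_n;
  adj_sym : symmetric adj;
  adj_irr : irreflexive adj }.

Definition graph_iso (m n : nat) (G : sgraph m) (H : sgraph n) : Prop :=
  exists f : 'I_m -> 'I_n,
    bijective f /\ forall x y, adj H (f x) (f y) = adj G x y.

Definition compl_rel (n : nat) (e : rel 'I_n) : rel 'I_n :=
  fun i j => (i != j) && ~~ e i j.

Lemma compl_rel_sym n (G : sgraph n) : symmetric (compl_rel G).
Proof. by move=> i j; rewrite /compl_rel eq_sym adj_sym. Qed.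

Lemma compl_rel_irr n (G : sgraph n) : irreflexive (compl_rel G).
Proof. by move=> i; rewrite /compl_rel eqxx. Qed.

Definition compl_graph (n : nat) (G : sgraph n) : sgraph n :=
  SGraph (compl_rel_sym G) (compl_rel_irr G).

Definition path_rel (n : nat) : rel 'I_n :=
  fun i j => (i.+1 == j :> nat) || (j.+1 == i :> nat).

Lemma path_rel_sym n : symmetric (@path_rel n).
Proof. by move=> i j; rewrite /path_rel orbC. Qed.

Lemma path_rel_irr n : irreflexive (@path_rel n).
Proof. by move=> i; rewrite /path_rel orbb gtn_eqF. Qed.

Definition path_graph (n : nat) : sgraph n :=
  SGraph (@path_rel_sym n) (@path_rel_irr n).

(* Vertices are numbered from 0, so the extra edge {2,4} of T_{2,2} joins
   1 and 3. *)
Definition T22_rel : rel 'I_5 :=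
  fun i j => [|| path_rel i j, (i == 1%N :> nat) && (j == 3%N :> nat)
               | (i == 3%N :> nat) && (j == 1%N :> nat)].

Lemma T22_rel_sym : symmetric T22_rel.
Proof.
move=> i j; rewrite /T22_rel path_rel_sym; congr (_ || _).
by rewrite orbC [X in X || _]andbC [X in _ || X]andbC.
Qed.

Lemma T22_rel_irr : irreflexive T22_rel.
Proof.
by move=> i; rewrite /T22_rel path_rel_irr /=; case: i => [[|[|[|[|[|]]]]]].
Qed.

Definition T22_graph : sgraph 5 := SGraph T22_rel_sym T22_rel_irr.

Definition SG (R : realType) (n : nat) (G : sgraph n) : set 'M[R]_n :=
  [set A | A^T = A /\ forall i j, i != j -> (A i j != 0) = G i j].
Arguments SG R {n} G _.

Lemma finite_eigenvalues (R : realType) (n : nat) (A : 'M[R]_n) :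
  finite_set [set a | eigenvalue A a].
Proof.
have p0 : char_poly A != 0 by rewrite monic_neq0 // char_poly_monic.
apply: contrapT => infA.
have [B BA] := infinite_set_fset (size (char_poly A)) infA.
rewrite leqNgt max_poly_roots // ?fset_uniq //.
by apply/allP => a aB; rewrite -eigenvalue_root_char; exact: BA.
Qed.

(* [fset_set] sends infinite sets to the empty set; by [finite_eigenvalues]
   this junk value does not occur. *)
Definition q_mx (R : realType) (n : nat) (A : 'M[R]_n) : nat :=
  #|` fset_set [set a | eigenvalue A a] |.

Lemma SG_neq0 (R : realType) (n : nat) (G : sgraph n) :
  exists k : nat, `[< exists2 A : 'M[R]_n, SG R G A & q_mx A = k >].
Proof.
pose A : 'M[R]_n := \matrix_(i, j) (G i j)%:R.
exists (q_mx A); apply/asboolP; exists A => //; split.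
  by apply/matrixP => i j; rewrite !mxE adj_sym.
by move=> i j _; rewrite mxE pnatr_eq0 eqb0 negbK.
Qed.

Definition q_graph (R : realType) (n : nat) (G : sgraph n) : nat :=
  ex_minn (SG_neq0 R G).
Arguments q_graph R {n} G.

(* Main.v *)
Require Import Defs.
From HB Require Import structures.
From mathcomp Require Import all_boot all_order all_algebra finmap.
From mathcomp Require Import boolp classical_sets functions cardinality reals.
From mathcomp Require Import interval_inference topology normedtype sequences exp trigo.
From mathcomp Require Import ring lra zify.

(** A matrix in [SG R G] with two double eigenvalues, or with a triple one, shows
    that [q G <= n - 2]; then a bound of 4 on the [q] of the complement settles the
    theorem. The proof determines a short list of graphs outside of which such a
    matrix exists, and bounds the complements of the graphs on the list.

    Matrices of [G] are obtained from small matrices [B] on a subgraph. If the only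
    symmetric [X] that vanishes on the diagonal and on the edges of [B], commutes
    with [B] and satisfies [X (B - l) (B - m) = 0] is zero (the strong property
    [strong]), then by the implicit function theorem the missing edges can be
    filled in without lowering the multiplicities of [l] and [m]; vertices outside
    the subgraph get a diagonal entry different from [l] and [m] first. This is
    [strong_perturbation] and [strong_embedding]. Signed cycles, spiders, two
    triangles or claws, and some small combinations of them carry two double
    eigenvalues in this way. Laplacians of a graph with a cut vertex of four branches
    or with isolated vertices, and direct sums of two parts with an edge each, give
    the remaining cases.

    A longest path then leaves little freedom ([longest_path_structure]): if
    [q G >= n - 1], the graph is a path, a path with a chord over two edges, a path
    with one leaf at an inner vertex, or a path with one isolated vertex. Moreover
    [q G = n] only for a path, since a triangle, a claw or an isolated vertex
    already provides one double eigenvalue.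

    It remains to show that the complement has [q] at most 2 for a path, and at most
    3 for the other graphs on the list. Vectors in dimension three, orthogonal
    exactly along the edges of [G], have a Gram matrix with the pattern of the
    complement. Six of the vectors are explicit, with squares that span all quadratic
    forms; the others are added along the path, each orthogonal to one earlier vector
    and otherwise generic. The norms of the six can be adapted so that
    the nonzero eigenvalues of the Gram matrix take one or two prescribed values
    ([frame_weights], [q_graph_compl_frame]). This takes six vertices. On five, the
    complements contain a cycle of length four, except for the path and the
    self-complementary path with a middle chord. These, the complement of the
    former, and the path on four vertices are the exceptions of the theorem. *)

Set Implicit Arguments.
Unset Strict Implicit.
Unset Printing Implicit Defensive.

Import Order.TTheory GRing.Theory Num.Theory.
Import numFieldNormedType.Exports.
Local Open Scope ring_scope.

(** * Counting distinct eigenvalues *)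

Definition eigenmult (R : realType) (n : nat) (A : 'M[R]_n) (a : R) : nat :=
  (n - \rank (A - a%:M)%R)%N.

Section EigenvalueCount.
Variables (R : realType) (n : nat).
Implicit Types (A : 'M[R]_n) (G : sgraph n).

Lemma q_graph_le G A : SG R G A -> (q_graph R G <= q_mx A)%N.
Proof.
move=> GA; rewrite /q_graph; case: ex_minnP => k _; apply.
by apply/asboolP; exists A.
Qed.

Lemma q_mx_le_roots A (s : seq R) :
  (forall a, eigenvalue A a -> a \in s) -> (q_mx A <= size s)%N.
Proof.
move=> As; rewrite /q_mx; apply: uniq_leq_size (fset_uniq _) _ => a.
by rewrite in_fset_set ?inE; [exact: As | exact: finite_eigenvalues].
Qed.

(** Eigenspaces for distinct eigenvalues are in direct sum, so each listed
    value lowers the number of distinct eigenvalues by its multiplicity minus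
    one; a listed value that is not an eigenvalue only weakens the bound. *)
Lemma q_mx_multiplicities A (s : seq R) : uniq s ->
  (q_mx A + \sum_(a <- s) eigenmult A a <= n + size s)%N.
Proof.
move=> us.
have memE a : (a \in fset_set [set a | eigenvalue A a]) = eigenvalue A a.
  by rewrite in_fset_set; [apply/idP/idP; rewrite in_setE | exact: finite_eigenvalues].
rewrite /q_mx; set F := fset_set _ in memE *.
have rk a : eigenmult A a = \rank (eigenspace A a) by rewrite mxrank_ker.
have dir : (\sum_(i : F) \rank (eigenspace A (val i)) <= n)%N.
  have := @mxdirect_sum_eigenspace _ _ n A xpredT (fun i : F => val i)
    (fun i j _ _ => @val_inj _ _ _ i j).
  by rewrite mxdirectE /= => /eqP <-; exact: rank_leq_col.
have dirF : (\sum_(a <- F) \rank (eigenspace A a) <= n)%N.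
  by rewrite big_seq_fsetE.
have := leq_add dirF (leqnn (size s)); apply: leq_trans.
rewrite (eq_bigr _ (fun a _ => rk a)).
rewrite [X in (_ <= X + _)%N](bigID (mem s)) /= -(count_predC (mem s) F).
have h1 : (count (predC (mem s)) F <=
    \sum_(a <- F | a \notin s) \rank (eigenspace A a))%N.
  rewrite -sum1_count big_seq_cond [leqRHS]big_seq_cond.
  apply: leq_sum => a /andP[aF _]; rewrite lt0n mxrank_eq0.
  by move: aF; rewrite memE.
have h2 : (\sum_(a <- s) \rank (eigenspace A a) <=
    \sum_(a <- F | a \in s) \rank (eigenspace A a))%N.
  rewrite (bigID (mem F)) /= [X in (_ + X)%N]big1 => [|a aF]; last first.
    by apply/eqP; rewrite mxrank_eq0; move: aF; rewrite memE negbK.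
  rewrite addn0 -big_filter -[leqRHS]big_filter; apply: eq_leq; apply: perm_big.
  apply: uniq_perm; rewrite ?filter_uniq ?fset_uniq // => a.
  by rewrite !mem_filter andbC.
have h3 : (count (mem s) F <= size s)%N.
  rewrite -size_filter; apply: uniq_leq_size; first by rewrite filter_uniq ?fset_uniq.
  by move=> a; rewrite mem_filter => /andP[].
rewrite addnC addnA addnAC; exact: leq_add (leq_add h2 h1) h3.
Qed.

End EigenvalueCount.

(** * Perturbing a matrix while keeping two eigenvalues *)

Lemma mx_norm_ub (R : realType) m n (X : 'M[R]_(m, n)) i j : `|X i j| <= `|X|.
Proof.
rewrite [leRHS]/Num.Def.normr /= mx_normrE.
exact: (le_bigmax _ (fun ij => `|X ij.1 ij.2|) (i, j)).
Qed.

Lemma mx_norm_lub (R : realType) m n (X : 'M[R]_(m, n)) (c : R) :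
  0 <= c -> (forall i j, `|X i j| <= c) -> `|X| <= c.
Proof.
by move=> c0 Xc; rewrite [leLHS]/Num.Def.normr /= mx_normrE; apply/bigmax_leP; split.
Qed.

Lemma mx_norm_mul (R : realType) n (X Y : 'M[R]_n) :
  `|X *m Y| <= n%:R * (`|X| * `|Y|).
Proof.
apply: mx_norm_lub => [|i j]; first by rewrite !mulr_ge0.
rewrite mxE (le_trans (ler_norm_sum _ _ _)) //.
rewrite (le_trans (ler_sum _ (G := fun=> `|X| * `|Y|) _)) //.
  by move=> k _; rewrite normrM ler_pM // mx_norm_ub.
by rewrite sumr_const card_ord mulr_natl.
Qed.

Lemma mx_norm_tr (R : realType) m n (X : 'M[R]_(m, n)) : `|X^T| = `|X|.
Proof.
apply/le_anti/andP; split; apply: mx_norm_lub => // i j.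
  by rewrite mxE mx_norm_ub.
by rewrite -[X]trmxK mxE (trmxK X) mx_norm_ub.
Qed.

Lemma linear_bounded (R : realType) n (f : 'M[R]_n -> 'M[R]_n) : linear f ->
  exists2 c : R, 0 < c & forall X, `|f X| <= c * `|X|.
Proof.
move=> lf; pose fl := GRing.isLinear.Build R 'M[R]_n 'M[R]_n *:%R f lf.
pose F : {linear 'M[R]_n -> 'M[R]_n} := HB.pack f fl.
rewrite -[f]/(F : _ -> _); move: F => {}f {fl lf}.
pose c := \sum_i \sum_j `|f (delta_mx i j)|.
have c0 : 0 <= c by apply: sumr_ge0 => i _; apply: sumr_ge0.
exists (c + 1) => [|X]; first by rewrite ltr_wpDl.
apply: le_trans (_ : c * `|X| <= _); last by rewrite ler_wpM2r // lerDl.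
rewrite {1}[X]matrix_sum_delta linear_sum mulr_suml.
apply: le_trans (ler_norm_sum _ _ _) _; apply: ler_sum => i _.
rewrite linear_sum mulr_suml.
apply: le_trans (ler_norm_sum _ _ _) _; apply: ler_sum => j _.
by rewrite linearZ normrZ mulrC ler_wpM2l // mx_norm_ub.
Qed.

Lemma linear_inj_inverse (R : realType) n (f : 'M[R]_n -> 'M[R]_n) :
  linear f -> (forall X, f X = 0 -> X = 0) ->
  exists2 g : 'M[R]_n -> 'M[R]_n, linear g & cancel g f.
Proof.
move=> lf; pose fl := GRing.isLinear.Build R 'M[R]_n 'M[R]_n *:%R f lf.
pose F : {linear 'M[R]_n -> 'M[R]_n} := HB.pack f fl.
rewrite -[f]/(F : _ -> _); move: F => {}f {fl lf} f0; have k0 : (lker (linfun f) == 0)%VS.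
  by rewrite -subv0; apply/subvP => X; rewrite memv_ker lfunE => /eqP /f0 ->; exact: mem0v.
exists ((linfun f)^-1)%VF => [c X Y|X]; first exact: linearP.
by have := lker0_lfunVK k0 X; rewrite [X in X = _]lfunE.
Qed.

Section Contraction.
Variables (R : realType) (n : nat).

HB.instance Definition _ := NormedModule.on 'M[R]_n.

(** The iteration stays in the closed ball of radius [d], on which [f] contracts
    by one half. *)
Lemma contraction_solve (f : 'M[R]_n -> 'M[R]_n) (d : R) : 0 < d ->
  (forall X, `|X| <= d -> `|f X| <= d) ->
  (forall X Y, `|X| <= d -> `|Y| <= d -> `|f X - f Y| <= 2^-1 * `|X - Y|) ->
  exists2 X, `|X| <= d & X = f X.
Proof.
move=> d0 fd fl; pose U := [set X : 'M[R]_n | `|X| <= d]%classic.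
have fU : set_fun U U f by move=> X; exact: fd.
have clU : closed U.
  have := @closed_ball_closed _ _ (0 : 'M[R]_n) d; rewrite closed_ballE //.
  by congr closed; apply/seteqP; split => X; rewrite /closed_ball_ /U /= sub0r normrN.
have [] := @banach_fixed_point R 'M[R]_n U (mkfun fU).
- have h0 : 0 <= 2^-1 :> R by rewrite invr_ge0.
  exists (2^-1)%:nng; split=> /=; first lra.
  by move=> [X Y] [/= UX UY]; exact: fl.
- exact: clU.
- by exists 0; rewrite /U /= normr0 ltW.
- by move=> X UX fX; exists X.
Qed.

End Contraction.

(** [strong B l m] says that, within the symmetric matrices supported where [B]
    has no edge, no nonzero normal vector exists at [B] to the manifold of
    symmetric matrices that keep the multiplicities of [l] and [m]. *)
Definition strong (R : realType) (n : nat) (B : 'M[R]_n) (l m : R) : Prop :=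
  forall X : 'M[R]_n, X^T = X ->
    (forall i j, (i == j) || (B i j != 0) -> X i j = 0) ->
    X *m B = B *m X -> X *m ((B - l%:M) *m (B - m%:M)) = 0 -> X = 0.

Lemma mxtrace_sqr (R : realType) n (X : 'M[R]_n) :
  \tr (X *m X^T) = \sum_i \sum_j X i j ^+ 2.
Proof.
apply: eq_bigr => i _; rewrite mxE; apply: eq_bigr => j _.
by rewrite mxE expr2.
Qed.

Lemma mxtrace_sqr_ge0 (R : realType) n (X : 'M[R]_n) : 0 <= \tr (X *m X^T).
Proof.
by rewrite mxtrace_sqr; do 2!apply: sumr_ge0 => ? _; rewrite sqr_ge0.
Qed.

Lemma mxtrace_sqr_eq0 (R : realType) n (X : 'M[R]_n) :
  \tr (X *m X^T) <= 0 -> X = 0.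
Proof.
rewrite mxtrace_sqr => h; apply/matrixP => i j; rewrite mxE.
have s0 : \sum_i \sum_j X i j ^+ 2 = 0.
  apply/le_anti; rewrite h; do 2!apply: sumr_ge0 => ? _; exact: sqr_ge0.
have /eqP := s0; rewrite psumr_eq0 => [|k _]; last first.
  by apply: sumr_ge0 => ? _; exact: sqr_ge0.
move/allP/(_ i (mem_index_enum _)); rewrite psumr_eq0 => [|k _]; last exact: sqr_ge0.
by move/allP/(_ j (mem_index_enum _)); rewrite sqrf_eq0 => /eqP.
Qed.

(** A row [v] with [v = - v K] has [v v^T = - v K v^T = 0], as [K] is skew. *)
Lemma skew_unitmx (R : realType) n (K : 'M[R]_n) : K^T = - K -> 1%:M + K \in unitmx.
Proof.
move=> Ks; rewrite -row_free_unit -kermx_eq0.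
have := mulmx_ker (1%:M + K); move: (kermx _) => V VK.
apply/eqP/mxtrace_sqr_eq0.
have hV : V = - (V *m K) by apply/eqP; rewrite -addr_eq0 -[X in X + _]mulmx1 -mulmxDr VK.
have e1 : \tr (V *m V^T) = - \tr (V *m K *m V^T).
  by rewrite {1}hV mulNmx linearN.
have e2 : \tr (V *m K *m V^T) = - \tr (V *m K *m V^T).
  by rewrite -[LHS]mxtrace_tr !trmx_mul trmxK Ks mulNmx mulmxN linearN mulmxA.
lra.
Qed.

(** Size and Lipschitz control near the origin, in the second argument: for
    [k = 1] the Lipschitz constant tends to zero with the radius. *)
Definition small_lip (R : realType) n k (f : 'M[R]_n -> 'M[R]_n -> 'M[R]_n) : Prop :=
  exists2 c : R, 0 <= c & forall (d : R) T X Y, 0 <= d -> d <= 1 ->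
    `|T| <= d -> `|X| <= d -> `|Y| <= d ->
    `|f T X| <= c * d /\ `|f T X - f T Y| <= c * d ^+ k * `|X - Y|.

Section SmallLip.
Variables (R : realType) (n : nat).
Implicit Types f g : 'M[R]_n -> 'M[R]_n -> 'M[R]_n.

Lemma small_lip_fst k : small_lip k (fun T _ : 'M[R]_n => T).
Proof.
exists 1 => // d T X Y d0 d1 Td Xd Yd; rewrite mul1r subrr normr0; split=> //.
by rewrite !mulr_ge0 // exprn_ge0.
Qed.

Lemma small_lip_linear (h : 'M[R]_n -> 'M[R]_n) : linear h ->
  small_lip 0 (fun _ X => h X).
Proof.
move=> lh; have [c c0 hc] := linear_bounded lh.
exists c => [|d T X Y d0 d1 Td Xd Yd]; first exact: ltW.
split; first by apply: le_trans (hc X) _; rewrite ler_wpM2l // ltW.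
rewrite expr0 mulr1; have := hc (X - Y).
suff -> : h (X - Y) = h X - h Y by [].
by rewrite addrC -scaleN1r lh scaleN1r addrC.
Qed.

Lemma small_lipN k f : small_lip k f -> small_lip k (fun T X => - f T X).
Proof.
move=> [c c0 hf]; exists c => // d T X Y d0 d1 Td Xd Yd.
have [h1 h2] := hf d T X Y d0 d1 Td Xd Yd.
by rewrite normrN -opprD normrN.
Qed.

Lemma small_lipD k f g : small_lip k f -> small_lip k g ->
  small_lip k (fun T X => f T X + g T X).
Proof.
move=> [c c0 hf] [e e0 hg]; exists (c + e) => [|d T X Y d0 d1 Td Xd Yd].
  exact: addr_ge0.
have [h1 h2] := hf d T X Y d0 d1 Td Xd Yd.
have [h3 h4] := hg d T X Y d0 d1 Td Xd Yd.
rewrite !mulrDl; split; first exact: le_trans (ler_normD _ _) (lerD h1 h3).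
by rewrite opprD addrACA; exact: le_trans (ler_normD _ _) (lerD h2 h4).
Qed.

Lemma small_lipW f : small_lip 1 f -> small_lip 0 f.
Proof.
move=> [c c0 hf]; exists c => // d T X Y d0 d1 Td Xd Yd.
have [h1 h2] := hf d T X Y d0 d1 Td Xd Yd; split=> //.
apply: le_trans h2 _; rewrite ler_wpM2r // expr0 mulr1 expr1.
by rewrite -[leRHS]mulr1 ler_wpM2l.
Qed.

Lemma small_lipM f g : small_lip 0 f -> small_lip 0 g ->
  small_lip 1 (fun T X => f T X *m g T X).
Proof.
move=> [c c0 hf] [e e0 hg].
exists (n%:R * (c * e + c * e)) => [|d T X Y d0 d1 Td Xd Yd].
  by rewrite mulr_ge0 // addr_ge0 // mulr_ge0.
have [h1 h2] := hf d T X Y d0 d1 Td Xd Yd.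
have [h3 h4] := hg d T X Y d0 d1 Td Xd Yd.
have [h5 _] := hg d T Y X d0 d1 Td Yd Xd.
rewrite expr0 mulr1 in h2 h4.
have cd0 : 0 <= c * d by exact: mulr_ge0.
have ed0 : 0 <= e * d by exact: mulr_ge0.
have XY0 : 0 <= `|X - Y| by [].
split.
  apply: le_trans (mx_norm_mul _ _) _; rewrite -mulrA ler_wpM2l //.
  apply: le_trans (ler_pM _ _ h1 h3) _ => //.
  rewrite (_ : c * d * (e * d) = (c * e * d) * d); last by ring.
  rewrite (_ : (c * e + c * e) * d = (c * e * d) * 2); last by ring.
  by rewrite ler_wpM2l ?mulr_ge0 //; lra.
have -> : f T X *m g T X - f T Y *m g T Y =
    f T X *m (g T X - g T Y) + (f T X - f T Y) *m g T Y.
  by rewrite mulmxBr mulmxBl addrA subrK.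
apply: le_trans (ler_normD _ _) _.
apply: le_trans (lerD (mx_norm_mul _ _) (mx_norm_mul _ _)) _.
rewrite -mulrDr -!mulrA ler_wpM2l //.
apply: le_trans (lerD (ler_pM _ _ h1 h4) (ler_pM _ _ h2 h5)) _ => //.
by rewrite expr1 le_eqVlt; apply/orP; left; apply/eqP; ring.
Qed.

End SmallLip.

Section Perturbation.
Variables (R : realType) (n : nat) (B : 'M[R]_n) (l m : R).
Hypothesis Bsym : B^T = B.

Let P i j := (i == j) || (B i j != 0).
Let mask (X : 'M[R]_n) : 'M[R]_n := \matrix_(i, j) if P i j then X i j else 0.
Let p : 'M[R]_n := (B - l%:M) *m (B - m%:M).
Let comm (X : 'M[R]_n) := B *m X - X *m B.
Let weight (X : 'M[R]_n) := p *m (p *m X *m p) *m p.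

Let Pc i j : P i j = P j i.
Proof. by rewrite /P eq_sym -{1}Bsym mxE. Qed.

Let pC : p = (B - m%:M) *m (B - l%:M).
Proof.
rewrite /p 2!mulmxBr !mulmxBl !mul_mx_scalar !mul_scalar_mx.
by apply/matrixP => i j; rewrite !mxE; case: (i == j) => /=; ring.
Qed.

Let psym : p^T = p.
Proof.
by rewrite [in RHS]pC /p trmx_mul !linearB /= Bsym !tr_scalar_mx.
Qed.

Let maskT X : (mask X)^T = mask X^T.
Proof. by apply/matrixP => i j; rewrite !mxE Pc. Qed.

Let commT X : (comm X)^T = - comm X^T.
Proof. by rewrite /comm linearB /= !trmx_mul Bsym opprB. Qed.

Let weightT X : (weight X)^T = weight X^T.
Proof.
by rewrite /weight; move: (p) (psym) => q qs; rewrite !trmx_mul qs !mulmxA.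
Qed.

(** The composite of the linearization of the equation solved below with its
    adjoint; the last term makes it injective on all matrices, not only on the
    symmetric ones. *)
Let normal_op (X : 'M[R]_n) := mask X + 2 *: comm (comm X) + weight X + (X - X^T).

Let normal_op_inj : strong B l m -> forall X, normal_op X = 0 -> X = 0.
Proof.
move=> sB X HX.
have q1 : \tr (mask X *m X^T) = \tr (mask X *m (mask X)^T).
  apply: eq_bigr => i _; rewrite !mxE; apply: eq_bigr => j _; rewrite !mxE.
  by case: (P i j); rewrite ?mul0r.
have q2 : \tr (comm (comm X) *m X^T) = \tr (comm X *m (comm X)^T).
  rewrite commT; move: (comm X) => C.
  rewrite /comm mulmxBl mulmxN mulmxBr opprB !linearB /= -!mulmxA.
  by congr (_ - _); rewrite mxtrace_mulC !mulmxA.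
have q3 : \tr (weight X *m X^T) = \tr (p *m X *m p *m (p *m X *m p)^T).
  rewrite /weight; move: (p) (psym) => q qs; rewrite !trmx_mul qs -!mulmxA.
  by rewrite mxtrace_mulC !mulmxA.
have q4 : \tr ((X - X^T) *m X^T) = 2^-1 * \tr ((X - X^T) *m (X - X^T)^T).
  rewrite linearB /= trmxK mulmxBr linearB /=.
  rewrite [X in _ * (_ - X)](_ : _ = - \tr ((X - X^T) *m X^T)); last first.
    rewrite -[LHS]mxtrace_tr trmx_mul linearB /= trmxK -opprB mulmxN linearN /=.
    by rewrite mxtrace_mulC.
  by field.
have s : \tr (mask X *m (mask X)^T) + 2 * \tr (comm X *m (comm X)^T)
   + \tr (p *m X *m p *m (p *m X *m p)^T)
   + 2^-1 * \tr ((X - X^T) *m (X - X^T)^T) = 0.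
  move: HX; rewrite /normal_op; move: (X - X^T) q4 => D q4 HX.
  rewrite -q1 -q2 -q3 -q4.
  have : \tr (0 *m X^T) = 0 by rewrite mul0mx linear0.
  rewrite -HX; move: (mask X) (comm (comm X)) (weight X) => E F W.
  by rewrite !mulmxDl -scalemxAl !mxtraceD mxtraceZ.
have [g1 g2] := (mxtrace_sqr_ge0 (mask X), mxtrace_sqr_ge0 (comm X)).
have [g3 g4] := (mxtrace_sqr_ge0 (p *m X *m p), mxtrace_sqr_ge0 (X - X^T)).
have z1 : mask X = 0 by apply: mxtrace_sqr_eq0; lra.
have z2 : comm X = 0 by apply: mxtrace_sqr_eq0; lra.
have z3 : p *m X *m p = 0 by apply: mxtrace_sqr_eq0; lra.
have z4 : X - X^T = 0 by apply: mxtrace_sqr_eq0; lra.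
have Xs : X^T = X by apply/esym/eqP; rewrite -subr_eq0 z4.
have XB : X *m B = B *m X by apply/esym/eqP; rewrite -subr_eq0; apply/eqP.
apply: sB => // [i j Pij|].
  by have /matrixP/(_ i j) := z1; rewrite !mxE /P Pij.
rewrite -/p.
have Xp : X *m p = p *m X.
  have hc c : X *m (B - c%:M) = (B - c%:M) *m X.
    by rewrite mulmxBr mulmxBl XB mul_mx_scalar mul_scalar_mx.
  by rewrite /p mulmxA hc -!mulmxA hc.
apply: mxtrace_sqr_eq0; move: (p) (psym) z3 Xp => q qs z3 Xq.
by rewrite trmx_mul Xs qs {1}Xq mulmxA z3 mul0mx linear0.
Qed.

Let mask_lin : linear mask.
Proof.
by move=> c X Y; apply/matrixP => i j; rewrite !mxE; case: ifP; rewrite ?mulr0 ?addr0.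
Qed.

Let comm_lin : linear comm.
Proof.
move=> c X Y; rewrite /comm mulmxDr mulmxDl -scalemxAr -scalemxAl scalerBr.
by rewrite opprD addrACA.
Qed.

Let weight_lin : linear weight.
Proof.
move=> c X Y; rewrite /weight; move: (p) => q.
by rewrite !(mulmxDr, mulmxDl) -!scalemxAr -!scalemxAl -!scalemxAr -!scalemxAl.
Qed.

Let normal_op_lin : linear normal_op.
Proof.
move=> c X Y; rewrite /normal_op mask_lin !comm_lin weight_lin linearP /=.
apply/matrixP => i j.
by move: (mask X) (mask Y) (comm (comm X)) (comm (comm Y)) (weight X) (weight Y)
  => ? ? ? ? ? ?; rewrite !mxE; ring.
Qed.

Let normal_opT X : (normal_op X)^T = normal_op X^T.
Proof.
have tr A C W : (A + 2 *: C + W + (X - X^T))^T = A^T + 2 *: C^T + W^T + (X^T - X).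
  by apply/matrixP => i j; rewrite !mxE.
have commN Y : comm (- Y) = - comm Y.
  by rewrite /comm mulmxN mulNmx opprB opprK addrC.
by rewrite /normal_op tr maskT weightT 2!commT commN opprK trmxK.
Qed.

(** With [K = comm X], this is what is left of the equation
    [(1 - K) (B + T + mask X) (1 + K) = (1 + K) (B - weight X) (1 - K)] beyond the
    part that is linear in [T] and [X]; see [skew_conj]. *)
Let nonlin T X :=
  (T + mask X - weight X) *m comm X - comm X *m (T + mask X - weight X)
  - comm X *m ((T + mask X + weight X) *m comm X).

Let nonlin_small : small_lip 1 nonlin.
Proof.
have hT := @small_lip_fst R n 0.
have hm := small_lip_linear mask_lin; have hw := small_lip_linear weight_lin.
have hc := small_lip_linear comm_lin.
have hs := small_lipD hT hm.
have hd := small_lipD hs (small_lipN hw); have ha := small_lipD hs hw.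
exact: small_lipD (small_lipD (small_lipM hd hc) (small_lipN (small_lipM hc hd)))
  (small_lipN (small_lipM hc (small_lipW (small_lipM ha hc)))).
Qed.

Let nonlin0 T : nonlin T 0 = 0.
Proof.
have c0 : comm 0 = 0 by rewrite /comm mulmx0 mul0mx subrr.
by rewrite /nonlin c0 !(mulmx0, mul0mx) !subrr.
Qed.

Let nonlinT T X : T^T = T -> (nonlin T X)^T = nonlin T X^T.
Proof.
move=> Ts; rewrite /nonlin.
have -> : comm X^T = - (comm X)^T by rewrite commT opprK.
rewrite -maskT -weightT; move: (mask X) (weight X) (comm X) => E W K.
have e1 U V : (U - V)^T = U^T - V^T :> 'M[R]_n by rewrite linearB.
have e2 U V : (U + V)^T = U^T + V^T :> 'M[R]_n by rewrite linearD.
by rewrite !(e1, e2, trmx_mul) Ts !(mulmxN, mulNmx) !opprK -mulmxA [X in X - _]addrC.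
Qed.

(** The equation reads [normal_op X = - (T + nonlin T X)] on symmetric matrices;
    applying the inverse of [normal_op] turns it into a fixed point problem for a
    map that contracts near the origin. The fixed point is symmetric because its
    transpose is another one. *)
Let solve (e : R) : strong B l m -> 0 < e ->
  exists2 d : R, 0 < d & forall T, T^T = T -> `|T| <= d ->
    exists X, [/\ X^T = X, `|X| <= e & mask X + 2 *: comm (comm X) + weight X
      + T + nonlin T X = 0].
Proof.
move=> sB e0.
have [g lg gK] := linear_inj_inverse normal_op_lin (normal_op_inj sB).
have inj X Y : normal_op X = normal_op Y -> X = Y.
  move=> XY; apply/eqP; rewrite -subr_eq0; apply/eqP/(normal_op_inj sB).
  by rewrite addrC -scaleN1r normal_op_lin XY scaleN1r addNr.
have gB X Y : g X - g Y = g (X - Y).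
  by rewrite addrC -scaleN1r -lg scaleN1r addrC.
have [C C0 hC] := linear_bounded lg.
have [c c0 hc] := nonlin_small.
pose d := Num.min (Num.min e 1) (2 * (C * c + 1))^-1.
have Cc0 : 0 <= C * c by rewrite mulr_ge0 // ltW.
have k0 : 0 < 2 * (C * c + 1) by lra.
have d0 : 0 < d by rewrite !lt_min e0 ltr01 invr_gt0.
have d1 : d <= 1 by rewrite !ge_min lexx orbT.
have de : d <= e by rewrite !ge_min lexx.
have Ccd : C * c * d <= 2^-1.
  have : d <= (2 * (C * c + 1))^-1 by rewrite ge_min lexx orbT.
  rewrite -(ler_pM2l k0) divff ?gt_eqF // => h.
  by nra.
have C1 : 0 < 2 * (C + 1) by lra.
exists (d / (2 * (C + 1))) => [|T Ts Td]; first exact: divr_gt0.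
have CT : C * `|T| <= d / 2.
  move: Td; rewrite ler_pdivlMr // => Td.
  have : 0 <= `|T| by []. by nra.
have Td' : `|T| <= d.
  apply: le_trans Td _; rewrite ler_pdivrMr //; nra.
pose f X := g (- (T + nonlin T X)).
have fl X Y : `|X| <= d -> `|Y| <= d -> `|f X - f Y| <= 2^-1 * `|X - Y|.
  move=> Xd Yd; rewrite /f gB; apply: le_trans (hC _) _.
  rewrite -opprD normrN opprD addrACA subrr add0r.
  have [_] := hc d T X Y (ltW d0) d1 Td' Xd Yd; rewrite expr1.
  move/(ler_wpM2l (ltW C0)) => /le_trans -> //.
  by rewrite !mulrA ler_wpM2r.
have fd X : `|X| <= d -> `|f X| <= d.
  move=> Xd; have z : `|0 : 'M[R]_n| <= d by rewrite normr0 ltW.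
  have h := fl X 0 Xd z; rewrite subr0 in h.
  have h0 : `|f 0| <= C * `|T|.
    by rewrite /f nonlin0 addr0; apply: le_trans (hC _) _; rewrite normrN.
  rewrite -[f X](subrK (f 0)); apply: le_trans (ler_normD _ _) _.
  by lra.
have [X Xd fX] := contraction_solve d0 fd fl.
have HX Y : Y = f Y -> normal_op Y = - (T + nonlin T Y) by move=> {1}->; rewrite gK.
have Xs : X^T = X.
  have fXT : X^T = f X^T.
    apply: inj; rewrite gK -normal_opT HX // -nonlinT //.
    by rewrite linearN /= linearD /= Ts.
  have := fl X^T X; rewrite -fXT -fX mx_norm_tr => /(_ Xd Xd) h.
  apply/eqP; rewrite -subr_eq0 -normr_le0; lra.
exists X; split=> //; first exact: le_trans Xd de.
have := HX X fX; rewrite /normal_op Xs subrr addr0 => ->.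
by rewrite -addrA addNr.
Qed.

Let skew_conj (K S W : 'M[R]_n) :
  (1%:M - K) *m (B + S) *m (1%:M + K) - (1%:M + K) *m (B + W) *m (1%:M - K) =
  S - W + 2 *: (B *m K - K *m B) + ((S + W) *m K - K *m (S + W))
  + K *m ((W - S) *m K).
Proof.
have e1 (M : 'M[R]_n) : (1%:M - K) *m M *m (1%:M + K) =
    M + M *m K - K *m M - K *m (M *m K).
  rewrite mulmxDr mulmx1 mulmxBl mul1mx mulmxBl -mulmxA.
  move: (M *m K) (K *m M) => mk km; move: (K *m mk) => kmk.
  by apply/matrixP => i j; rewrite !mxE; ring.
have e2 (M : 'M[R]_n) : (1%:M + K) *m M *m (1%:M - K) =
    M - M *m K + K *m M - K *m (M *m K).
  rewrite mulmxBr mulmx1 mulmxDl mul1mx mulmxDl -mulmxA.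
  move: (M *m K) (K *m M) => mk km; move: (K *m mk) => kmk.
  by apply/matrixP => i j; rewrite !mxE; ring.
rewrite e1 e2 !(mulmxDl, mulmxBl, mulmxDr, mulmxBr) mulNmx mulmxN.
move: (B *m K) (K *m B) (S *m K) (K *m S) (W *m K) (K *m W) => bk kb sk ks wk kw.
move: (K *m bk) (K *m sk) (K *m wk) => kbk ksk kwk.
by apply/matrixP => i j; rewrite !mxE; ring.
Qed.

(** As [K] is skew, [1 + K] and [1 - K] are invertible, and they commute: the
    hypothesis says that [A] is conjugate to [D]. *)
Let rank_skew_conj (K A D : 'M[R]_n) (a : R) : K^T = - K ->
  (1%:M - K) *m A *m (1%:M + K) = (1%:M + K) *m D *m (1%:M - K) ->
  \rank (A - a%:M) = \rank (D - a%:M).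
Proof.
move=> Ks AD.
have uK : 1%:M + K \in unitmx by exact: skew_unitmx.
have uN : 1%:M - K \in unitmx by apply: skew_unitmx; rewrite linearN /= Ks.
have rk U V (M : 'M[R]_n) : U \in unitmx -> V \in unitmx ->
    \rank (U *m M *m V) = \rank M.
  move=> hU hV; rewrite mxrankMfree ?row_free_unit //.
  by rewrite eqmxMfull // row_full_unit.
rewrite -(rk _ _ (A - a%:M) uN uK) -(rk _ _ (D - a%:M) uK uN); congr (\rank _).
have ex U V (M : 'M[R]_n) : U *m (M - a%:M) *m V = U *m M *m V - a *: (U *m V).
  by rewrite mulmxBr mulmxBl mul_mx_scalar -scalemxAl.
rewrite !ex AD; congr (_ - _ *: _).
rewrite mulmxDr mulmxBr !mulmx1 mulmxBl mulmxDl !mul1mx.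
by apply/matrixP => i j; rewrite !mxE; ring.
Qed.

(** This is the implicit function theorem in the direction where the strong
    property makes the linearized problem solvable. One symmetric unknown [X]
    encodes the three corrections: [mask X] for the entries that may move, the
    skew matrix [K = B X - X B] for the change of eigenvectors, and [weight X] for
    the change of the other eigenvalues. For the solution found above,
    [A = B + T + mask X] is conjugate to [D = B - weight X]; and [weight X] is a
    left multiple of both [B - l] and [B - m], so that [D - l] and [D - m] have at
    most the ranks of [B - l] and [B - m]. *)
Lemma strong_perturbation (e : R) : strong B l m -> 0 < e ->
  exists2 d : R, 0 < d & forall T : 'M[R]_n, T^T = T ->
    (forall i j, (i == j) || (B i j != 0) -> T i j = 0) -> `|T| <= d ->
    exists A : 'M[R]_n, [/\ A^T = A, forall i j, `|A i j - B i j| < e,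
      forall i j, i != j -> B i j = 0 -> A i j = T i j,
      (\rank (A - l%:M)%R <= \rank (B - l%:M)%R)%N &
      (\rank (A - m%:M)%R <= \rank (B - m%:M)%R)%N].
Proof.
move=> sB e0; have e20 : 0 < e / 2 by lra.
have [d d0 hd] := solve sB e20.
exists (Num.min d (e / 2)) => [|T Ts T0]; first by rewrite lt_min d0.
rewrite le_min => /andP[Td Te]; have [X [Xs Xe HX]] := hd T Ts Td.
pose K := comm X; pose A := B + (T + mask X); pose D := B - weight X.
have Ks : K^T = - K by rewrite commT Xs.
have AD : (1%:M - K) *m A *m (1%:M + K) = (1%:M + K) *m D *m (1%:M - K).
  apply/eqP; rewrite -subr_eq0 skew_conj -HX /nonlin -/K [comm K]/comm.
  apply/eqP; move: (mask X) (weight X) (K) => E W C.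
  rewrite opprK; have -> : - W - (T + E) = - (T + E + W).
    by apply/matrixP => i j; rewrite !mxE; ring.
  rewrite mulNmx mulmxN; move: (_ *m C) (C *m _) (C *m _) (B *m C) (C *m B) => x y z u v.
  by apply/matrixP => i j; rewrite !mxE; ring.
have rkD a : (exists Z, weight X = Z *m (B - a%:M)) ->
    (\rank (D - a%:M)%R <= \rank (B - a%:M)%R)%N.
  move=> [Z wZ]; rewrite /D wZ.
  rewrite (_ : _ - _ - _ = (1%:M - Z) *m (B - a%:M)) ?mxrankM_maxr //.
  by rewrite mulmxBl mul1mx addrAC.
exists A; split.
- by rewrite /A !linearD /= Bsym Ts maskT Xs.
- move=> i j; rewrite /A !mxE /P [B i j + _]addrC addrK.
  case: ifP => [Pij|_].
    by rewrite T0 // add0r (le_lt_trans (mx_norm_ub _ _ _)) //; lra.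
  by rewrite addr0 (le_lt_trans (mx_norm_ub _ _ _)) //; lra.
- move=> i j ij b0; rewrite /A !mxE /P b0 eqxx orbF (negPf ij) addr0.
  by rewrite add0r.
- rewrite (rank_skew_conj l Ks AD); apply: rkD.
  exists (p *m (p *m X *m p) *m (B - m%:M)).
  by rewrite -mulmxA -pC.
- rewrite (rank_skew_conj m Ks AD); apply: rkD.
  exists (p *m (p *m X *m p) *m (B - l%:M)).
  by rewrite -mulmxA.
Qed.

End Perturbation.

(** * From a matrix on a subgraph to a matrix of the whole graph *)

Section Extension.
Variables (R : realType) (n : nat).

Lemma nonzero_entries_bound (B : 'M[R]_n) (e : R) : 0 < e ->
  exists d : R, [/\ 0 < d, d <= e & forall i j, B i j != 0 -> d <= `|B i j|].
Proof.
move=> e0; exists (\big[Num.min/e]_(ij | B ij.1 ij.2 != 0) `|B ij.1 ij.2|); split.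
- by apply: lt_bigmin => // ij; rewrite normr_gt0.
- exact: bigmin_le_id.
- by move=> i j b0; apply: (bigmin_le_cond _ (j := (i, j)) _ _).
Qed.

(** The perturbation fills in the missing edges with small entries, while moving
    the nonzero entries by less than their size. *)
Lemma strong_extension (G : sgraph n) (B : 'M[R]_n) (l m e : R) :
  B^T = B -> strong B l m -> (forall i j, i != j -> B i j != 0 -> G i j) -> 0 < e ->
  exists A, [/\ SG R G A, forall i j, `|A i j - B i j| < e,
    (eigenmult B l <= eigenmult A l)%N & (eigenmult B m <= eigenmult A m)%N].
Proof.
move=> Bs sB BG e0; have [e1 [e10 e1e e1B]] := nonzero_entries_bound B e0.
have [d d0 hd] := strong_perturbation Bs sB e10.
pose T := \matrix_(i, j) (if [&& i != j, B i j == 0 & G i j] then d else 0) : 'M[R]_n.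
have Bc i j : B i j = B j i by rewrite -{1}Bs mxE.
have [||| A [As AB AT Al Am]] := hd T.
- by apply/matrixP => i j; rewrite !mxE eq_sym (Bc j) (adj_sym G j).
- by move=> i j; rewrite mxE; case: eqP => //= _ /negPf ->.
- apply: mx_norm_lub => [|i j]; first exact: ltW.
  by rewrite mxE; case: ifP => _; [rewrite gtr0_norm | rewrite normr0 ltW].
exists A; split.
- split=> // i j ij; have [b0|b0] := eqVneq (B i j) 0.
    rewrite AT // mxE ij b0 eqxx /=; case: (G i j); last by rewrite eqxx.
    by rewrite gt_eqF.
  rewrite (BG _ _ ij b0); apply/eqP => a0.
  by have := AB i j; rewrite a0 sub0r normrN ltNge e1B.
- by move=> i j; apply: lt_le_trans (AB i j) e1e.
- exact: leq_sub2l.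
- exact: leq_sub2l.
Qed.

End Extension.

Section Embedding.
Variables (R : realType) (k n : nat) (B : 'M[R]_k) (l m d : R) (f : 'I_k -> 'I_n).
Hypotheses (Bsym : B^T = B) (sB : strong B l m) (f_inj : injective f).
Hypotheses (dl : d != l) (dm : d != m).

Let F : 'M[R]_(k, n) := \matrix_(a, i) (i == f a)%:R.
Let E : 'M[R]_n := 1%:M - F^T *m F.
(** [B] on the image of [f], and the scalar [d] on the remaining vertices. *)
Let B1 : 'M[R]_n := F^T *m B *m F + d *: E.

Let FFT : F *m F^T = 1%:M.
Proof.
apply/matrixP => a b; rewrite !mxE (bigD1 (f a)) //= !mxE eqxx mul1r big1 => [|i ia].
  by rewrite addr0 (inj_eq f_inj).
by rewrite mxE (negPf ia) mul0r.
Qed.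

Let FE : F *m E = 0.
Proof. by rewrite /E mulmxBr mulmx1 mulmxA FFT mul1mx subrr. Qed.

Let EFT : E *m F^T = 0.
Proof. by rewrite /E mulmxBl mul1mx -mulmxA FFT mulmx1 subrr. Qed.

Let FB10 : F *m B1 = B *m F.
Proof. by rewrite mulmxDr -scalemxAr FE scaler0 addr0 !mulmxA FFT mul1mx. Qed.

Let FB1 a : F *m (B1 - a%:M) = (B - a%:M) *m F.
Proof. by rewrite mulmxBr mulmxBl FB10 mul_mx_scalar mul_scalar_mx. Qed.

Let B1E a : (B1 - a%:M) *m E = (d - a) *: E.
Proof.
have EE : E *m E = E by rewrite {2}/E mulmxBr mulmx1 mulmxA EFT mul0mx subr0.
by rewrite mulmxBl /B1 mulmxDl -(mulmxA _ F E) FE mulmx0 add0r -scalemxAl EE mul_scalar_mx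
  scalerBl.
Qed.

Let B1sym : B1^T = B1.
Proof.
rewrite /B1 /E linearD linearZ linearB /= !trmx_mul trmxK Bsym trmx1.
by rewrite mulmxA.
Qed.

Let conjF (M : 'M[R]_n) a b : (F *m M *m F^T) a b = M (f a) (f b).
Proof.
rewrite !mxE (bigD1 (f b)) //= big1 => [|j jb]; last first.
  by rewrite !mxE (negPf jb) mulr0.
rewrite !mxE eqxx mulr1 addr0 (bigD1 (f a)) //= big1 => [|j ja].
  by rewrite mxE eqxx mul1r addr0.
by rewrite mxE (negPf ja) mul0r.
Qed.

Let B1_codom a b : B1 (f a) (f b) = B a b.
Proof.
by rewrite -conjF FB10 -mulmxA FFT mulmx1.
Qed.

Let B1_notin (i j : 'I_n) : i \notin codom f ->
  (B1 i j = d *+ (i == j)) * (B1 j i = d *+ (i == j)).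
Proof.
move=> fi; have F0 a : F a i = 0.
  by rewrite mxE; case: eqP => // ia; rewrite ia codom_f in fi.
have E1 : B1 i j = d *+ (i == j).
  rewrite /B1 /E !mxE !big1 => [|a _|a _]; last 2 first.
  - by rewrite mxE F0 mul0r.
  - by rewrite [(_ *m _) i a]mxE big1 ?mul0r // => b _; rewrite mxE F0 mul0r.
  by rewrite add0r subr0 mulr_natr.
by split=> //; rewrite -B1sym mxE.
Qed.

Let B1_pattern (i j : 'I_n) : i != j -> B1 i j != 0 ->
  exists a b, [/\ i = f a, j = f b & B a b != 0].
Proof.
move=> ij b0; have [/codomP[a ia]|fi] := boolP (i \in codom f); last first.
  by move: b0; rewrite (B1_notin j fi).1 (negPf ij) eqxx.
have [/codomP[b jb]|fj] := boolP (j \in codom f); last first.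
  by move: b0; rewrite (B1_notin i fj).2 (eq_sym j) (negPf ij) eqxx.
by exists a, b; rewrite ia jb B1_codom in b0 *.
Qed.

(** A normal vector vanishes on the vertices outside the image, because [d] is
    neither [l] nor [m]; what remains is a normal vector at [B]. *)
Let strongB1 : strong B1 l m.
Proof.
move=> X Xs X0 XB Xp.
have XE : X *m E = 0.
  have : X *m ((B1 - l%:M) *m (B1 - m%:M)) *m E = 0 by rewrite Xp mul0mx.
  rewrite -!mulmxA B1E -!scalemxAr B1E -!scalemxAr !scalerA => /eqP.
  by rewrite scaler_eq0 mulf_eq0 !subr_eq0 (negPf dl) (negPf dm) => /eqP.
have XF : X *m F^T *m F = X.
  by move/eqP: XE; rewrite /E mulmxBr mulmx1 subr_eq0 mulmxA => /eqP.
have FX : F^T *m (F *m X) = X.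
  by rewrite -[RHS]Xs -[in RHS]XF !trmx_mul trmxK Xs.
have FB a : F *m (B1 - a%:M) *m F^T = B - a%:M by rewrite FB1 -mulmxA FFT mulmx1.
have FB0 : B = F *m B1 *m F^T by rewrite FB10 -mulmxA FFT mulmx1.
have R1 (M : 'M[R]_(n, k)) : F *m X *m F^T *m (F *m M) = F *m (X *m M).
  by rewrite mulmxA -(mulmxA F X) -(mulmxA F _ F) XF mulmxA.
suff FXF : F *m X *m F^T = 0.
  by rewrite -XF -{1}FX -(mulmxA F^T) FXF mulmx0 mul0mx.
apply: sB.
- by rewrite !trmx_mul trmxK Xs mulmxA.
- move=> a b ab; rewrite conjF X0 //.
  by rewrite (inj_eq f_inj) B1_codom.
- rewrite FB0 -(mulmxA F B1) R1 -!mulmxA; congr (F *m _).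
  by rewrite (mulmxA F) (mulmxA F^T) FX !mulmxA XB.
- have -> : (B - l%:M) *m (B - m%:M) = F *m ((B1 - l%:M) *m (B1 - m%:M) *m F^T).
    by rewrite -[B - m%:M]FB !mulmxA -FB1.
  by rewrite R1 (mulmxA X) Xp mul0mx mulmx0.
Qed.

Let mult_B1 a : (eigenmult B a <= eigenmult B1 a)%N.
Proof.
have kn : (k <= n)%N by have := leq_card f f_inj; rewrite !card_ord.
have rF : \rank F = k by apply/eqP/row_freeP; exists F^T.
have rE : (\rank E + k <= n)%N.
  by have := mulmx0_rank_max EFT; rewrite mxrank_tr rF.
have -> : eigenmult B1 a = (n - \rank (F^T *m (B - a%:M) *m F + (d - a) *: E)%R)%N.
  rewrite /eigenmult; congr (_ - \rank _)%N.
  rewrite /B1 /E mulmxBr mulmxBl mul_mx_scalar -scalemxAl.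
  move: (F^T *m B *m F) (F^T *m F) => u v.
  by apply/matrixP => i j; rewrite !mxE; case: (i == j) => /=; ring.
have h1 := mxrank_add (F^T *m (B - a%:M) *m F) ((d - a) *: E).
have h2 : (\rank ((d - a) *: E)%R <= \rank E)%N by exact: mxrank_scale.
have h3 : (\rank (F^T *m (B - a%:M) *m F)%R <= \rank (B - a%:M)%R)%N.
  by apply: leq_trans (mxrankM_maxl _ _) _; exact: mxrankM_maxr.
have h : (\rank (F^T *m (B - a%:M) *m F + (d - a) *: E)%R <= \rank (B - a%:M)%R + \rank E)%N.
  exact: leq_trans h1 (leq_add h3 h2).
rewrite /eigenmult leq_subLR addnBA; last exact: leq_trans (rank_leq_col _) _.
by rewrite leq_subRL; lia.
Qed.

Variable G : sgraph n.
Hypothesis BG : forall a b, a != b -> B a b != 0 -> G (f a) (f b).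

Lemma strong_embedding (e : R) : 0 < e -> exists A, [/\ SG R G A,
  forall i, i \notin codom f -> `|A i i - d| < e,
  (eigenmult B l <= eigenmult A l)%N & (eigenmult B m <= eigenmult A m)%N].
Proof.
move=> e0; have [||||A [GA AB Al Am]] := @strong_extension R n G B1 l m e.
- exact: B1sym.
- exact: strongB1.
- move=> i j ij b0; have [a [b [ia jb ab]]] := B1_pattern ij b0.
  by rewrite ia jb BG //; rewrite ia jb (inj_eq f_inj) in ij.
- exact: e0.
exists A; split=> //; first by move=> i fi; have := AB i i; rewrite (B1_notin i fi).1 eqxx.
- exact: leq_trans (mult_B1 l) Al.
- exact: leq_trans (mult_B1 m) Am.
Qed.

End Embedding.

(** * Bounds on q from embedded matrices *)

Lemma exists_avoiding2 (R : realType) (l m : R) : exists d : R, d != l /\ d != m.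
Proof.
exists (Num.max l m + 1); split; rewrite gt_eqF // ltr_pwDr // le_max lexx //.
by rewrite orbT.
Qed.

Section EmbeddingBounds.
Variables (R : realType) (k n : nat) (B : 'M[R]_k) (G : sgraph n) (f : 'I_k -> 'I_n).
Hypotheses (Bsym : B^T = B) (f_inj : injective f).
Hypothesis BG : forall a b, a != b -> B a b != 0 -> G (f a) (f b).

Lemma q_graph_embedding2 (l m : R) : strong B l m -> l != m ->
  (q_graph R G + eigenmult B l + eigenmult B m <= n + 2)%N.
Proof.
move=> sB lm; have [d [dl dm]] := exists_avoiding2 l m.
have [A [GA _ Al Am]] := strong_embedding Bsym sB f_inj dl dm BG ltr01.
have := @q_mx_multiplicities _ _ A [:: l; m]; rewrite /= inE lm => /(_ isT).
rewrite !big_cons big_nil addn0 => h; rewrite -addnA.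
by apply: leq_trans h; rewrite leq_add ?leq_add ?q_graph_le.
Qed.

Lemma q_graph_embedding1 (l : R) : strong B l l ->
  (q_graph R G + eigenmult B l <= n + 1)%N.
Proof.
move=> sB; have [d [dl _]] := exists_avoiding2 l l.
have [A [GA _ Al _]] := strong_embedding Bsym sB f_inj dl dl BG ltr01.
have := @q_mx_multiplicities _ _ A [:: l] isT; rewrite big_seq1 => h.
by apply: leq_trans h; rewrite leq_add ?q_graph_le.
Qed.

(** The diagonal entry at an isolated vertex may be changed at will; set to [l],
    it contributes one more to the multiplicity of [l]. *)
Lemma q_graph_embedding_isolated (l : R) (z : 'I_n) : strong B l l ->
  (forall j, ~~ G z j) -> z \notin codom f ->
  (q_graph R G + eigenmult B l <= n)%N.
Proof.
move=> sB Gz fz; have [d [dl _]] := exists_avoiding2 l l.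
have e0 : 0 < `|d - l| by rewrite normr_gt0 subr_eq0.
have [A [[As GA] Ad Al _]] := strong_embedding Bsym sB f_inj dl dl BG e0.
have Azl : A z z - l != 0.
  rewrite subr_eq0; apply/eqP => h; have := Ad z fz.
  by rewrite h distrC ltxx.
have Az i : i != z -> A i z = 0.
  move=> iz; apply/eqP; have := GA i z iz; rewrite adj_sym (negPf (Gz i)).
  by move/negbT; rewrite negbK.
pose A1 := A - (A z z - l) *: delta_mx z z.
have GA1 : SG R G A1.
  split=> [|i j ij].
    by rewrite /A1 linearB linearZ /= trmx_delta As.
  rewrite -GA // /A1 !mxE; case: (i =P z) => [iz|_]; last by rewrite mulr0 subr0.
  by case: (j =P z) => [jz|_]; [rewrite iz jz eqxx in ij | rewrite mulr0 subr0].
have rK : \rank (kermx (A - l%:M)) = eigenmult A l by rewrite mxrank_ker.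
have K0 := mulmx_ker (A - l%:M); move: (kermx _) rK K0 => K rK K0.
have Kz i : K i z = 0.
  have /matrixP/(_ i z) := K0; rewrite [RHS]mxE mxE (bigD1 z) //= big1 => [|j jz].
    rewrite addr0 !mxE eqxx mulr1n => /eqP.
    by rewrite mulf_eq0 (negPf Azl) orbF => /eqP.
  by rewrite !mxE Az // (negPf jz) mulr0n subr0 mulr0.
pose e : 'rV[R]_n := delta_mx 0 z.
have eA : e *m (A1 - l%:M) = 0.
  apply/rowP => j; rewrite -rowE !mxE eqxx /= eq_sym.
  have [->|jz] := eqVneq j z; first by rewrite mulr1 mulr1n; ring.
  have -> : A z j = 0 by rewrite -As mxE Az.
  by rewrite mulr0 mulr0n; ring.
have KA : K *m (A1 - l%:M) = 0.
  rewrite /A1 addrAC mulmxBr K0 sub0r; apply/eqP; rewrite oppr_eq0; apply/eqP.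
  rewrite -scalemxAr; apply/matrixP => i j; rewrite !mxE big1 ?mulr0 // => a _.
  by rewrite !mxE; case: eqP => [->|_]; rewrite ?Kz ?mul0r ?mulr0.
have cap0 : (K :&: e)%MS = 0.
  apply/eqP; rewrite -submx0; apply/rV_subP => v; rewrite sub_capmx submx0.
  move=> /andP[/submxP[D vD] /sub_rVP[c vc]]; apply/eqP.
  have : v 0 z = 0 by rewrite vD mxE big1 // => a _; rewrite Kz mulr0.
  by rewrite vc !mxE !eqxx mulr1 => ->; rewrite scale0r.
have re : \rank e = 1%N by rewrite mxrank_delta.
have : (eigenmult A l + 1 <= eigenmult A1 l)%N.
  rewrite -rK -re -(mxrank_disjoint_sum cap0) /eigenmult leq_subRL ?rank_leq_row //.
  rewrite addnC addsmxE; apply: mulmx0_rank_max.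
  by rewrite mul_col_mx KA eA col_mx0.
have := @q_mx_multiplicities _ _ A1 [:: l] isT; rewrite big_seq1 /=.
by have := q_graph_le GA1; lia.
Qed.

End EmbeddingBounds.

(** * Bounds on q from explicit eigenvectors *)

Lemma row_free_diag (R : realType) k n (V : 'M[R]_(k, n)) (g : 'I_k -> 'I_n) :
  (forall i j, (V i (g j) != 0) = (i == j)) -> row_free V.
Proof.
move=> Vg; apply/row_freeP.
exists (\matrix_(x, j) ((x == g j)%:R / V j (g j))).
apply/matrixP => i j; rewrite !mxE (bigD1 (g j)) //= big1 => [|x xj]; last first.
  by rewrite mxE (negPf xj) mul0r mulr0.
rewrite mxE eqxx mul1r addr0; have [<-|ij] := eqVneq i j.
  by rewrite divff // Vg.
by have := Vg i j; rewrite (negPf ij) => /negbFE/eqP ->; rewrite mul0r.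
Qed.

Lemma eigenmult_ge (R : realType) k n (A : 'M[R]_n) (V : 'M[R]_(k, n)) (a : R) :
  row_free V -> V *m A = a *: V -> (k <= eigenmult A a)%N.
Proof.
move=> /eqP rV VA; rewrite -{1}rV /eigenmult leq_subRL ?rank_leq_row // addnC.
by apply: mulmx0_rank_max; rewrite mulmxBr VA mul_mx_scalar subrr.
Qed.

Section Laplacian.
Variables (R : realType) (n : nat) (G : sgraph n) (D : pred 'I_n).

(** The Laplacian of the subgraph induced on [D], bordered by the edges outside
    of it: a vector supported on [D] and constant on the components of that
    subgraph can only fail to be in the kernel at the vertices outside [D]. *)
Definition bordered_laplacian : 'M[R]_n :=
  \matrix_(i, j) if i == j then (\sum_(k | D k && G k i) 1) *+ D i else - (G i j)%:R.

Lemma SG_bordered_laplacian : SG R G bordered_laplacian.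
Proof.
split=> [|i j ij]; last by rewrite mxE (negPf ij) oppr_eq0 pnatr_eq0 eqb0 negbK.
apply/matrixP => i j; rewrite !mxE eq_sym; case: eqP => [->|_] //.
by rewrite adj_sym.
Qed.

Lemma bordered_laplacian_in (x : 'rV[R]_n) j :
  (forall i, ~~ D i -> x 0 i = 0) -> D j ->
  (forall i, D i -> G i j -> x 0 i = x 0 j) ->
  (x *m bordered_laplacian) 0 j = 0.
Proof.
move=> xD Dj xG; rewrite mxE (bigD1 j) //= mxE eqxx Dj mulr1n mulr_sumr.
rewrite [X in _ + X](eq_bigr (fun i => - (x 0 j *+ (D i && G i j)))) => [|i ij]; last first.
  rewrite mxE (negPf ij) mulrN; have [Di|/xD ->] := boolP (D i); last by rewrite mul0r.
  by case: (boolP (G i j)) => [/(xG _ Di) ->|_] /=; rewrite ?mulr1 ?mulr0.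
rewrite sumrN; apply/eqP; rewrite subr_eq0; apply/eqP.
rewrite big_mkcond (bigD1 j) //= adj_irr andbF add0r.
by apply: eq_bigr => i _; case: ifP => _; rewrite ?mulr1.
Qed.

Lemma bordered_laplacian_notin (x : 'rV[R]_n) j :
  ~~ D j -> x 0 j = 0 ->
  (x *m bordered_laplacian) 0 j = - \sum_(i | G i j) x 0 i.
Proof.
move=> Dj xj; rewrite mxE (bigD1 j) //= xj mul0r add0r -sumrN [RHS]big_mkcond.
rewrite [RHS](bigD1 j) //= adj_irr add0r; apply: eq_bigr => i ij.
by rewrite mxE (negPf ij); case: (G i j); rewrite ?mulrN ?mulr1 ?mulr0 ?oppr0.
Qed.

End Laplacian.

Lemma q_graph_eigenmult (R : realType) n (G : sgraph n) (A : 'M[R]_n) (a : R) :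
  SG R G A -> (q_graph R G + eigenmult A a <= n + 1)%N.
Proof.
move=> GA; have := @q_mx_multiplicities _ _ A [:: a] isT; rewrite big_seq1 => h.
by apply: leq_trans h; rewrite leq_add2r q_graph_le.
Qed.

Lemma q_graph_isolated1 (R : realType) n (G : sgraph n) (z t : 'I_n) :
  (forall j, ~~ G z j) -> t != z -> (q_graph R G + 1 <= n)%N.
Proof.
move=> Gz tz; pose D : pred 'I_n := predT.
pose V : 'M[R]_(2, n) := \matrix_(k, i) ((i == z) == (k == ord0))%:R.
have h2 : (2 <= eigenmult (bordered_laplacian R G D) 0)%N.
  apply: (@eigenmult_ge _ _ _ _ V).
    apply: (@row_free_diag _ _ _ _ (fun k => if k == ord0 then z else t)) => i j.
    rewrite mxE pnatr_eq0 eqb0 negbK.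
    by case: i => [[|[|//]] ?]; case: j => [[|[|//]] ?]; rewrite /= ?eqxx ?(negPf tz).
  rewrite scale0r; apply/row_matrixP => k; rewrite row_mul row0; apply/rowP => j.
  rewrite bordered_laplacian_in ?mxE // => i _ ij; rewrite !mxE.
  have [iz|iz] := eqVneq i z; first by rewrite iz (negPf (Gz j)) in ij.
  have [jz|//] := eqVneq j z; by rewrite adj_sym jz (negPf (Gz i)) in ij.
have := @q_graph_eigenmult R n G _ 0 (SG_bordered_laplacian R G D); lia.
Qed.

(** The indicator vectors of the two vertices and of the rest span a kernel of
    dimension three. *)
Lemma q_graph_isolated2 (R : realType) n (G : sgraph n) (z1 z2 t : 'I_n) :
  (forall j, ~~ G z1 j) -> (forall j, ~~ G z2 j) -> z1 != z2 -> t != z1 -> t != z2 ->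
  (q_graph R G + 2 <= n)%N.
Proof.
move=> G1 G2 z12 t1 t2; pose D : pred 'I_n := predT.
pose s i : 'I_3 := if i == z1 then 0 else if i == z2 then 1 else 2.
pose V : 'M[R]_(3, n) := \matrix_(k, i) (k == s i)%:R.
have z21 : (z2 == z1) = false by rewrite eq_sym (negPf z12).
have h3 : (3 <= eigenmult (bordered_laplacian R G D) 0)%N.
  apply: (@eigenmult_ge _ _ _ _ V).
    apply: (@row_free_diag _ _ _ _ (fun k => nth t [:: z1; z2] k)) => i j.
    rewrite mxE pnatr_eq0 eqb0 negbK /s; congr (i == _).
    by case: j => [[|[|[|//]]] ?] /=; rewrite ?eqxx ?z21 ?(negPf t1) ?(negPf t2);
      apply: val_inj.
  rewrite scale0r; apply/row_matrixP => k; rewrite row_mul row0; apply/rowP => j.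
  rewrite bordered_laplacian_in ?mxE // => i _ ij; rewrite !mxE; congr (_ == _)%:R.
  have ji : G j i by rewrite adj_sym.
  have hi z : (forall j, ~~ G z j) -> (i == z) = false.
    by move=> Gz; apply: contraTF ij => /eqP ->.
  have hj z : (forall j, ~~ G z j) -> (j == z) = false.
    by move=> Gz; apply: contraTF ji => /eqP ->.
  by rewrite /s !hi // !hj.
have := @q_graph_eigenmult R n G _ 0 (SG_bordered_laplacian R G D); lia.
Qed.

(** The sets [C k] are unions of components of [G - u]. A combination of two of
    their indicator vectors, weighted by the numbers of edges to [u] in the other
    set, is in the kernel of the Laplacian of [G - u] bordered by the row of [u];
    four sets give a kernel of dimension three. *)
Lemma q_graph_cut4 (R : realType) n (G : sgraph n) (u : 'I_n) (C : 'I_4 -> pred 'I_n)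
    (a : 'I_4 -> 'I_n) :
  (forall k, ~~ C k u) ->
  (forall k i j, i != u -> j != u -> G i j -> C k i -> C k j) ->
  (forall k k' i, C k i -> C k' i -> k = k') ->
  (forall k, C k (a k)) -> (forall k, G (a k) u) ->
  (q_graph R G + 2 <= n)%N.
Proof.
move=> Cu CG Cd Ca Gu; pose D := predC1 u.
pose m k : R := \sum_(i | G i u) (C k i)%:R.
have m0 k : 0 < m k.
  rewrite /m (bigD1 (a k)) //= Ca ltr_pwDl // sumr_ge0 //.
pose w (k : 'I_3) : 'I_4 := widen_ord (isT : 3 <= 4)%N k.
have wmax k : w k != ord_max by rewrite -val_eqE /= neq_ltn ltn_ord.
pose V : 'M[R]_(3, n) :=
  \matrix_(k, i) (m ord_max * (C (w k) i)%:R - m (w k) * (C ord_max i)%:R).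
have h3 : (3 <= eigenmult (bordered_laplacian R G D) 0)%N.
  apply: (@eigenmult_ge _ _ _ _ V).
    apply: (@row_free_diag _ _ _ _ (fun k => a (w k))) => i j; rewrite mxE.
    have -> : C ord_max (a (w j)) = false.
      by apply: contraNF (wmax j) => h; rewrite (Cd _ _ _ (Ca (w j)) h).
    have -> : C (w i) (a (w j)) = (i == j).
      apply/idP/eqP => [h|->]; last exact: Ca.
      by apply: val_inj; exact: (congr1 val (Cd _ _ _ h (Ca (w j)))).
    rewrite mulr0 subr0 mulf_eq0 gt_eqF //= pnatr_eq0 eqb0 negbK //.
  rewrite scale0r; apply/row_matrixP => k; rewrite row_mul row0; apply/rowP => j.
  rewrite [RHS]mxE; have [->|ju] := eqVneq j u.
    rewrite bordered_laplacian_notin /= ?eqxx //; last first.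
      by rewrite !mxE !(negPf (Cu _)) !mulr0 subrr.
    apply/eqP; rewrite oppr_eq0; apply/eqP.
    under eq_bigr do rewrite !mxE.
    by rewrite sumrB -!mulr_sumr -/(m _) -/(m _) mulrC subrr.
  rewrite bordered_laplacian_in // => [i|i iu ij].
    by rewrite negbK => /eqP ->; rewrite !mxE !(negPf (Cu _)) !mulr0 subrr.
  have e l : C l i = C l j.
    apply/idP/idP; apply: CG => //; by rewrite adj_sym.
  by rewrite !mxE !e.
have := @q_graph_eigenmult R n G _ 0 (SG_bordered_laplacian R G D); lia.
Qed.

Lemma strong_edge (R : realType) :
  strong (const_mx (2^-1) : 'M[R]_2) 0 1.
Proof.
move=> X _ X0 _ _; apply/matrixP => i j; rewrite [RHS]mxE X0 //.
by rewrite mxE invr_eq0 pnatr_eq0 orbT.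
Qed.

Section TwoParts.
Variables (R : realType) (n : nat) (G : sgraph n).

Definition part_rel (C : pred 'I_n) : rel 'I_n := fun i j => [&& C i, C j & G i j].

Lemma part_rel_sym C : symmetric (part_rel C).
Proof. by move=> i j; rewrite /part_rel adj_sym andbCA. Qed.

Lemma part_rel_irr C : irreflexive (part_rel C).
Proof. by move=> i; rewrite /part_rel adj_irr !andbF. Qed.

Definition part_graph C : sgraph n := SGraph (part_rel_sym C) (part_rel_irr C).

(** The edge [ab] alone has eigenvalues 0 and 1, which survive in a matrix of the
    part. The vertices outside [C] are isolated there and their diagonal entries
    stay near 2, so the two eigenvectors vanish on them. *)
Lemma part_eigenvectors (C : pred 'I_n) (a b : 'I_n) : C a -> C b -> G a b ->
  exists A : 'M[R]_n, SG R (part_graph C) A /\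
    forall c, c \in [:: 0; 1] -> exists x : 'rV[R]_n,
      [/\ x != 0, x *m A = c *: x & forall i, ~~ C i -> x 0 i = 0].
Proof.
move=> Ca Cb ab; pose B : 'M[R]_2 := const_mx 2^-1.
have aneb : a != b by apply: contraTneq ab => ->; rewrite adj_irr.
pose f (i : 'I_2) := if i == ord0 then a else b.
have f_inj : injective f.
  by move=> [[|[|//]] ?] [[|[|//]] ?] /eqP; rewrite /f /= ?(negPf aneb) 1?eq_sym ?(negPf aneb)
    => // _; apply: val_inj.
have Bs : B^T = B by apply/matrixP => i j; rewrite !mxE.
have BG i j : i != j -> B i j != 0 -> part_graph C (f i) (f j).
  move=> ij _; rewrite /= /part_rel; move: ij.
  by case: i => [[|[|//]] ?]; case: j => [[|[|//]] ?] //= _; rewrite /f /= Ca Cb ?ab // adj_sym.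
have d0 : (2 : R) != 0 by rewrite pnatr_eq0.
have d1 : (2 : R) != 1 by rewrite -subr_eq0 (_ : 2 - 1 = 1) ?oner_eq0 //; ring.
have e0 : (0 : R) < 2^-1 by lra.
have [A [GA Ad A0 A1]] := strong_embedding Bs (@strong_edge R) f_inj d0 d1 BG e0.
exists A; split=> // c; rewrite !inE => c01.
have mult c' (y : 'rV[R]_2) : y 0 0 != 0 -> y *m B = c' *: y -> (1 <= eigenmult B c')%N.
  move=> y0 yB; apply: (eigenmult_ge _ yB); apply: (@row_free_diag _ _ _ _ (fun=> ord0)) => i j.
  by rewrite !ord1 y0.
have multA : (1 <= eigenmult A c)%N.
  case/orP: c01 => /eqP ->.
    apply: leq_trans A0; apply: (mult _ (\row_j (if j == 0 then 1 else -1)));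
      first by rewrite mxE oner_eq0.
    by apply/rowP => j; rewrite !mxE !big_ord_recl big_ord0 !mxE /=; field.
  apply: leq_trans A1; apply: (mult _ (const_mx 1)); first by rewrite mxE oner_eq0.
  by apply/rowP => j; rewrite !mxE !big_ord_recl big_ord0 !mxE /=; field.
have eA : eigenvalue A c by rewrite /eigenvalue -mxrank_eq0 mxrank_ker -lt0n.
have [x xA x0] := eigenvalueP eA; exists x; split=> // i Ci.
have fi : i \notin codom f.
  apply/codomP => -[k ik]; move: Ci; rewrite ik /f; case: ifP => _; by rewrite ?Ca ?Cb.
have /rowP/(_ i) := xA; rewrite [LHS]mxE [RHS]mxE (bigD1 i) //= big1 => [|j ji]; last first.
  have := GA.2 j i ji; rewrite /= /part_rel (negPf Ci) andbF => /negbT;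
    rewrite negbK => /eqP ->.
  by rewrite mulr0.
rewrite addr0 => /eqP; rewrite mulrC -subr_eq0 -mulrBl mulf_eq0 => /orP[|/eqP //].
have := Ad i fi; rewrite ltr_norml => /andP[h1 h2] /eqP h.
by case/orP: c01 => /eqP cE; lra.
Qed.

(** The matrices of the two parts have the common eigenvalues 0 and 1, which are
    double in their direct sum. *)
Lemma q_graph_two_parts (C : pred 'I_n) (a b a' b' : 'I_n) :
  C a -> C b -> G a b -> ~~ C a' -> ~~ C b' -> G a' b' ->
  (forall i j, C i -> ~~ C j -> ~~ G i j) ->
  (q_graph R G + 2 <= n)%N.
Proof.
move=> Ca Cb ab Ca' Cb' ab' CC.
have [A1 [[A1s GA1] ev1]] := part_eigenvectors Ca Cb ab.
have [A2 [[A2s GA2] ev2]] := @part_eigenvectors (predC C) a' b' Ca' Cb' ab'.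
have z1 i j : C i (+) C j -> A1 i j = 0.
  move=> ij; apply/eqP; have := GA1 i j; rewrite /= /part_rel.
  case: eqVneq => [e|_ /(_ isT)]; first by rewrite e addbb in ij.
  have -> : [&& C i, C j & G i j] = false by case: (C i) (C j) ij => [] [].
  by move/negbT; rewrite negbK.
have z2 i j : C i (+) C j -> A2 i j = 0.
  move=> ij; apply/eqP; have := GA2 i j; rewrite /= /part_rel /=.
  case: eqVneq => [e|_ /(_ isT)]; first by rewrite e addbb in ij.
  have -> : [&& ~~ C i, ~~ C j & G i j] = false by case: (C i) (C j) ij => [] [].
  by move/negbT; rewrite negbK.
pose A : 'M[R]_n := \matrix_(i, j) if C i then A1 i j else A2 i j.
have GA : SG R G A.
  split=> [|i j ij].
    apply/matrixP => i j; rewrite !mxE.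
    have s1 : A1 j i = A1 i j by rewrite -[in LHS]A1s mxE.
    have s2 : A2 j i = A2 i j by rewrite -[in LHS]A2s mxE.
    rewrite s1 s2; case Ci : (C i); case Cj : (C j) => //.
      by rewrite z1 ?z2 // Ci Cj.
    by rewrite z1 ?z2 // Ci Cj.
  rewrite mxE; case: ifP => Ci; rewrite ?GA1 ?GA2 //= /part_rel /= Ci /=.
    by case: (boolP (C j)) => //= Cj; rewrite (negPf (CC _ _ Ci Cj)).
  case: (boolP (C j)) => //= Cj; apply/esym/negbTE; rewrite adj_sym CC //.
  by rewrite Ci.
have mult c : c \in [:: 0; 1] -> (2 <= eigenmult A c)%N.
  move=> c01; have [x [x0 xA xC]] := ev1 c c01; have [y [y0 yA yC]] := ev2 c c01.
  have nz (v : 'rV[R]_n) : v != 0 -> exists i, v 0 i != 0.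
    move=> v0; apply/existsP; apply: contraNT v0 => /existsPn h.
    by apply/eqP/rowP => i; rewrite mxE; have := h i; rewrite negbK => /eqP.
  have [[i xi] [j yj]] := (nz _ x0, nz _ y0).
  have Ci : C i by apply: contraNT xi => /xC ->.
  have Cj : ~~ C j by apply: contraNN yj => Cj; rewrite yC //= Cj.
  have [xj yi] : x 0 j = 0 /\ y 0 i = 0 by split; [apply: xC | apply: yC; rewrite /= Ci].
  pose V : 'M[R]_(2, n) := \matrix_(k, s) if k == 0 then x 0 s else y 0 s.
  apply: (@eigenmult_ge _ _ _ _ V).
    apply: (@row_free_diag _ _ _ _ (fun k : 'I_2 => if k == 0 then i else j)) => s t.
    rewrite mxE; move: s t => [[|[|//]] ?] [[|[|//]] ?] /=;
      by rewrite ?xi ?yj ?xj ?yi ?eqxx.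
  apply/row_matrixP => k; rewrite row_mul linearZ /=.
  have -> : row k V = if k == 0 then x else y.
    by apply/rowP => s; rewrite !mxE; case: ifP.
  case: ifP => _; [rewrite -xA | rewrite -yA]; apply/rowP => t; rewrite !mxE.
    apply: eq_bigr => s _; rewrite mxE; case: ifP => // /negbT Cs.
    by rewrite xC // !mul0r.
  apply: eq_bigr => s _; rewrite mxE; case: ifP => // Cs.
  by rewrite yC /= ?Cs // !mul0r.
have := @q_mx_multiplicities _ _ A [:: 0; 1]; rewrite /= inE eq_sym oner_eq0 => /(_ isT).
rewrite !big_cons big_nil addn0.
have := mult 0; have := mult 1; rewrite !inE !eqxx !orbT => /(_ isT) h1 /(_ isT) h0.
move=> h; have := leq_trans (leq_add (q_graph_le GA) (leq_add h0 h1)) h; lia.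
Qed.

End TwoParts.

(** * Small matrices with two double eigenvalues *)

Section Tables.
Variables (R : realType) (k : nat) (c : seq (seq int)).

Definition entry (i j : nat) : int := nth 0 (nth [::] c i) j.

Definition table_mx : 'M[R]_k.+1 := \matrix_(i, j) (entry i j)%:~R.

(** The entries of a symmetric matrix supported on the non-edges of the table;
    on numerals it evaluates either to 0 or to a variable. *)
Definition off_entry (y : nat -> nat -> R) (i j : nat) : R :=
  if (i == j) || (entry i j != 0) then 0 else if (i < j)%N then y i j else y j i.

Definition commute_at (y : nat -> nat -> R) (i j : nat) : Prop :=
  foldr (fun t a => off_entry y i t * (entry t j)%:~R + a) 0 (iota 0 k.+1) =
  foldr (fun t a => (entry i t)%:~R * off_entry y t j + a) 0 (iota 0 k.+1).

Lemma strong_table (l m : R) :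
  (forall y, (forall i j, (i <= k)%N -> (j <= k)%N -> commute_at y i j) ->
     forall i j, (i < j <= k)%N -> entry i j = 0 -> y i j = 0) ->
  strong table_mx l m.
Proof.
move=> H X Xs X0 XB _.
pose y i j := X (inord i) (inord j).
have Xc i j : X i j = X j i by rewrite -{1}Xs mxE.
have XE i j : X i j = off_entry y i j.
  rewrite /off_entry /y !inord_val; case: ifP => [p|_]; last by case: ifP.
  by apply: X0; move: p; rewrite mxE intr_eq0.
have fE (F : nat -> R) : foldr (fun t a => F t + a) 0 (iota 0 k.+1) = \sum_(t < k.+1) F t.
  by rewrite -(big_mkord xpredT F) /index_iota subn0 unlock /= /reducebig; elim: (iota _ _).
have X0lt (i j : 'I_k.+1) : (i < j)%N -> X i j = 0.
  move=> ij; have [e0|e0] := eqVneq (entry i j) 0; last first.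
    by apply: X0; rewrite mxE intr_eq0 e0 orbT.
  have := H y _ i j; rewrite ij -ltnS ltn_ord e0 /y !inord_val; apply=> //.
  move=> a b ak bk; rewrite /commute_at !fE.
  have /matrixP/(_ (Ordinal (ak : a < k.+1)%N) (Ordinal (bk : b < k.+1)%N)) := XB.
  rewrite !mxE => e; transitivity (\sum_t X (Ordinal (ak : a < k.+1)%N)
    t * table_mx t (Ordinal (bk : b < k.+1)%N)).
    by apply: eq_bigr => t _; rewrite XE mxE.
  by rewrite e; apply: eq_bigr => t _; rewrite XE mxE.
apply/matrixP => i j; rewrite mxE; case: (ltngtP i j) => [h|h|/val_inj ->].
- exact: X0lt.
- by rewrite Xc X0lt.
- by rewrite X0 // eqxx.
Qed.

Definition table_sym : bool :=
  all (fun i => all (fun j => entry i j == entry j i) (iota 0 k.+1)) (iota 0 k.+1).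

Lemma table_mx_sym : table_sym -> table_mx^T = table_mx.
Proof.
move=> /allP h; apply/matrixP => i j; rewrite !mxE.
have hi (a : 'I_k.+1) : val a \in iota 0 k.+1 by rewrite mem_iota ltn_ord.
by have /allP/(_ _ (hi i))/eqP -> := h _ (hi j).
Qed.

(** Two integer eigenvectors that are independent because of the two
    coordinates [p] and [q]. *)
Definition eigen_pair (l : int) (u v : seq int) (p q : nat) : bool :=
  [&& (p <= k)%N, (q <= k)%N,
      u`_p != 0, u`_q == 0, v`_p == 0, v`_q != 0 &
      all (fun w => all (fun j =>
        foldr (fun t a => w`_t * entry t j + a) 0 (iota 0 k.+1) == l * w`_j)
        (iota 0 k.+1)) [:: u; v]].

Lemma eigenmult_table (l : int) (u v : seq int) (p q : nat) :
  eigen_pair l u v p q -> (2 <= eigenmult table_mx l%:~R)%N.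
Proof.
move=> /and4P[pk qk up /and4P[uq vp vq /allP h]].
pose V : 'M[R]_(2, k.+1) := \matrix_(s, t) ((if s == 0 then u else v)`_t)%:~R.
have hV (s : 'I_2) : (if s == 0 then u else v) \in [:: u; v] by rewrite !inE; case: ifP;
  rewrite eqxx ?orbT.
apply: (@eigenmult_ge _ _ _ _ V).
  apply: (@row_free_diag _ _ _ _ (fun s : 'I_2 => if s == 0 then inord p else inord q)) => s t.
  rewrite mxE intr_eq0; case: s => [[|[|//]] ?]; case: t => [[|[|//]] ?] /=;
    by rewrite inordK ?(eqP uq) ?(eqP vp) ?(negPf up) ?(negPf vq).
apply/matrixP => s j; rewrite !mxE.
have hj : val j \in iota 0 k.+1 by rewrite mem_iota ltn_ord.
have /allP/(_ _ hj)/eqP e := h _ (hV s); rewrite -intrM -{}e.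
rewrite (_ : foldr _ _ _ = \sum_(t < k.+1) (if s == 0 then u else v)`_t * entry t j).
  by rewrite rmorph_sum; apply: eq_bigr => t _; rewrite !mxE /= intrM.
pose F t := (if s == 0 then u else v)`_t * entry t j.
rewrite -(big_mkord xpredT F) /index_iota subn0 unlock /= /reducebig /F.
by elim: (iota _ _) => //= a r ->.
Qed.

Lemma nth_embedding n (G : sgraph n) (x0 : 'I_n) (s : seq 'I_n) :
  uniq s -> size s = k.+1 -> table_sym ->
  (forall i j, (i < j <= k)%N -> entry i j != 0 -> G (nth x0 s i) (nth x0 s j)) ->
  injective (fun i : 'I_k.+1 => nth x0 s i) /\
  forall a b : 'I_k.+1, a != b -> table_mx a b != 0 -> G (nth x0 s a) (nth x0 s b).
Proof.
move=> us ss cs sG; split=> [i j /eqP|a b].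
  by rewrite nth_uniq ?ss // => /eqP /val_inj.
rewrite mxE intr_eq0; case: (ltngtP a b) => [h|h|/val_inj ->]; last by rewrite eqxx.
  by move=> _ e; apply: sG => //; rewrite h -ltnS ltn_ord.
move=> _ e; rewrite adj_sym; apply: sG; first by rewrite h -ltnS ltn_ord.
move: e; have := table_mx_sym cs => /matrixP/(_ a b); rewrite !mxE => /eqP.
by rewrite eqr_int => /eqP ->.
Qed.

Lemma q_graph_table n (G : sgraph n) (x0 : 'I_n) (s : seq 'I_n) (l m : int)
    (u v u' v' : seq int) (p q p' q' : nat) :
  table_sym -> strong table_mx l%:~R m%:~R -> l != m ->
  eigen_pair l u v p q -> eigen_pair m u' v' p' q' -> uniq s -> size s = k.+1 ->
  (forall i j, (i < j <= k)%N -> entry i j != 0 -> G (nth x0 s i) (nth x0 s j)) ->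
  (q_graph R G + 2 <= n)%N.
Proof.
move=> cs sB lm el em us ss sG; have [f_inj BG] := nth_embedding us ss cs sG.
have lmR : l%:~R != m%:~R :> R by rewrite eqr_int.
have := q_graph_embedding2 (table_mx_sym cs) f_inj BG sB lmR.
have := eigenmult_table el; have := eigenmult_table em.
move: (eigenmult _ _) (eigenmult _ _) => a b; lia.
Qed.

End Tables.

(** One linear equation between the unknown entries of a normal vector. *)
Ltac commutation h i j :=
  have := h i j isT isT; rewrite /commute_at /off_entry /entry /=
    ?(mul0r, mulr0, add0r, addr0, mulr0z, mulr1z, mulr1, mul1r).

(** The tables are chosen so that the commutation equations alone force a normal
    vector to vanish, and, except for the single claw, so that two eigenvalues are
    double. If deleting a vertex leaves three pieces that share an eigenvalue, the
    combinations of their eigenvectors that cancel at that vertex form a plane;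
    this is used at the center of the spider, and at both branching vertices of the
    two trees that have two of them. Where a triangle is attached at one vertex, its
    other two vertices have equal rows, hence a null vector, and the remaining
    diagonal entries supply a second one. The net has the symmetry of a rotation of
    order three. Two disjoint pieces bring one double eigenvalue each; a shift of
    one diagonal keeps their spectra disjoint. *)
Definition star4_edge_table : seq (seq int) :=
  [:: [:: 2; 1; 1; 1; 1];
      [:: 1; 1; 1; 0; 0];
      [:: 1; 1; 1; 0; 0];
      [:: 1; 0; 0; 2; 0];
      [:: 1; 0; 0; 0; 2]].

Lemma strong_star4_edge (R : realType) (l m : R) : strong (table_mx R 4 star4_edge_table) l m.
Proof.
apply: strong_table => y h.
commutation h 0%N 1%N => h0.
commutation h 0%N 2%N => h1.
commutation h 1%N 3%N => h2.
commutation h 0%N 3%N => h3.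
commutation h 0%N 4%N => h4.
by move=> [|[|[|[|[|i]]]]] [|[|[|[|[|j]]]]]; rewrite /= ?andbF // => _ _; lra.
Qed.

Definition spider222_table : seq (seq int) :=
  [:: [:: 0; 1; 0; 1; 0; 1; 0];
      [:: 1; 1; 1; 0; 0; 0; 0];
      [:: 0; 1; 1; 0; 0; 0; 0];
      [:: 1; 0; 0; 1; 1; 0; 0];
      [:: 0; 0; 0; 1; 1; 0; 0];
      [:: 1; 0; 0; 0; 0; 1; 1];
      [:: 0; 0; 0; 0; 0; 1; 1]].

Lemma strong_spider222 (R : realType) (l m : R) : strong (table_mx R 6 spider222_table) l m.
Proof.
apply: strong_table => y h.
commutation h 1%N 2%N => h0.
commutation h 3%N 4%N => h1.
commutation h 5%N 6%N => h2.
commutation h 1%N 3%N => h3.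
commutation h 1%N 5%N => h4.
commutation h 3%N 5%N => h5.
commutation h 0%N 1%N => h6.
commutation h 0%N 2%N => h7.
commutation h 0%N 3%N => h8.
commutation h 2%N 3%N => h9.
commutation h 0%N 4%N => h10.
commutation h 0%N 5%N => h11.
commutation h 2%N 5%N => h12.
commutation h 4%N 5%N => h13.
commutation h 0%N 6%N => h14.
by move=> [|[|[|[|[|[|[|i]]]]]]] [|[|[|[|[|[|[|j]]]]]]]; rewrite /= ?andbF // => _ _; lra.
Qed.

Definition adjacent_branchings_table : seq (seq int) :=
  [:: [:: -1; 1; 1; 1; 0; 0];
      [:: 1; 0; 0; 0; 0; 0];
      [:: 1; 0; 0; 0; 0; 0];
      [:: 1; 0; 0; 2; 1; 1];
      [:: 0; 0; 0; 1; 1; 0];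
      [:: 0; 0; 0; 1; 0; 1]].

Lemma strong_adjacent_branchings (R : realType) (l m : R) :
  strong (table_mx R 5 adjacent_branchings_table) l m.
Proof.
apply: strong_table => y h.
commutation h 0%N 1%N => h0.
commutation h 0%N 2%N => h1.
commutation h 3%N 4%N => h2.
commutation h 3%N 5%N => h3.
commutation h 1%N 3%N => h4.
commutation h 2%N 3%N => h5.
commutation h 0%N 4%N => h6.
commutation h 1%N 4%N => h7.
commutation h 2%N 4%N => h8.
commutation h 0%N 5%N => h9.
by move=> [|[|[|[|[|[|i]]]]]] [|[|[|[|[|[|j]]]]]]; rewrite /= ?andbF // => _ _; lra.
Qed.

Definition branchings_distance2_table : seq (seq int) :=
  [:: [:: 0; 2; 2; 2; 0; 0; 0];
      [:: 2; 0; 0; 0; 0; 0; 0];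
      [:: 2; 0; 0; 0; 0; 0; 0];
      [:: 2; 0; 0; 4; 2; 0; 0];
      [:: 0; 0; 0; 2; 5; 2; 2];
      [:: 0; 0; 0; 0; 2; 2; 0];
      [:: 0; 0; 0; 0; 2; 0; 2]].

Lemma strong_branchings_distance2 (R : realType) (l m : R) :
  strong (table_mx R 6 branchings_distance2_table) l m.
Proof.
apply: strong_table => y h.
commutation h 0%N 1%N => h0.
commutation h 0%N 2%N => h1.
commutation h 1%N 3%N => h2.
commutation h 2%N 3%N => h3.
commutation h 3%N 5%N => h4.
commutation h 4%N 5%N => h5.
commutation h 3%N 6%N => h6.
commutation h 4%N 6%N => h7.
commutation h 0%N 3%N => h8.
commutation h 3%N 4%N => h9.
commutation h 1%N 5%N => h10.
commutation h 2%N 5%N => h11.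
commutation h 1%N 6%N => h12.
commutation h 2%N 6%N => h13.
commutation h 0%N 4%N => h14.
by move=> [|[|[|[|[|[|[|i]]]]]]] [|[|[|[|[|[|[|j]]]]]]]; rewrite /= ?andbF // => _ _; lra.
Qed.

Definition net_table : seq (seq int) :=
  [:: [:: 1; 1; 1; 1; 0; 0];
      [:: 1; 1; 1; 0; 1; 0];
      [:: 1; 1; 1; 0; 0; 1];
      [:: 1; 0; 0; 0; 0; 0];
      [:: 0; 1; 0; 0; 0; 0];
      [:: 0; 0; 1; 0; 0; 0]].

Lemma strong_net (R : realType) (l m : R) : strong (table_mx R 5 net_table) l m.
Proof.
apply: strong_table => y h.
commutation h 0%N 1%N => h0.
commutation h 0%N 2%N => h1.
commutation h 1%N 2%N => h2.
commutation h 0%N 3%N => h3.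
commutation h 1%N 4%N => h4.
commutation h 2%N 5%N => h5.
commutation h 1%N 3%N => h6.
commutation h 2%N 3%N => h7.
commutation h 2%N 4%N => h8.
by move=> [|[|[|[|[|[|i]]]]]] [|[|[|[|[|[|j]]]]]]; rewrite /= ?andbF // => _ _; lra.
Qed.

Definition triangle_branching_table : seq (seq int) :=
  [:: [:: 3; 1; 1; 1; 0; 0];
      [:: 1; 1; 1; 0; 0; 0];
      [:: 1; 1; 1; 0; 0; 0];
      [:: 1; 0; 0; 1; 1; 1];
      [:: 0; 0; 0; 1; 4; 0];
      [:: 0; 0; 0; 1; 0; 4]].

Lemma strong_triangle_branching (R : realType) (l m : R) :
  strong (table_mx R 5 triangle_branching_table) l m.
Proof.
apply: strong_table => y h.
commutation h 0%N 1%N => h0.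
commutation h 0%N 2%N => h1.
commutation h 3%N 4%N => h2.
commutation h 3%N 5%N => h3.
commutation h 1%N 3%N => h4.
commutation h 2%N 3%N => h5.
commutation h 0%N 4%N => h6.
commutation h 0%N 5%N => h7.
commutation h 1%N 4%N => h8.
by move=> [|[|[|[|[|[|i]]]]]] [|[|[|[|[|[|j]]]]]]; rewrite /= ?andbF // => _ _; lra.
Qed.

Definition claw_table : seq (seq int) :=
  [:: [:: 0; 1; 1; 1];
      [:: 1; 0; 0; 0];
      [:: 1; 0; 0; 0];
      [:: 1; 0; 0; 0]].

Lemma strong_claw (R : realType) (l m : R) : strong (table_mx R 3 claw_table) l m.
Proof.
apply: strong_table => y h.
commutation h 0%N 1%N => h0.
commutation h 0%N 2%N => h1.
commutation h 0%N 3%N => h2.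
by move=> [|[|[|[|i]]]] [|[|[|[|j]]]]; rewrite /= ?andbF // => _ _; lra.
Qed.

Definition two_triangles_table : seq (seq int) :=
  [:: [:: 1; 1; 1; 0; 0; 0];
      [:: 1; 1; 1; 0; 0; 0];
      [:: 1; 1; 1; 0; 0; 0];
      [:: 0; 0; 0; 2; 1; 1];
      [:: 0; 0; 0; 1; 2; 1];
      [:: 0; 0; 0; 1; 1; 2]].

Lemma strong_two_triangles (R : realType) (l m : R) :
  strong (table_mx R 5 two_triangles_table) l m.
Proof.
apply: strong_table => y h.
commutation h 0%N 3%N => h0.
commutation h 1%N 3%N => h1.
commutation h 2%N 3%N => h2.
commutation h 0%N 4%N => h3.
commutation h 1%N 4%N => h4.
commutation h 2%N 4%N => h5.
commutation h 0%N 5%N => h6.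
commutation h 1%N 5%N => h7.
commutation h 2%N 5%N => h8.
by move=> [|[|[|[|[|[|i]]]]]] [|[|[|[|[|[|j]]]]]]; rewrite /= ?andbF // => _ _; lra.
Qed.

Definition triangle_claw_table : seq (seq int) :=
  [:: [:: 1; 1; 1; 0; 0; 0; 0];
      [:: 1; 1; 1; 0; 0; 0; 0];
      [:: 1; 1; 1; 0; 0; 0; 0];
      [:: 0; 0; 0; 1; 1; 1; 1];
      [:: 0; 0; 0; 1; 1; 0; 0];
      [:: 0; 0; 0; 1; 0; 1; 0];
      [:: 0; 0; 0; 1; 0; 0; 1]].

Lemma strong_triangle_claw (R : realType) (l m : R) :
  strong (table_mx R 6 triangle_claw_table) l m.
Proof.
apply: strong_table => y h.
commutation h 3%N 4%N => h0.
commutation h 3%N 5%N => h1.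
commutation h 3%N 6%N => h2.
commutation h 0%N 4%N => h3.
commutation h 1%N 4%N => h4.
commutation h 2%N 4%N => h5.
commutation h 0%N 5%N => h6.
commutation h 1%N 5%N => h7.
commutation h 2%N 5%N => h8.
commutation h 0%N 6%N => h9.
commutation h 1%N 6%N => h10.
commutation h 2%N 6%N => h11.
commutation h 0%N 3%N => h12.
commutation h 1%N 3%N => h13.
commutation h 2%N 3%N => h14.
by move=> [|[|[|[|[|[|[|i]]]]]]] [|[|[|[|[|[|[|j]]]]]]]; rewrite /= ?andbF // => _ _; lra.
Qed.

Definition two_claws_table : seq (seq int) :=
  [:: [:: 0; 1; 1; 1; 0; 0; 0; 0];
      [:: 1; 0; 0; 0; 0; 0; 0; 0];
      [:: 1; 0; 0; 0; 0; 0; 0; 0];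
      [:: 1; 0; 0; 0; 0; 0; 0; 0];
      [:: 0; 0; 0; 0; 1; 1; 1; 1];
      [:: 0; 0; 0; 0; 1; 1; 0; 0];
      [:: 0; 0; 0; 0; 1; 0; 1; 0];
      [:: 0; 0; 0; 0; 1; 0; 0; 1]].

Lemma strong_two_claws (R : realType) (l m : R) : strong (table_mx R 7 two_claws_table) l m.
Proof.
apply: strong_table => y h.
commutation h 0%N 1%N => h0.
commutation h 0%N 2%N => h1.
commutation h 0%N 3%N => h2.
commutation h 4%N 5%N => h3.
commutation h 4%N 6%N => h4.
commutation h 4%N 7%N => h5.
commutation h 1%N 5%N => h6.
commutation h 2%N 5%N => h7.
commutation h 3%N 5%N => h8.
commutation h 1%N 6%N => h9.
commutation h 2%N 6%N => h10.
commutation h 3%N 6%N => h11.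
commutation h 1%N 7%N => h12.
commutation h 2%N 7%N => h13.
commutation h 3%N 7%N => h14.
commutation h 1%N 4%N => h15.
commutation h 2%N 4%N => h16.
commutation h 3%N 4%N => h17.
commutation h 0%N 5%N => h18.
commutation h 0%N 6%N => h19.
commutation h 0%N 7%N => h20.
commutation h 0%N 4%N => h21.
by move=> [|[|[|[|[|[|[|[|i]]]]]]]] [|[|[|[|[|[|[|[|j]]]]]]]]; rewrite /= ?andbF // => _ _; lra.
Qed.

Section Shapes.
Variables (R : realType) (n : nat) (G : sgraph n).
Implicit Types (a b c d t u v w x y z : 'I_n).

Lemma q_graph_fourfold_with_edge v a b c d : uniq [:: v; a; b; c; d] ->
  G v a -> G v b -> G v c -> G v d -> G a b ->
  (q_graph R G + 2 <= n)%N.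
Proof.
move=> us e01 e02 e03 e04 e12.
apply: (@q_graph_table R 4 star4_edge_table n G v [:: v; a; b; c; d] 0 2
  [:: 0; -1; 1; 0; 0] [:: -2; 2; 0; 1; 1]
  [:: 0; -1; -1; 2; 0] [:: 0; -1; -1; 0; 2] 2 4 3 4) => //.
  exact: strong_star4_edge.
by move=> [|[|[|[|[|i]]]]] [|[|[|[|[|j]]]]]; rewrite /= ?andbF.
Qed.

Lemma q_graph_spider222 v a a1 b b1 c c1 : uniq [:: v; a; a1; b; b1; c; c1] ->
  G v a -> G v b -> G v c -> G a a1 -> G b b1 -> G c c1 ->
  (q_graph R G + 2 <= n)%N.
Proof.
move=> us e01 e03 e05 e12 e34 e56.
apply: (@q_graph_table R 6 spider222_table n G v [:: v; a; a1; b; b1; c; c1] 0 2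
  [:: 0; 1; -1; -1; 1; 0; 0] [:: 0; 1; -1; 0; 0; -1; 1]
  [:: 0; -1; -1; 1; 1; 0; 0] [:: 0; -1; -1; 0; 0; 1; 1] 4 6 4 6) => //.
  exact: strong_spider222.
by move=> [|[|[|[|[|[|[|i]]]]]]] [|[|[|[|[|[|[|j]]]]]]]; rewrite /= ?andbF.
Qed.

Lemma q_graph_adjacent_branchings u a b v c d : uniq [:: u; a; b; v; c; d] ->
  G u a -> G u b -> G u v -> G v c -> G v d ->
  (q_graph R G + 2 <= n)%N.
Proof.
move=> us e01 e02 e03 e34 e35.
apply: (@q_graph_table R 5 adjacent_branchings_table n G u [:: u; a; b; v; c; d] 0 1
  [:: 0; -1; 1; 0; 0; 0] [:: 0; 1; 0; -1; 1; 1]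
  [:: -1; -1; -1; 0; 1; 0] [:: -1; -1; -1; 0; 0; 1] 2 5 4 5) => //.
  exact: strong_adjacent_branchings.
by move=> [|[|[|[|[|[|i]]]]]] [|[|[|[|[|[|j]]]]]]; rewrite /= ?andbF.
Qed.

Lemma q_graph_branchings_distance2 u a b w v c d : uniq [:: u; a; b; w; v; c; d] ->
  G u a -> G u b -> G u w -> G w v -> G v c -> G v d ->
  (q_graph R G + 2 <= n)%N.
Proof.
move=> us e01 e02 e03 e34 e45 e46.
apply: (@q_graph_table R 6 branchings_distance2_table n G u [:: u; a; b; w; v; c; d] 0 2
  [:: 0; -1; 1; 0; 0; 0; 0] [:: 0; -1; 0; 1; -2; 2; 2]
  [:: 1; 1; 1; -1; 0; 1; 0] [:: 1; 1; 1; -1; 0; 0; 1] 2 6 5 6) => //.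
  exact: strong_branchings_distance2.
by move=> [|[|[|[|[|[|[|i]]]]]]] [|[|[|[|[|[|[|j]]]]]]]; rewrite /= ?andbF.
Qed.

Lemma q_graph_net x y z x1 y1 z1 : uniq [:: x; y; z; x1; y1; z1] ->
  G x y -> G x z -> G x x1 -> G y z -> G y y1 -> G z z1 ->
  (q_graph R G + 2 <= n)%N.
Proof.
move=> us e01 e02 e03 e12 e14 e25.
apply: (@q_graph_table R 5 net_table n G x [:: x; y; z; x1; y1; z1] 1 (-1)
  [:: -1; 1; 0; -1; 1; 0] [:: -1; 0; 1; -1; 0; 1]
  [:: 1; -1; 0; -1; 1; 0] [:: 1; 0; -1; -1; 0; 1] 4 5 4 5) => //.
  exact: strong_net.
by move=> [|[|[|[|[|[|i]]]]]] [|[|[|[|[|[|j]]]]]]; rewrite /= ?andbF.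
Qed.

Lemma q_graph_triangle_branching x y z t a b : uniq [:: x; y; z; t; a; b] ->
  G x y -> G x z -> G x t -> G y z -> G t a -> G t b ->
  (q_graph R G + 2 <= n)%N.
Proof.
move=> us e01 e02 e03 e12 e34 e35.
apply: (@q_graph_table R 5 triangle_branching_table n G x [:: x; y; z; t; a; b] 0 4
  [:: 0; -1; 1; 0; 0; 0] [:: 2; -2; 0; -4; 1; 1]
  [:: -2; -1; -1; 0; 2; 0] [:: -2; -1; -1; 0; 0; 2] 2 5 4 5) => //.
  exact: strong_triangle_branching.
by move=> [|[|[|[|[|[|i]]]]]] [|[|[|[|[|[|j]]]]]]; rewrite /= ?andbF.
Qed.

Lemma q_graph_two_triangles x y z x1 y1 z1 : uniq [:: x; y; z; x1; y1; z1] ->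
  G x y -> G x z -> G y z -> G x1 y1 -> G x1 z1 -> G y1 z1 ->
  (q_graph R G + 2 <= n)%N.
Proof.
move=> us e01 e02 e12 e34 e35 e45.
apply: (@q_graph_table R 5 two_triangles_table n G x [:: x; y; z; x1; y1; z1] 0 1
  [:: -1; 1; 0; 0; 0; 0] [:: -1; 0; 1; 0; 0; 0]
  [:: 0; 0; 0; -1; 1; 0] [:: 0; 0; 0; -1; 0; 1] 1 2 4 5) => //.
  exact: strong_two_triangles.
by move=> [|[|[|[|[|[|i]]]]]] [|[|[|[|[|[|j]]]]]]; rewrite /= ?andbF.
Qed.

Lemma q_graph_triangle_claw x y z u a b c : uniq [:: x; y; z; u; a; b; c] ->
  G x y -> G x z -> G y z -> G u a -> G u b -> G u c ->
  (q_graph R G + 2 <= n)%N.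
Proof.
move=> us e01 e02 e12 e34 e35 e36.
apply: (@q_graph_table R 6 triangle_claw_table n G x [:: x; y; z; u; a; b; c] 0 1
  [:: -1; 1; 0; 0; 0; 0; 0] [:: -1; 0; 1; 0; 0; 0; 0]
  [:: 0; 0; 0; 0; -1; 1; 0] [:: 0; 0; 0; 0; -1; 0; 1] 1 2 5 6) => //.
  exact: strong_triangle_claw.
by move=> [|[|[|[|[|[|[|i]]]]]]] [|[|[|[|[|[|[|j]]]]]]]; rewrite /= ?andbF.
Qed.

Lemma q_graph_two_claws u a b c u1 a1 b1 c1 : uniq [:: u; a; b; c; u1; a1; b1; c1] ->
  G u a -> G u b -> G u c -> G u1 a1 -> G u1 b1 -> G u1 c1 ->
  (q_graph R G + 2 <= n)%N.
Proof.
move=> us e01 e02 e03 e45 e46 e47.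
apply: (@q_graph_table R 7 two_claws_table n G u [:: u; a; b; c; u1; a1; b1; c1] 0 1
  [:: 0; -1; 1; 0; 0; 0; 0; 0] [:: 0; -1; 0; 1; 0; 0; 0; 0]
  [:: 0; 0; 0; 0; 0; -1; 1; 0] [:: 0; 0; 0; 0; 0; -1; 0; 1] 2 3 6 7) => //.
  exact: strong_two_claws.
by move=> [|[|[|[|[|[|[|[|i]]]]]]]] [|[|[|[|[|[|[|[|j]]]]]]]]; rewrite /= ?andbF.
Qed.

End Shapes.

(** * Cycles *)

Section Cycle.
Variables (R : realType) (k : nat).
Local Notation N := k.+4.

Definition cycle_rel (i j : nat) : bool := (i.+1 == j) || (j.+1 == i).

(** The adjacency matrix of the cycle with one edge of negative sign: signs make
    the eigenvalues 2 cos (pi / N) and 2 cos (3 pi / N) double for every N. *)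
Definition cycle_mx : 'M[R]_N := \matrix_(i, j)
  if cycle_rel i j then 1 else
  if (i + j == N.-1)%N && ((i == 0 :> nat) || (j == 0 :> nat)) then -1 else 0.

Lemma cycle_mx_sym : cycle_mx^T = cycle_mx.
Proof.
by apply/matrixP => i j; rewrite !mxE /cycle_rel orbC addnC [X in _ && X]orbC.
Qed.

Lemma cycle_mx_col p (M : 'M[R]_(p, N)) a (j x y : 'I_N) : x != y ->
  (forall i, i != x -> i != y -> cycle_mx i j = 0) ->
  (M *m cycle_mx) a j = M a x * cycle_mx x j + M a y * cycle_mx y j.
Proof.
move=> xy h; rewrite mxE (bigD1 x) //= (bigD1 y) 1?eq_sym //= big1 ?addr0 // => i /andP[ix iy].
by rewrite h // mulr0.
Qed.

Lemma cycle_mx_inner p (M : 'M[R]_(p, N)) a (j x y : 'I_N) :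
  x.+1 = j -> y = j.+1 :> nat -> (M *m cycle_mx) a j = M a x + M a y.
Proof.
move=> xj yj; rewrite (cycle_mx_col _ _ (x := x) (y := y)).
- by rewrite !mxE /cycle_rel yj -xj !eqxx orbT !mulr1.
- by rewrite -val_eqE /= yj -xj; lia.
move=> i; rewrite -!val_eqE /= => ix iy; rewrite mxE /cycle_rel.
by rewrite ifF ?ifF //; have := ltn_ord i; have := ltn_ord y; lia.
Qed.

Lemma cycle_mx_first p (M : 'M[R]_(p, N)) a :
  (M *m cycle_mx) a ord0 = M a (inord 1) - M a ord_max.
Proof.
rewrite (cycle_mx_col _ _ (x := inord 1) (y := ord_max)).
- by rewrite !mxE /cycle_rel !inordK //= addn0 eqxx mulr1 mulrN1.
- by rewrite -val_eqE /= inordK.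
move=> i; rewrite -!val_eqE /= inordK // => ix iy; rewrite mxE /cycle_rel.
by rewrite ifF ?ifF //=; have := ltn_ord i; lia.
Qed.

Lemma cycle_mx_last p (M : 'M[R]_(p, N)) a :
  (M *m cycle_mx) a ord_max = M a (inord k.+2) - M a ord0.
Proof.
rewrite (cycle_mx_col _ _ (x := inord k.+2) (y := ord0)).
- by rewrite !mxE /cycle_rel !inordK //= eqxx mulr1 mulrN1.
- by rewrite -val_eqE /= inordK.
move=> i; rewrite -!val_eqE /= inordK // => ix iy; rewrite mxE /cycle_rel.
by rewrite ifF ?ifF //=; have := ltn_ord i; lia.
Qed.

Lemma cycle_kernel_rec p (M : 'M[R]_(p, N)) (c : R) a i : (i.+2 < N)%N ->
  M *m (cycle_mx - c%:M) = 0 ->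
  M a (inord i.+2) = c * M a (inord i.+1) - M a (inord i).
Proof.
move=> iN; rewrite mulmxBr mul_mx_scalar => /matrixP/(_ a (inord i.+1)).
have e := @cycle_mx_inner p M a (inord i.+1) (inord i) (inord i.+2).
rewrite [RHS]mxE [LHS]mxE e ?inordK //; try exact: ltnW; last by do 2 apply: ltnW.
by rewrite !mxE; lra.
Qed.

(** A row of the kernel is determined by its first two entries. *)
Lemma cycle_kernel_row0 p (M : 'M[R]_(p, N)) (c : R) a :
  M *m (cycle_mx - c%:M) = 0 -> M a ord0 = 0 -> M a (inord 1) = 0 -> forall j, M a j = 0.
Proof.
move=> MB m0 m1.
suff h i : (i < N)%N -> M a (inord i) = 0 by move=> j; rewrite -[j]inord_val h.
suff h2 : (i < N)%N -> M a (inord i) = 0 /\ ((i.+1 < N)%N -> M a (inord i.+1) = 0).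
  by move=> /h2[].
elim: i => [_|i IH iN].
  by split=> // ; rewrite (_ : inord 0 = ord0) //; apply: val_inj; rewrite /= inordK.
have [x0 /(_ iN) y0] := IH (ltnW iN); split=> // iN'.
by rewrite (cycle_kernel_rec _ iN' MB) x0 y0 mulr0 subr0.
Qed.

Lemma cycle_kernel_sym0 (M : 'M[R]_N) (c : R) : M^T = M ->
  M *m (cycle_mx - c%:M) = 0 -> M ord0 ord0 = 0 -> M ord0 (inord 1) = 0 ->
  M (inord 1) (inord 1) = 0 -> M = 0.
Proof.
move=> Ms MB m00 m01 m11.
have Mc i j : M i j = M j i by rewrite -{1}Ms mxE.
have r0 := cycle_kernel_row0 MB m00 m01.
have r1 := cycle_kernel_row0 MB (etrans (Mc _ _) m01) m11.
apply/matrixP => i j; rewrite mxE; apply: (cycle_kernel_row0 MB).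
  by rewrite Mc r0.
by rewrite Mc r1.
Qed.

(** For a normal vector [X], the product [X (B - m)] has zero diagonal and its
    rows satisfy the recurrence of [B - l]; three diagonal zeros then force it
    to vanish as [l] is nonzero, and the same recurrence for [m] kills [X]. *)
Lemma strong_cycle (l m : R) : l != 0 -> strong cycle_mx l m.
Proof.
move=> l0 X Xs X0 XB Xp.
have Xd i : X i i = 0 by apply: X0; rewrite eqxx.
have BC : (cycle_mx - l%:M) *m (cycle_mx - m%:M) = (cycle_mx - m%:M) *m (cycle_mx - l%:M).
  rewrite 2!mulmxBr !mulmxBl !mul_mx_scalar !mul_scalar_mx.
  by apply/matrixP => i j; rewrite !mxE; case: (i == j) => /=; ring.
pose Y := X *m (cycle_mx - m%:M).
have YB : Y *m (cycle_mx - l%:M) = 0 by rewrite -mulmxA -BC.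
have Ys : Y^T = Y.
  by rewrite /Y trmx_mul Xs linearB /= cycle_mx_sym tr_scalar_mx mulmxBr mulmxBl XB
    mul_mx_scalar mul_scalar_mx.
have Yd i : Y i i = 0.
  rewrite mxE big1 // => j _; have [->|ij] := eqVneq i j; first by rewrite Xd mul0r.
  have [b0|b0] := eqVneq (cycle_mx i j) 0; last by rewrite X0 ?b0 ?orbT ?mul0r.
  have -> : (cycle_mx - m%:M) j i = 0; last by rewrite mulr0.
  have bji : cycle_mx j i = 0 by rewrite -cycle_mx_sym mxE.
  by rewrite mxE bji add0r !mxE eq_sym (negPf ij) oppr0.
have Yc i j : Y i j = Y j i by rewrite -{1}Ys mxE.
have z0 : inord 0 = ord0 :> 'I_N by apply: val_inj; rewrite /= inordK.
have step a := @cycle_kernel_rec _ Y l a 0 isT YB; rewrite z0 in step.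
have Y0 : Y = 0.
  apply: (cycle_kernel_sym0 Ys YB) => //.
  have h1 := step (inord 2); rewrite Yd (Yc _ (inord 1)) (Yc _ ord0) !step !Yd (Yc (inord 1))
    in h1.
  have : l * Y ord0 (inord 1) = 0 by lra.
  by move/eqP; rewrite mulf_eq0 (negPf l0) => /eqP.
apply: (cycle_kernel_sym0 Xs Y0) => //; apply: X0.
by rewrite mxE /cycle_rel inordK // oner_eq0 orbT.
Qed.

(** The sequences [sin ((i - c) t)] satisfy the recurrence of the eigenvalue
    [2 cos t], and they change sign after [N] steps, as the negative edge
    requires. *)
Lemma eigenmult_cycle (t : R) : sin t != 0 ->
  (forall a, sin (a + N%:R * t) = - sin a) -> (2 <= eigenmult cycle_mx (2 * cos t)%R)%N.
Proof.
move=> t0 tN; pose x (c i : nat) := sin ((i%:R - c%:R) * t).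
pose V : 'M[R]_(2, N) := \matrix_(c, i) x c i.
have rec (c : nat) (a : R) : sin ((a - 1 - c%:R) * t) + sin ((a + 1 - c%:R) * t) =
    2 * cos t * sin ((a - c%:R) * t).
  rewrite (_ : (a - 1 - c%:R) * t = (a - c%:R) * t - t); last by ring.
  by rewrite (_ : (a + 1 - c%:R) * t = (a - c%:R) * t + t) ?sinB ?sinD; [ring | ring].
have shift (c : nat) (a : R) : sin ((a + N%:R - c%:R) * t) = - sin ((a - c%:R) * t).
  by rewrite -tN; congr sin; ring.
apply: (@eigenmult_ge _ _ _ _ V).
  apply: (@row_free_diag _ _ _ _ (fun c : 'I_2 => if c == 0 then inord 1 else ord0)) => i j.
  rewrite mxE /x; case: i => [[|[|//]] ?]; case: j => [[|[|//]] ?] /=; rewrite ?inordK //.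
  - by rewrite subr0 mul1r t0.
  - by rewrite subrr mul0r sin0 eqxx.
  - by rewrite subrr mul0r sin0 eqxx.
  - by rewrite sub0r mulN1r sinN oppr_eq0 t0.
apply/matrixP => c j; rewrite [RHS]mxE [V c j]mxE.
have [j0|jpos] := posnP j.
  have -> : j = ord0 by apply: val_inj.
  rewrite cycle_mx_first !mxE /x inordK //= -(rec c 0).
  have -> : 0 - 1 - c%:R = k.+3%:R - N%:R - c%:R :> R by rewrite [N%:R]mulrS; ring.
  rewrite addrC add0r; congr (_ + _).
  have := shift c (k.+3%:R - N%:R); rewrite subrK => ->; ring.
have [jl|jl] := eqVneq (val j) N.-1.
  have -> : j = ord_max by apply: val_inj.
  rewrite cycle_mx_last !mxE /x inordK //= -(rec c k.+3%:R).
  congr (_ + _); first by congr (sin ((_ - _) * _)); rewrite [k.+3%:R]mulrS; ring.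
  by rewrite -shift; congr sin; rewrite [N%:R]mulrS [0%:R]mulr0n; ring.
have jN : (j.+1 < N)%N by have := ltn_ord j; rewrite /= in jl; lia.
rewrite (cycle_mx_inner _ _ (x := inord j.-1) (y := inord j.+1)) ?inordK ?prednK //;
  last exact: ltnW.
rewrite !mxE /x !inordK //; last lia.
rewrite -rec; congr (sin ((_ - _) * _) + sin ((_ - _) * _)).
  by rewrite -[in RHS](prednK jpos) [in RHS]mulrS; ring.
by rewrite mulrS; ring.
Qed.
End Cycle.

Lemma q_graph_cycle (R : realType) n (G : sgraph n) (s : seq 'I_n) :
  uniq s -> (4 <= size s)%N -> cycle (adj G) s -> (q_graph R G + 2 <= n)%N.
Proof.
case: s => // x0 s us; case ss : (size (x0 :: s)) => [|[|[|[|k]]]] // _ cs.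
pose f (i : 'I_k.+4) := nth x0 (x0 :: s) i.
have f_inj : injective f.
  by move=> i j /eqP; rewrite nth_uniq ?ss // => /eqP /val_inj.
have adjS i : (i.+1 < k.+4)%N -> G (nth x0 (x0 :: s) i) (nth x0 (x0 :: s) i.+1).
  move=> ik; have /(pathP x0)/(_ i) := cs; rewrite size_rcons -[(size s).+1]/(size (x0 :: s))
    ss.
  rewrite -rcons_cons nth_rcons (ltnW ik) ?ss ?(ltnW ik) nth_rcons => /(_ isT).
  by have -> : (i < size s)%N by move: ss ik => /= [<-].
have adj0 : G (nth x0 (x0 :: s) k.+3) x0.
  have /(pathP x0)/(_ k.+3) := cs; rewrite size_rcons -[(size s).+1]/(size (x0 :: s)) ss.
  rewrite -rcons_cons nth_rcons ss ltnSn nth_rcons => /(_ isT).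
  have -> : size s = k.+3 by case: ss.
  by rewrite ltnn eqxx.
have BG (i j : 'I_k.+4) : i != j -> cycle_mx R k i j != 0 -> G (f i) (f j).
  move=> _; rewrite mxE /cycle_rel; case: ifP => [/orP[/eqP e|/eqP e] _|_].
  - by rewrite /f -e adjS // e ltn_ord.
  - by rewrite adj_sym /f -e adjS // e ltn_ord.
  case: ifP; rewrite ?eqxx // => /andP[/eqP ij /orP[/eqP z|/eqP z]] _.
    by rewrite adj_sym /f; move: ij; rewrite z add0n => -> /=.
  by rewrite /f; move: ij; rewrite z addn0 => -> /=.
have p0 := pi_gt0 R.
have N0 : 0 < k.+4%:R :> R by rewrite ltr0n.
have N4 : 4 <= k.+4%:R :> R by rewrite ler_nat.
pose t : R := pi / k.+4%:R.
have tN : k.+4%:R * t = pi by rewrite mulrC divfK ?gt_eqF.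
have t0 : 0 < t by rewrite divr_gt0.
have t4 : 4 * t <= pi by rewrite -tN ler_wpM2r // ltW.
have s1 : sin t != 0 by rewrite gt_eqF // sin_gt0_pi // t0; lra.
have s3 : sin (3 * t) != 0 by rewrite gt_eqF // sin_gt0_pi //; lra.
have c1 : 0 < cos t by apply: cos_gt0_pihalf; lra.
have c13 : cos (3 * t) < cos t.
  by rewrite ltr_cos ?in_itv /=; lra.
have sp a : sin (a + k.+4%:R * t) = - sin a by rewrite tN sinDpi.
have sp3 a : sin (a + k.+4%:R * (3 * t)) = - sin a.
  rewrite mulrCA tN (_ : a + 3 * pi = a + pi + pi + pi); last by ring.
  by rewrite !sinDpi opprK.
have l0 : 2 * cos t != 0 by rewrite gt_eqF // mulr_gt0.
have lm : 2 * cos t != 2 * cos (3 * t) by rewrite gt_eqF // ltr_pM2l.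
have := q_graph_embedding2 (cycle_mx_sym R k) f_inj BG (@strong_cycle R k _ _ l0) lm.
have := eigenmult_cycle s1 sp; have := eigenmult_cycle s3 sp3.
move: (eigenmult _ _) (eigenmult _ _) => u v; lia.
Qed.

(** * One double eigenvalue *)

Definition triangle_table : seq (seq int) := nseq 3 (nseq 3 1).

Lemma strong_triangle (R : realType) (l m : R) : strong (table_mx R 2 triangle_table) l m.
Proof. by apply: strong_table => y _ [|[|[|i]]] [|[|[|j]]]; rewrite /= ?andbF. Qed.

Definition has_triangle_or_claw n (G : sgraph n) (s : seq 'I_n) : bool :=
  match s with
  | [:: x; y; z] => [&& uniq s, G x y, G x z & G y z]
  | [:: u; a; b; c] => [&& uniq s, G u a, G u b & G u c]
  | _ => false
  end.

(** The triangle with unit diagonal and the claw with zero diagonal both have a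
    double eigenvalue 0, which an isolated vertex turns into a triple one. *)
Lemma q_graph_triangle_or_claw (R : realType) n (G : sgraph n) s :
  has_triangle_or_claw G s ->
  (q_graph R G + 1 <= n)%N /\
  forall z, (forall j, ~~ G z j) -> z \notin s -> (q_graph R G + 2 <= n)%N.
Proof.
have key k c x0 u v p q : table_sym k c -> strong (table_mx R k c) 0 0 ->
    eigen_pair k c 0 u v p q -> uniq s -> size s = k.+1 ->
    (forall i j, (i < j <= k)%N -> entry c i j != 0 -> G (nth x0 s i) (nth x0 s j)) ->
    (q_graph R G + 1 <= n)%N /\
    forall z, (forall j, ~~ G z j) -> z \notin s -> (q_graph R G + 2 <= n)%N.
  move=> cs sB e0 us ss sG.
  have [f_inj BG] := nth_embedding R us ss cs sG.
  have e2 := eigenmult_table R e0; split=> [|z Gz zs].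
    have := q_graph_embedding1 (table_mx_sym R cs) f_inj BG sB.
    by move: (eigenmult _ _) e2 => a; lia.
  have zf : z \notin codom (fun i : 'I_k.+1 => nth x0 s i).
    by apply: contra zs => /codomP[i ->]; rewrite mem_nth // ss.
  have := q_graph_embedding_isolated (table_mx_sym R cs) f_inj BG sB Gz zf.
  by move: (eigenmult _ _) e2 => a; lia.
case: s key => [|x [|y [|z [|t [|? ?]]]]] //= key /and4P[us e1 e2 e3].
  apply: (key 2%N triangle_table x [:: 1; -1; 0] [:: 1; 0; -1] 1%N 2%N) => //.
    exact: strong_triangle.
  by move=> [|[|[|i]]] [|[|[|j]]]; rewrite /= ?andbF.
apply: (key 3%N claw_table x [:: 0; 1; -1; 0] [:: 0; 1; 0; -1] 2%N 3%N) => //.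
  exact: strong_claw.
by move=> [|[|[|[|i]]]] [|[|[|[|j]]]]; rewrite /= ?andbF.
Qed.

(** * Longest paths *)

Ltac distinct := rewrite /= ?inE ?negb_or ?andbT; repeat (apply/andP; split).

Section Degree4.
Variables (R : realType) (n : nat) (G : sgraph n).

(** With an edge between two neighbours, four edges at [u] and that edge give two
    double eigenvalues. Otherwise the neighbours are in distinct components of
    [G - u], since a path between them would close up to a long cycle. *)
Lemma q_graph_degree4 (u a b c d : 'I_n) : uniq [:: a; b; c; d] ->
  G u a -> G u b -> G u c -> G u d -> (q_graph R G + 2 <= n)%N.
Proof.
move=> us ua ub uc ud.
have neq x : G u x -> u != x by apply: contraTneq => <-; rewrite adj_irr.
have [na nb nc nd] := And4 (neq _ ua) (neq _ ub) (neq _ uc) (neq _ ud).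
have := us; rewrite /= !inE !negb_or !andbT.
case/and3P=> /and3P[ab ac ad] /andP[bc bd] cd.
have key x y z t : G u x -> G u y -> G u z -> G u t -> uniq [:: u; x; y; z; t] ->
    G x y -> (q_graph R G + 2 <= n)%N.
  by move=> *; apply: (@q_graph_fourfold_with_edge R n G u x y z t).
have [e|eab] := boolP (G a b).
  by apply: (key a b c d) => //; distinct => //; rewrite eq_sym.
have [e|eac] := boolP (G a c).
  by apply: (key a c b d) => //; distinct => //; rewrite eq_sym.
have [e|ead] := boolP (G a d).
  by apply: (key a d b c) => //; distinct => //; rewrite eq_sym.
have [e|ebc] := boolP (G b c).
  by apply: (key b c a d) => //; distinct => //; rewrite eq_sym.
have [e|ebd] := boolP (G b d).
  by apply: (key b d a c) => //; distinct => //; rewrite eq_sym.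
have [e|ecd] := boolP (G c d).
  by apply: (key c d a b) => //; distinct => //; rewrite eq_sym.
pose A (k : 'I_4) := nth a [:: a; b; c; d] k.
have uA k : G u (A k) by case: k => [[|[|[|[|//]]]] ?].
have Au k : A k != u by rewrite eq_sym neq.
have A_inj : injective A.
  by move=> k l /eqP; rewrite nth_uniq // => /eqP /val_inj.
have noedge k l : ~~ G (A k) (A l).
  by case: k => [[|[|[|[|//]]]] ?]; case: l => [[|[|[|[|//]]]] ?];
    rewrite /A /= ?adj_irr // adj_sym.
pose e := [rel x y | [&& G x y, x != u & y != u]].
have e_sym : connect_sym e.
  by apply: sym_connect_sym => x y /=; rewrite adj_sym [X in _ && X]andbC.
have [/forallP conn|] := boolP [forall k, forall l, connect e (A k) (A l) ==> (k == l)].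
  have {}conn k l : connect e (A k) (A l) -> k = l.
    by move=> kl; have /forallP/(_ l) := conn k; rewrite kl => /eqP.
  apply: (@q_graph_cut4 R n G u (fun k x => (x != u) && connect e (A k) x) A) => //.
  - by move=> k; rewrite eqxx.
  - move=> k i j iu ju ij /andP[_ ki]; rewrite ju; apply: connect_trans ki _.
    by apply: connect1; rewrite /= ij iu.
  - move=> k l i /andP[_ ki] /andP[_ li]; apply: conn.
    by apply: connect_trans ki _; rewrite e_sym.
  - by move=> k; rewrite Au connect0.
  - by move=> k; rewrite adj_sym.
move=> /forallPn[k /forallPn[l]]; rewrite negb_imply => /andP[/connectP[p0 pe0 lp] kl].
case/shortenP: pe0 lp => p pe up _ lp.
have pu : u \notin p.
  apply/negP => uin; have /(pathP u)/(_ (index u p)) := pe.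
  by rewrite index_mem uin nth_index //= eqxx !andbF => /(_ isT).
have pG : path (adj G) (A k) p by apply: sub_path pe => x y /= /andP[].
apply: (@q_graph_cycle R n G (u :: A k :: p)).
- by rewrite cons_uniq inE negb_or neq // pu up.
- case: p lp {pe up pu} pG => [|x [|y p]] //= lp.
    by rewrite (A_inj _ _ lp) eqxx in kl.
  by rewrite andbT -lp (negPf (noedge k l)).
- by rewrite /= uA rcons_path pG -lp adj_sym uA.
Qed.
End Degree4.

Section LongestPath.
Variables (R : realType) (n : nat) (G : sgraph n).
Implicit Types (u w x y z : 'I_n) (P s : seq 'I_n).

Definition longest_path P : Prop :=
  [/\ uniq P, sorted (adj G) P &
      forall s, uniq s -> sorted (adj G) s -> (size s <= size P)%N].

Lemma longest_path_exists : exists P, longest_path P.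
Proof.
pose A m := [exists t : m.-tuple 'I_n, uniq t && sorted (adj G) t].
have A0 : exists m, A m by exists 0%N; apply/existsP; exists [tuple].
have An m : A m -> (m <= n)%N.
  move=> /existsP[t /andP[ut _]]; rewrite -(size_tuple t) -(card_uniqP ut).
  by rewrite -[n in (_ <= n)%N]card_ord max_card.
have [m /existsP[t /andP[ut st]] mmax] := ex_maxnP A0 An.
exists t; split=> // s us ss; rewrite size_tuple; apply: mmax.
by apply/existsP; exists (in_tuple s); rewrite us.
Qed.

Lemma longest_path_rev P : longest_path P -> longest_path (rev P).
Proof.
move=> [uP sP mP]; split; rewrite ?rev_uniq ?size_rev // rev_sorted.
by apply: sub_sorted sP => x y; rewrite adj_sym.
Qed.

Lemma longest_path_start x s w : longest_path (x :: s) -> w \notin x :: s -> ~~ G w x.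
Proof.
move=> [uP sP mP] wP; apply/negP => wx.
by have := mP (w :: x :: s); rewrite cons_uniq wP uP /= wx ltnn; move/(_ isT sP).
Qed.

(** The path that starts with [w'], [w] and skips [x] would be longer. *)
Lemma longest_path_second x y s w w' : longest_path (x :: y :: s) ->
  uniq [:: w', w, x, y & s] -> G w y -> ~~ G w' w.
Proof.
move=> [uP sP mP] uw wy; apply/negP => ww.
have := mP [:: w', w, y & s]; rewrite [sorted _ _]/= ww wy ltnn.
move: sP => /= /andP[_ sP] h; suff : false by []. apply: h => //.
rewrite -/(uniq [:: w', w, y & s]); apply: (subseq_uniq _ uw).
exact: (cat_subseq (subseq_refl [:: w'; w]) (subseq_cons (y :: s) x)).
Qed.

(** With the edge [xz], the path [w, y, x, z] would be a longer start. *)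
Lemma longest_path_start_triangle x y z s w : longest_path [:: x, y, z & s] ->
  uniq [:: w, x, y, z & s] -> G w y -> ~~ G x z.
Proof.
move=> [uP sP mP] uw wy; apply/negP => xz.
move: sP => /= /and3P[xy yz sP].
have := mP [:: w, y, x, z & s]; rewrite /= wy xz adj_sym xy ltnn => h.
suff : false by []. apply: h => //.
rewrite -/(uniq [:: w, y, x, z & s]) (perm_uniq (s2 := [:: w, x, y, z & s])) //.
by apply/permP => e /=; lia.
Qed.

Lemma longest_path_insert s1 x y s2 w : longest_path (s1 ++ [:: x, y & s2]) ->
  w \notin s1 ++ [:: x, y & s2] -> G w x -> ~~ G w y.
Proof.
move=> [uP sP mP] wP wx; apply/negP => wy.
have := mP (s1 ++ [:: x, w, y & s2]).
have -> : size (s1 ++ [:: x, w, y & s2]) = (size (s1 ++ [:: x, y & s2])).+1.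
  by rewrite !size_cat /= !addnS.
rewrite ltnn => h; suff : false by []. apply: h => //.
  rewrite (perm_uniq (s2 := w :: (s1 ++ [:: x, y & s2]))) ?cons_uniq ?wP //.
  by apply/permP => e; rewrite /= !count_cat /=; lia.
move: sP; case: s1 {uP mP wP} => [|a s1] /=.
  by move=> /andP[_ ->]; rewrite wy adj_sym wx.
rewrite !cat_path /= => /and4P[-> -> _ ->].
by rewrite wy adj_sym wx.
Qed.

End LongestPath.

(** * Graphs with q at least the order minus one *)

(** Adjacency patterns of an enumeration of the vertices: a path; a path with
    the chord [k, k + 2]; a path on all vertices but the last, which is joined
    to [k] only; the same with the last vertex isolated. *)
Definition path_pattern (i j : nat) : bool := j == i.+1.
Definition chord_pattern (k i j : nat) : bool := (j == i.+1) || ((i == k) && (j == k.+2)).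
Definition leaf_pattern (n k i j : nat) : bool := if j == n.-1 then i == k else j == i.+1.
Definition isolated_pattern (n i j : nat) : bool := (j != n.-1) && (j == i.+1).

Section LeftEnd.
Variables (n : nat) (G : sgraph n) (x0 : 'I_n) (P : seq 'I_n).
Hypothesis hP : longest_path G P.
Local Notation v := (nth x0 P).

Lemma longest_path_end0 w : (0 < size P)%N -> w \notin P -> ~~ G w (v 0).
Proof.
move=> P0; have e := drop_nth x0 P0; rewrite drop0 in e.
move=> wP; apply: (@longest_path_start _ G _ (drop 1 P)); first by rewrite -e.
by rewrite -e.
Qed.

Lemma longest_path_end1 w w' : (1 < size P)%N -> w \notin P -> w' \notin P -> w' != w ->
  G w (v 1) -> ~~ G w' w.
Proof.
move=> P1 wP w'P ww; have e := drop_nth x0 (ltnW P1).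
rewrite drop0 (drop_nth x0 P1) in e.
apply: (@longest_path_second _ G (v 0) (v 1) (drop 2 P)); first by rewrite -e.
have [uP _ _] := hP.
by rewrite 2!cons_uniq in_cons negb_or ww -!e wP w'P uP.
Qed.

Lemma longest_path_end_triangle w : (2 < size P)%N -> w \notin P ->
  G w (v 1) -> ~~ G (v 0) (v 2).
Proof.
move=> P2 wP; have e := drop_nth x0 (ltnW (ltnW P2)).
rewrite drop0 (drop_nth x0 (ltnW P2)) (drop_nth x0 P2) in e.
apply: (@longest_path_start_triangle _ G (v 0) (v 1) (v 2) (drop 3 P) w); first by rewrite -e.
have [uP _ _] := hP.
by rewrite cons_uniq -!e wP uP.
Qed.

Lemma longest_path_consecutive w i : (i.+1 < size P)%N -> w \notin P ->
  G w (v i) -> ~~ G w (v i.+1).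
Proof.
move=> Pi wP; have e := cat_take_drop i P.
rewrite (drop_nth x0 (ltnW Pi)) (drop_nth x0 Pi) in e.
by apply: (@longest_path_insert _ G (take i P) (v i) _ (drop i.+2 P)); rewrite e.
Qed.

End LeftEnd.

Section Structure.
Variables (R : realType) (n : nat) (G : sgraph n) (x0 : 'I_n) (P : seq 'I_n).
Hypothesis tight : ~ (q_graph R G + 2 <= n)%N.
Hypothesis hP : longest_path G P.
Local Notation v := (nth x0 P).
Local Notation L := (size P).

Let hR := longest_path_rev hP.

Let vR i : (i < L)%N -> nth x0 (rev P) (L - i.+1) = v i.
Proof. by move=> iL; rewrite nth_rev; [congr nth; lia | lia]. Qed.

Let v_adj i : (i.+1 < L)%N -> G (v i) (v i.+1).
Proof. by move=> iL; have [_ /(sortedP x0)/(_ _ iL)] := hP. Qed.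

Let v_neq i j : (i < L)%N -> (j < L)%N -> i != j -> v i != v j.
Proof. by move=> iL jL; have [uP _ _] := hP; rewrite nth_uniq. Qed.

Let out_neq w i : w \notin P -> (i < L)%N -> w != v i.
Proof. by move=> wP iL; apply: contraNneq wP => ->; rewrite mem_nth. Qed.

Let seg_path i m : (i + m < L)%N -> path (adj G) (v i) (map v (iota i.+1 m)).
Proof.
elim: m i => //= m IH i im; rewrite v_adj ?IH //; lia.
Qed.

Let seg_last i m : last (v i) (map v (iota i.+1 m)) = v (i + m).
Proof. by elim: m i => [|m IH] i /=; rewrite ?addn0 // IH addSnnS. Qed.

Let seg_uniq i m : (i + m < L)%N -> uniq (map v (iota i m.+1)).
Proof.
move=> im; rewrite map_inj_in_uniq ?iota_uniq // => a b.
rewrite !mem_iota addnS => /andP[_ a1] /andP[_ b1] /eqP.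
by have [uP _ _] := hP; rewrite nth_uniq ?(leq_trans a1) ?(leq_trans b1) // => /eqP.
Qed.

(** A longer chord would close a cycle of length at least four. *)
Let chord i j : (i < j)%N -> (j < L)%N -> G (v i) (v j) -> (j <= i.+2)%N.
Proof.
move=> ij jL Gij; rewrite leqNgt; apply/negP => h; apply: tight.
apply: (@q_graph_cycle R n G (map v (iota i (j - i).+1))).
- by apply: seg_uniq; lia.
- by rewrite size_map size_iota; lia.
- rewrite /= rcons_path seg_path ?seg_last; last lia.
  by rewrite subnKC 1?ltnW //= adj_sym.
Qed.

Ltac index_lia :=
  clear tight; repeat match goal with
  | H : is_true (adj _ _ _) |- _ => clear H
  | H : is_true (_ \notin _) |- _ => clear H
  | H : is_true (nth _ _ _ != _) |- _ => clear H
  end; lia.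

Ltac solve_neq :=
  lazymatch goal with
  | |- is_true (nth _ _ _ != nth _ _ _) => apply: v_neq; index_lia
  | |- is_true (nth _ _ _ != _) => rewrite eq_sym; apply: out_neq; [done | index_lia]
  | |- is_true (_ != nth _ _ _) => apply: out_neq; [done | index_lia]
  | |- _ => by rewrite eq_sym
  end.

Section Outsider.
Variables (w : 'I_n) (i : nat).
Hypotheses (wP : w \notin P) (iL : (i < L)%N) (wi : G w (v i)).

Lemma out_inner : (0 < i)%N && (i.+1 < L)%N.
Proof.
apply/andP; split.
  rewrite lt0n; apply/eqP => i0; have := longest_path_end0 x0 hP (leq_ltn_trans (leq0n i) iL)
    wP.
  by rewrite -i0 wi.
rewrite ltn_neqAle iL andbT; apply/eqP => iL1.
have LR : (0 < size (rev P))%N by rewrite size_rev; index_lia.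
have := @longest_path_end0 n G x0 (rev P) hR w LR; rewrite mem_rev => /(_ wP).
by have := vR iL; rewrite iL1 subnn => ->; rewrite wi.
Qed.

Lemma out_unique j : (j < L)%N -> G w (v j) -> j = i.
Proof.
have key a b : (a < b)%N -> (b < L)%N -> G w (v a) -> ~~ G w (v b).
  move=> ab bL wa; apply/negP => wb.
  have [b1|b2] := eqVneq b a.+1.
    by move: wb; apply/negP; rewrite b1; apply: longest_path_consecutive; rewrite -?b1.
  apply: tight; apply: (@q_graph_cycle R n G (w :: map v (iota a (b - a).+1))).
  - rewrite cons_uniq seg_uniq ?andbT; last lia.
    apply/mapP => -[c]; rewrite mem_iota => /andP[_ c1] wc; case/negP: wP.
    by rewrite wc mem_nth //; apply: leq_trans c1 _; rewrite addnS subnKC // ltnW.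
  - by rewrite /= size_map size_iota; index_lia.
  - rewrite /= rcons_path seg_path ?seg_last; last lia.
    by rewrite wa subnKC 1?ltnW //= adj_sym.
move=> jL wj; case: (ltngtP i j) => [h|h|->] //.
  by have := key i j h jL wi; rewrite wj.
by have := key j i h iL wj; rewrite wi.
Qed.

(** If [w] is attached next to an end of the path, the leg through [w] gives a
    longer path; otherwise three legs of length two meet at [v i]. *)
Lemma out_no_leg w' : w' \notin P -> w' != w -> ~~ G w' w.
Proof.
move=> w'P ww; apply/negP => Gww; have /andP[i0 iL1] := out_inner.
have i1 : i != 1%N.
  apply/eqP => e; have := longest_path_end1 hP (x0 := x0) _ wP w'P ww.
  by rewrite -e iL wi Gww => /(_ isT isT).
have iL2 : i.+2 != L.
  apply/eqP => e; have e1 : (L - i.+1)%N = 1%N by lia.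
  have := vR iL; rewrite e1 => e2; have L1 : (1 < L)%N by lia.
  have := @longest_path_end1 n G x0 (rev P) hR w w'.
  by rewrite size_rev !mem_rev e2 wi Gww => /(_ L1 wP w'P ww isT).
apply: tight; apply: (@q_graph_spider222 R n G (v i) w w' (v i.-1) (v i.-2) (v i.+1) (v i.+2)).
- by distinct; solve_neq.
- by rewrite adj_sym.
- by rewrite adj_sym; have := @v_adj i.-1; rewrite prednK //; apply.
- by rewrite v_adj.
- by rewrite adj_sym.
- by rewrite adj_sym; have := @v_adj i.-2; rewrite prednK; [apply; lia | lia].
- by rewrite v_adj //; index_lia.
Qed.

End Outsider.

Let v_adj' i : (0 < i)%N -> (i < L)%N -> G (v i) (v i.-1).
Proof. by move=> i0 iL; rewrite adj_sym; have := @v_adj i.-1; rewrite prednK //; apply. Qed.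

(** Two branching vertices of the path: the shape depends on their distance, from
    a vertex of degree four to two disjoint claws. *)
Let two_out w i w' j : w \notin P -> w' \notin P -> w' != w -> (i < L)%N -> (j < L)%N ->
  G w (v i) -> G w' (v j) -> False.
Proof.
wlog ij : w i w' j / (i <= j)%N => [H wP w'P ww iL jL wi w'j|].
  have [ij|ji] := leqP i j; first exact: (H w i w' j).
  by apply: (H w' j w i) => //; [exact: ltnW | rewrite eq_sym].
move=> wP w'P ww iL jL wi w'j; apply: tight.
have /andP[i0 iL1] := out_inner wP iL wi; have /andP[j0 jL1] := out_inner w'P jL w'j.
have iw : G (v i) w by rewrite adj_sym.
have jw : G (v j) w' by rewrite adj_sym.
have [e|i_j] := eqVneq j i.
  rewrite {}e in w'j jw *.
  apply: (@q_graph_degree4 R n G (v i) (v i.-1) (v i.+1) w w'); rewrite ?v_adj' ?v_adj //;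
    try index_lia.
  by distinct; solve_neq.
have [e|i_j1] := eqVneq j i.+1.
  apply: (@q_graph_adjacent_branchings R n G (v i) w (v i.-1) (v j) w' (v j.+1));
    rewrite ?v_adj' ?v_adj //; try index_lia; first by distinct; solve_neq.
  by rewrite e v_adj.
have [e|i_j2] := eqVneq j i.+2.
  apply: (@q_graph_branchings_distance2 R n G (v i) w (v i.-1) (v i.+1) (v j) w' (v j.+1));
    rewrite ?v_adj' ?v_adj //; try index_lia; first by distinct; solve_neq.
  by rewrite e v_adj //; index_lia.
apply: (@q_graph_two_claws R n G (v i) w (v i.-1) (v i.+1) (v j) w' (v j.-1) (v j.+1));
  rewrite ?v_adj' ?v_adj //; try index_lia.
by distinct; solve_neq.
Qed.

(** A chord far from the branching vertex leaves a triangle disjoint from a claw;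
    nearer, the chord and the leg form one of the other shapes or a longer path. *)
Let out_chordless w i a : w \notin P -> (i < L)%N -> G w (v i) -> (a.+2 < L)%N ->
  ~~ G (v a) (v a.+2).
Proof.
move=> wP iL wi aL; apply/negP => ga.
have /andP[i0 iL1] := out_inner wP iL wi.
have iw : G (v i) w by rewrite adj_sym.
have ga' : G (v a.+2) (v a) by rewrite adj_sym.
have a1 : G (v a) (v a.+1) by apply: v_adj; index_lia.
have a2 : G (v a.+1) (v a.+2) by apply: v_adj.
have a1' : G (v a.+1) (v a) by rewrite adj_sym.
have a2' : G (v a.+2) (v a.+1) by rewrite adj_sym.
have [far|] := boolP ((a.+4 <= i) || (i.+2 <= a))%N.
  apply: tight; apply: (@q_graph_triangle_claw R n G (v a) (v a.+1) (v a.+2)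
    (v i) w (v i.-1) (v i.+1)); rewrite ?v_adj' ?v_adj //; try index_lia.
  by case/orP: far => ?; distinct; solve_neq.
rewrite negb_or -!ltnNge => near.
have [e|i3] := eqVneq i a.+3.
  apply: tight; apply: (@q_graph_triangle_branching R n G (v a.+2) (v a.+1) (v a)
    (v i) w (v i.+1)); rewrite ?v_adj' ?v_adj //; try index_lia.
    by distinct; solve_neq.
  by rewrite e v_adj // -e.
have [e|i2] := eqVneq i a.+2.
  apply: tight; apply: (@q_graph_degree4 R n G (v i) (v a) (v i.-1) (v i.+1) w);
    rewrite ?v_adj' ?v_adj //; try index_lia; last by rewrite e.
  by distinct; solve_neq.
have [e|i_1] := eqVneq a i.+1.
  apply: tight; apply: (@q_graph_triangle_branching R n G (v a) (v a.+1) (v a.+2)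
    (v i) w (v i.-1)); rewrite ?v_adj' ?v_adj //; try index_lia.
    by distinct; solve_neq.
  by rewrite e adj_sym v_adj.
have [e|i_0] := eqVneq a i.
  apply: tight; apply: (@q_graph_degree4 R n G (v i) (v a.+2) (v i.-1) (v i.+1) w);
    rewrite ?v_adj' ?v_adj //; try index_lia; last by rewrite -e.
  by distinct; solve_neq.
have ia : i = a.+1 by index_lia.
have [a0|apos] := posnP a.
  have := @longest_path_end_triangle n G x0 P hP w.
  by rewrite -a0 ga -ia wi wP ia => /(_ aL isT isT).
have [aL3|aL3] := eqVneq a.+3 L.
  have LR : (2 < size (rev P))%N by rewrite size_rev; index_lia.
  have [k0 k1 k2] : [/\ L - a.+3 = 0, L - a.+2 = 1 & L - a.+1 = 2]%N.
    by split; index_lia.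
  have h0 := vR aL; have h1 := vR (ltnW aL); have h2 := vR (ltnW (ltnW aL)).
  rewrite k0 in h0; rewrite k1 in h1; rewrite k2 in h2.
  have := @longest_path_end_triangle n G x0 (rev P) hR w LR.
  by rewrite h0 h1 h2 mem_rev ga' -ia wi => /(_ wP isT).
apply: tight; apply: (@q_graph_net R n G (v i) (v a) (v a.+2) w (v a.-1) (v a.+3));
  rewrite ?v_adj' ?v_adj //; try index_lia; try (by rewrite ia).
by distinct; solve_neq.
Qed.

(** Depending on their distance, two chords form a cycle of length four, a vertex
    of degree four or two disjoint triangles. *)
Let chord_unique a b : (a < b)%N -> (b.+2 < L)%N ->
  G (v a) (v a.+2) -> ~~ G (v b) (v b.+2).
Proof.
move=> ab bL ga; apply/negP => gb; apply: tight.
have [e|b1] := eqVneq b a.+1.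
  apply: (@q_graph_cycle R n G [:: v a; v a.+2; v a.+3; v a.+1]) => //.
    by distinct; solve_neq.
  rewrite /= ga v_adj ?[G (v a.+1) _]adj_sym ?v_adj ?[G (v a.+3) _]adj_sym -?e ?gb //;
    index_lia.
have [e|b2] := eqVneq b a.+2.
  apply: (@q_graph_degree4 R n G (v b) (v a) (v b.-1) (v b.+1) (v b.+2));
    rewrite ?v_adj' ?v_adj //; try index_lia; last by rewrite adj_sym e.
  by distinct; solve_neq.
apply: (@q_graph_two_triangles R n G (v a) (v a.+1) (v a.+2) (v b) (v b.+1) (v b.+2));
  rewrite ?v_adj //; try index_lia.
by distinct; solve_neq.
Qed.

Let not_adj_chordless a b : (forall a, (a.+2 < L)%N -> ~~ G (v a) (v a.+2)) ->
  (a < b)%N -> (b < L)%N -> G (v a) (v b) = (b == a.+1).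
Proof.
move=> nochord ab bL; have [->|b1] := eqVneq b a.+1; first by rewrite v_adj //; index_lia.
apply/negP => gab; have b2 := chord ab bL gab.
have e : b = a.+2 by index_lia.
by have := nochord a; rewrite -e bL gab => /(_ isT).
Qed.

(** What is not connected to the path and [w] either contains an edge, which has
    both eigenvalues 0 and 1 in common with a matrix of the rest, or is isolated
    and adds to the double eigenvalue of the claw at [v i]. *)
Let outsider_only w i : w \notin P -> (i < L)%N -> G w (v i) ->
  forall z, z \notin P -> z = w.
Proof.
move=> wP iL wi z zP; apply/eqP/negPn/negP => zw; apply: tight.
have /andP[i0 iL1] := out_inner wP iL wi.
pose C x := (x \in P) || (x == w).
have CN x y : C x -> ~~ C y -> ~~ G x y.
  rewrite /C negb_or => Cx /andP[yP yw]; case/orP: Cx => [/(nthP x0)[j jL <-]|/eqP ->].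
    by apply/negP; rewrite adj_sym => yj; apply: (two_out wP yP yw iL jL wi yj).
  by rewrite adj_sym; apply: (out_no_leg wP iL wi).
have Cz : ~~ C z by rewrite /C negb_or zP zw.
have [/existsP[y zy]|/existsPn zN] := boolP [exists y, G z y].
  have Cy : ~~ C y by apply/negP => Cy; have := CN y z Cy Cz; rewrite adj_sym zy.
  apply: (@q_graph_two_parts R n G C w (v i) z y) => //; rewrite /C ?eqxx ?orbT //.
  by rewrite mem_nth.
have claw : has_triangle_or_claw G [:: v i; w; v i.-1; v i.+1].
  rewrite /has_triangle_or_claw v_adj' // v_adj // adj_sym wi !andbT.
  by distinct; solve_neq.
have [_ h] := q_graph_triangle_or_claw R claw.
by apply: (h z zN); rewrite !inE !negb_or zw !out_neq //; index_lia.
Qed.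

Let size_all (s : seq 'I_n) : uniq s -> (forall x, x \in s) -> size s = n.
Proof.
move=> us sA; rewrite -(card_uniqP us) -[RHS]card_ord; apply: eq_card => x.
by rewrite sA inE.
Qed.

(** Suppose [q G >= n - 1]. The vertices outside the longest path [P] are either a
    single leaf attached to an inner vertex, and then [P] has no chord, or not
    connected to [P]. In the second case there is at most one such vertex, since two
    of them, adjacent or isolated, save two eigenvalues; and with one, a chord of [P]
    would give a triangle beside an isolated vertex. If [P] covers the graph, it has
    at most one chord. *)
Lemma longest_path_structure : exists s, uniq s /\ size s = n /\
  exists e : nat -> nat -> bool,
    (forall i j, (i < j < n)%N -> G (nth x0 s i) (nth x0 s j) = e i j) /\
    [\/ e =2 path_pattern, exists2 k, (k.+2 < n)%N & e =2 chord_pattern k,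
        exists2 i, (0 < i)%N && (i.+2 < n)%N & e =2 leaf_pattern n i
      | (1 < n)%N /\ e =2 isolated_pattern n].
Proof.
have [uP sP mP] := hP.
have [/forallP allP|/forallPn[w wP]] := boolP [forall x, x \in P].
  have Ln := size_all uP allP; exists P; split=> //; split=> //.
  have [/existsP[k /andP[kL gk]]|/existsPn nochord] :=
      boolP [exists k : 'I_n, (k.+2 < L)%N && G (v k) (v k.+2)].
    exists (chord_pattern k); split; last by constructor 2; exists k => //;
      apply: leq_trans kL _; rewrite Ln.
    move=> i j /andP[ij jn]; rewrite -Ln in jn; rewrite /chord_pattern.
    have [->|j1] := eqVneq j i.+1; first by rewrite v_adj //; index_lia.
    have [gij|gij] := boolP (G (v i) (v j)); last first.
      by symmetry; apply: contraNF gij => /andP[/eqP -> /eqP ->].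
    have j2 := chord ij jn gij; have e : j = i.+2 by index_lia.
    rewrite e in gij jn *.
    case: (ltngtP i k) => [h|h|->]; last by rewrite eqxx.
      by have := chord_unique h kL gij; rewrite gk.
    by have := chord_unique h jn gk; rewrite gij.
  exists path_pattern; split; last by constructor 1.
  move=> i j /andP[ij jn]; apply: not_adj_chordless => //; last by rewrite Ln.
  move=> a aL; have an : (a < n)%N by rewrite -Ln; index_lia.
  by have := nochord (Ordinal an); rewrite aL.
have last_nth y : nth x0 (rcons P y) L = y by rewrite nth_rcons ltnn eqxx.
have [/existsP[i wi]|/existsPn wN] := boolP [exists i : 'I_L, G w (v i)].
  have wonly := outsider_only wP (ltn_ord i) wi.
  have us : uniq (rcons P w) by rewrite rcons_uniq wP.
  have sA x : x \in rcons P w.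
    by rewrite mem_rcons inE; case: (boolP (x \in P)) => [_|/wonly ->]; rewrite ?orbT ?eqxx.
  have Ln := size_all us sA; rewrite size_rcons in Ln.
  have nL : n.-1 = L by symmetry; exact: (congr1 (fun k => k.-1) Ln).
  have /andP[i0 iL1] := out_inner wP (ltn_ord i) wi.
  exists (rcons P w); rewrite us size_rcons Ln; split=> //; split=> //.
  exists (leaf_pattern n i); split; last first.
    by constructor 3; exists i => //; rewrite i0; exact: leq_trans (iL1 : (i.+2 < L.+1)%N)
      (eq_leq Ln).
  move=> a b /andP[ab bn]; rewrite /leaf_pattern nL; have [->|bL] := eqVneq b L.
    have aL : (a < L)%N by index_lia.
    rewrite last_nth nth_rcons aL adj_sym; apply/idP/eqP => [|->] //.
    exact: (out_unique wP (ltn_ord i) wi).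
  have bL' : (b < L)%N by index_lia.
  rewrite !nth_rcons bL' (ltn_trans ab bL'); apply: not_adj_chordless => //.
  by move=> c; exact: (out_chordless wP (ltn_ord i) wi).
have L0 : (0 < L)%N by have := mP [:: x0] isT isT.
have PN z x : z \notin P -> x \in P -> ~~ G z x.
  move=> zP /(nthP x0)[i iL <-]; apply/negP => zi.
  have out y : y \notin P -> y = z := outsider_only zP iL zi (z := y).
  by have := wN (Ordinal iL); rewrite (out w wP) zi.
have isolated z : z \notin P -> forall y, ~~ G z y.
  move=> zP y; apply/negP => zy; apply: tight.
  have yP : y \notin P by apply: contraTN zy => yP; exact: PN.
  have L1 : (1 < L)%N.
    have zney : z != y by apply: contraTneq zy => ->; rewrite adj_irr.
    by have := mP [:: z; y]; rewrite /= inE zney zy => /(_ isT isT).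
  apply: (@q_graph_two_parts R n G (mem P) (v 0) (v 1) z y) => //=.
  - by rewrite mem_nth.
  - by rewrite mem_nth.
  - by rewrite v_adj.
  - by move=> a b aP bP; rewrite adj_sym PN.
have wonly z : z \notin P -> z = w.
  move=> zP; apply/eqP/negPn/negP => zw; apply: tight.
  by apply: (@q_graph_isolated2 R n G z w (v 0)); rewrite ?zw // 1?eq_sym ?out_neq //;
    exact: isolated.
have us : uniq (rcons P w) by rewrite rcons_uniq wP.
have sA x : x \in rcons P w.
  by rewrite mem_rcons inE; case: (boolP (x \in P)) => [_|/wonly ->]; rewrite ?orbT ?eqxx.
have Ln := size_all us sA; rewrite size_rcons in Ln.
have nL : n.-1 = L by symmetry; exact: (congr1 (fun k => k.-1) Ln).
have nochord a : (a.+2 < L)%N -> ~~ G (v a) (v a.+2).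
  move=> aL; apply/negP => ga; apply: tight.
  have tri : has_triangle_or_claw G [:: v a; v a.+1; v a.+2].
    rewrite /has_triangle_or_claw ga !v_adj ?andbT //; try index_lia.
    by distinct; solve_neq.
  have [_ h] := q_graph_triangle_or_claw R tri.
  apply: (h w (isolated w wP)); rewrite !inE !negb_or !out_neq //; index_lia.
exists (rcons P w); rewrite us size_rcons Ln; split=> //; split=> //.
exists (isolated_pattern n); split; last first.
  by constructor 4; split=> //; exact: leq_trans (L0 : (1 < L.+1)%N) (eq_leq Ln).
move=> a b /andP[ab bn]; rewrite /isolated_pattern nL; have [->|bL] := eqVneq b L.
  have aL : (a < L)%N by index_lia.
  by rewrite last_nth nth_rcons aL adj_sym; apply/negbTE/isolated.
have bL' : (b < L)%N by index_lia.
by rewrite !nth_rcons bL' (ltn_trans ab bL'); apply: not_adj_chordless.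
Qed.

End Structure.

(** * Complements of sparse graphs from vectors in dimension three *)

Section Vectors.
Variable R : realType.

Definition vec : Type := (R * R * R)%type.

Definition dot (u v : vec) : R := u.1.1 * v.1.1 + u.1.2 * v.1.2 + u.2 * v.2.

Definition cross (u v : vec) : vec :=
  (u.1.2 * v.2 - u.2 * v.1.2, u.2 * v.1.1 - u.1.1 * v.2, u.1.1 * v.1.2 - u.1.2 * v.1.1).

Definition vec0 : vec := (0, 0, 0).

Lemma dotC u v : dot u v = dot v u.
Proof. by rewrite /dot; ring. Qed.

Lemma cross_neq0C u v : cross u v != vec0 -> cross v u != vec0.
Proof.
apply: contraNneq; rewrite /cross => -[e1 e2 e3].
by apply/eqP; congr (_, _, _); [move: e1 | move: e2 | move: e3] => e; rewrite -[RHS]oppr0 -e;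
  ring.
Qed.

Lemma dot_self_eq0 u : dot u u = 0 -> u = vec0.
Proof.
case: u => [[a b] c]; rewrite /dot /= => h.
have [ha [hb hc]] := (sqr_ge0 a, (sqr_ge0 b, sqr_ge0 c)).
rewrite !expr2 in ha hb hc; congr (_, _, _); apply/eqP; rewrite -sqrf_eq0 expr2; apply/eqP; lra.
Qed.

Lemma dot_neq0 u v : dot u v != 0 -> u != vec0.
Proof. by apply: contraNneq => ->; rewrite /dot /= !mul0r !addr0. Qed.

(** Points of the moment curve eventually leave any plane. *)
Lemma generic_vector (zs : seq vec) : all (fun z => z != vec0) zs ->
  exists r : vec, all (fun z => dot r z != 0) zs.
Proof.
move=> zs0; pose f (z : vec) := z.1.1%:P + z.1.2 *: 'X + z.2 *: 'X^2 : {poly R}.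
have fE z t : (f z).[t] = dot (1, t, t ^+ 2) z.
  by rewrite /f !hornerE /dot /=; ring.
pose F := \prod_(z <- zs) f z.
have F0 : F != 0.
  rewrite /F prodf_seq_neq0; apply: sub_all zs0 => z z0; apply: contraNneq z0 => fz.
  case: z fz => [[a b] c] fz; apply/eqP; rewrite /vec0.
  have coefz i : (f (a, b, c))`_i = 0 by rewrite fz coef0.
  have := coefz 0%N; have := coefz 1%N; have := coefz 2%N.
  rewrite /f !coefD !coefZ !coefC !coefX !coefXn /= !(mulr0, mulr1, addr0, add0r).
  by move=> -> -> ->.
have [t Ft] : exists t, F.[t] != 0.
  apply: contrapT => h; pose ts := [seq i%:R : R | i <- iota 0 (size F)].
  have : (size ts < size F)%N.
    apply: max_poly_roots => //.
      apply/allP => t _; rewrite rootE; apply/negPn/negP => Ft; apply: h; by exists t.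
    by rewrite map_inj_uniq ?iota_uniq // => i j /eqP; rewrite eqr_nat => /eqP.
  by rewrite size_map size_iota ltnn.
exists (1, t, t ^+ 2); apply/allP => z zz; rewrite -fE.
apply: contraNneq Ft => fz; rewrite /F horner_prod.
by apply/eqP; rewrite (big_rem z) //= fz mul0r.
Qed.

Section Extend.
Variables (n : nat) (E : rel nat).
Hypothesis E_sym : symmetric E.

(** The vectors realize the graph [E] on [D] by orthogonality; no two of them
    are parallel, so that further neighbours can be attached to any of them. *)
Definition realizes (D : pred nat) (p : nat -> vec) : Prop :=
  forall i j, (i < n)%N -> (j < n)%N -> D i -> D j -> i != j ->
    (dot (p i) (p j) == 0) = E i j /\ cross (p i) (p j) != vec0.

(** A vertex [v] with no neighbour in [D] gets a vector [r] generic with respect to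
    all vectors and all their cross products. With one neighbour, of vector [c],
    it gets the cross product of [c] and [r]: it is orthogonal to [c], and its
    products with the other vectors [z] are [- r . (c x z)], hence nonzero. *)
Lemma realizes_extend (D : pred nat) (p : nat -> vec) (v i0 i1 : nat) :
  realizes D p -> (i0 < n)%N -> (i1 < n)%N -> D i0 -> D i1 -> i0 != i1 ->
  ~~ D v -> (exists u, forall y, (y < n)%N -> D y -> E v y -> y = u) ->
  exists2 p', (forall y, D y -> p' y = p y) & realizes (predU1 v D) p'.
Proof.
move=> Dp i0n i1n D0 D1 i01 Dv [u uE].
pose ds := [seq y <- iota 0 n | D y].
have dsP y : y \in ds = (y < n)%N && D y by rewrite mem_filter mem_iota add0n andbC.
pose zs := [seq p y | y <- ds] ++ [seq cross (p x) (p y) | x <- ds,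
  y <- [seq y <- ds | y != x]].
have other y : (y < n)%N -> D y -> exists2 x, (x < n)%N && D x & y != x.
  move=> yn Dy; have [->|yi] := eqVneq y i0; first by exists i1; rewrite ?i1n.
  by exists i0; rewrite ?i0n.
have p0 y : (y < n)%N -> D y -> p y != vec0.
  move=> yn Dy; have [x /andP[xn Dx] yx] := other y yn Dy.
  have [_] := Dp y x yn xn Dy Dx yx; apply: contraNneq => ->.
  by rewrite /cross /vec0 /= !mul0r !subrr.
have zs0 : all (fun z => z != vec0) zs.
  rewrite all_cat; apply/andP; split; apply/allP => z.
    by move=> /mapP[y]; rewrite dsP => /andP[yn Dy] ->; exact: p0.
  move=> /allpairsPdep[x [y [xd]]]; rewrite mem_filter => /andP[yx yd] ->.
  move: xd yd; rewrite !dsP => /andP[xn Dx] /andP[yn Dy].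
  by have [] := Dp x y xn yn Dx Dy; rewrite 1?eq_sym.
have [r /allP rz] := generic_vector zs0.
have rp y : (y < n)%N -> D y -> dot r (p y) != 0.
  by move=> yn Dy; apply: rz; rewrite mem_cat map_f ?dsP ?yn.
have rc x y : (x < n)%N -> (y < n)%N -> D x -> D y -> x != y -> dot r (cross (p x) (p y)) != 0.
  move=> xn yn Dx Dy xy; apply: rz; rewrite mem_cat; apply/orP; right.
  by apply/allpairsPdep; exists x, y; rewrite mem_filter !dsP xn yn Dx Dy eq_sym xy.
suff [q qP] : exists q, forall y, (y < n)%N -> D y ->
    (dot q (p y) == 0) = E v y /\ cross q (p y) != vec0.
  exists (fun y => if y == v then q else p y).
    by move=> y Dy; case: eqP => // yv; rewrite -yv Dy in Dv.
  move=> i j iN jN; rewrite !inE.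
  case: (eqVneq i v) => [->|iv]; case: (eqVneq j v) => [->|jv] /=; rewrite ?eqxx //.
  - by move=> _ Dj _; exact: qP.
  - move=> Di _ _; have [h1 h2] := qP i iN Di; rewrite dotC h1 E_sym; split=> //.
    exact: cross_neq0C.
  - by move=> Di Dj ij; exact: Dp.
have crossE (a b c : vec) : dot a (cross b c) = dot (cross a b) c.
  by rewrite /dot /cross /=; ring.
have [/existsP[u' /andP[Du Eu]]|/existsPn noE] := boolP [exists u' : 'I_n, D u' && E v u'];
  last first.
  exists r => y yn Dy; split.
    rewrite (negPf (rp y yn Dy)); apply/esym/negbTE.
    by have := noE (Ordinal yn); rewrite Dy.
  have [x /andP[xn Dx] yx] := other y yn Dy.
  by apply: (@dot_neq0 _ (p x)); rewrite -crossE; exact: rc.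
have un := ltn_ord u'; have uu := uE u' un Du Eu.
set c := p u'.
exists (cross c r) => y yn Dy.
have e1 : dot (cross c r) (p y) = - dot r (cross c (p y)).
  by rewrite /dot /cross /=; ring.
have e2 : dot (cross (cross c r) (p y)) (cross c (p y)) = dot r (cross c (p y)) * dot c (p y).
  by rewrite /dot /cross /=; ring.
have [yu|yu] := eqVneq y u'.
  split.
    by rewrite yu Eu -/c; apply/eqP; rewrite /dot /cross /=; ring.
  have [x /andP[xn Dx] yx] := other y yn Dy.
  apply: (@dot_neq0 _ (cross c (p x))); rewrite yu -/c.
  have -> : dot (cross (cross c r) c) (cross c (p x)) = dot r (cross c (p x)) * dot c c.
    by rewrite /dot /cross /=; ring.
  rewrite mulf_neq0 //; first by rewrite rc // -yu.
  apply/eqP => /dot_self_eq0 c0; have := rp u' un Du; rewrite -/c c0.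
  by rewrite /dot /= !mulr0 !addr0 eqxx.
have rcy : dot r (cross c (p y)) != 0 by rewrite rc // eq_sym.
split.
  rewrite e1 oppr_eq0 (negPf rcy); apply/esym/negbTE/negP => Ey.
  by rewrite uu (uE y yn Dy Ey) eqxx in yu.
have [cy|cy] := eqVneq (dot c (p y)) 0; last by apply: (dot_neq0 (v := cross c (p y)));
  rewrite e2 mulf_neq0.
have -> : cross (cross c r) (p y) = (- dot r (p y) * c.1.1, - dot r (p y) * c.1.2,
  - dot r (p y) * c.2).
  rewrite /cross /=; congr (_, _, _).
  - by rewrite -[RHS]addr0 -[X in _ = _ + X](mulr0 r.1.1) -[X in r.1.1 * X]cy /dot; ring.
  - by rewrite -[RHS]addr0 -[X in _ = _ + X](mulr0 r.1.2) -[X in r.1.2 * X]cy /dot; ring.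
  - by rewrite -[RHS]addr0 -[X in _ = _ + X](mulr0 r.2) -[X in r.2 * X]cy /dot; ring.
have := p0 u' un Du; rewrite -/c; apply: contraNneq => -[/eqP h1 /eqP h2 /eqP h3].
move: h1 h2 h3; rewrite !mulf_eq0 !oppr_eq0 !(negPf (rp y yn Dy)) /=.
by case: (c) => [[a b] d] /= /eqP -> /eqP -> /eqP ->.
Qed.

End Extend.
End Vectors.

Section Frames.
Variable R : realType.
Local Notation vec := (vec R).
Implicit Types (p q : vec).

Definition vcomp (v : vec) (a : 'I_3) : R := nth 0 [:: v.1.1; v.1.2; v.2] a.

Lemma dot_vcomp (u v : vec) : dot u v = \sum_a vcomp u a * vcomp v a.
Proof. by rewrite !big_ord_recl big_ord0 /vcomp /dot /= addr0 addrA. Qed.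

(** Six vectors whose squares form a basis of the quadratic forms, and a positive
    combination of these squares that is diagonal. *)
Definition frame_base (P : seq vec) (c : seq R) (d : seq R) : Prop :=
  [/\ size P = 6%N, size c = 6%N /\ size d = 3%N, all (fun x => 0 < x) c,
    forall a a', \sum_(k <- iota 0 6) c`_k * (vcomp (nth (vec0 R) P k) a * vcomp (nth (vec0 R)
      P k) a')
      = d`_a *+ (a == a') &
    forall q, exists t : nat -> R, forall a a',
      \sum_(k <- iota 0 6) t k * (vcomp (nth (vec0 R) P k) a * vcomp (nth (vec0 R) P k) a')
      = vcomp q a * vcomp q a'].

Lemma small_multiplier (I : finType) (c b : I -> R) : (forall k, 0 < c k) ->
  exists2 e : R, 0 < e & forall k, 0 < c k - e * b k.
Proof.
move=> c0; exists (\big[Num.min/1]_k (c k / (1 + `|b k|))).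
  by apply: lt_bigmin => // k _; rewrite divr_gt0 // ltr_wpDr.
move=> k; have b1 : 0 < 1 + `|b k| by rewrite ltr_wpDr.
have := @bigmin_le_cond _ _ _ 1 k xpredT (fun k => c k / (1 + `|b k|)) isT.
have : 0 < \big[Num.min/1]_k (c k / (1 + `|b k|)).
  by apply: lt_bigmin => // i _; rewrite divr_gt0 // ltr_wpDr.
move: (\big[_/_]_k _) => e e0; rewrite ler_pdivlMr // mulrDr mulr1 => h.
have : e * b k <= e * `|b k| by rewrite ler_pM2l // ler_norm.
by rewrite subr_gt0; lra.
Qed.

(** The weights of the base absorb small weights on all other vectors. *)
Lemma frame_weights n (p : nat -> vec) (b : seq nat) P c d :
  frame_base P c d -> uniq b -> size b = 6%N -> {subset b <= iota 0 n} ->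
  (forall k, (k < 6)%N -> p (nth 0%N b k) = nth (vec0 R) P k) ->
  exists2 w : nat -> R, (forall i, 0 < w i) &
    forall a a', \sum_(i < n) w i * (vcomp (p i) a * vcomp (p i) a') = d`_a *+ (a == a').
Proof.
move=> [sP [sc _] c0 cd span] ub sb bn pb.
have iota6 (F : nat -> R) : \sum_(k <- iota 0 6) F k = \sum_(k < 6) F k.
  by rewrite -(big_mkord xpredT F) /index_iota subn0.
have [t ht] := choice (fun i => span (p i)).
pose beta (k : 'I_6) := \sum_(i <- iota 0 n | i \notin b) t i k.
have c0' (k : 'I_6) : 0 < c`_k by move/allP: c0; apply; rewrite mem_nth // sc.
have [e e0 he] := small_multiplier beta c0'.
pose w i := if (insub (index i b) : option 'I_6) is Some k then c`_k - e * beta k else e.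
have wb (k : 'I_6) : w (nth 0%N b k) = c`_k - e * beta k.
  by rewrite /w index_uniq ?sb // valK.
have wnb i : i \notin b -> w i = e.
  by move=> ib; rewrite /w memNindex // insubF // sb.
exists w => [i|a a'].
  by rewrite /w; case: insub => [k|//]; exact: he.
rewrite -(big_mkord xpredT (fun i => w i * (vcomp (p i) a * vcomp (p i) a'))) /index_iota subn0.
rewrite (bigID (mem b)) /= -big_filter.
rewrite (perm_big b) /=; last first.
  apply: uniq_perm => //; first by rewrite filter_uniq ?iota_uniq.
  by move=> i; rewrite mem_filter; case: (boolP (i \in b)) => //= ib; exact: bn.
rewrite (big_nth 0%N) sb big_mkord.
rewrite (eq_bigr (fun k : 'I_6 =>
  c`_k * (vcomp (nth (vec0 R) P k) a * vcomp (nth (vec0 R) P k) a') -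
  e * (beta k * (vcomp (nth (vec0 R) P k) a * vcomp (nth (vec0 R) P k) a')))); last first.
  by move=> k _; rewrite wb pb // mulrBl -(mulrA e).
rewrite sumrB.
rewrite -(iota6 (fun k => c`_k * (vcomp (nth (vec0 R) P k) a * vcomp (nth (vec0 R) P k) a'))).
rewrite cd -mulr_sumr.
rewrite (eq_bigr (fun i => e * (vcomp (p i) a * vcomp (p i) a'))); last by move=> i /wnb ->.
rewrite -mulr_sumr; set X := \sum_(k < 6) _; set Y := \sum_(i <- _ | _) _.
have -> : X = Y; last by rewrite subrK.
rewrite /X; under eq_bigr do rewrite mulr_suml.
by rewrite exchange_big /=; apply: eq_bigr => i _; rewrite -ht iota6.
Qed.

Section FrameMatrix.
Variables (n : nat) (G : sgraph n) (p : 'I_n -> vec) (w : 'I_n -> R) (d : seq R).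
Hypothesis d3 : size d = 3%N.
Hypothesis w0 : forall x, 0 < w x.
Hypothesis pG : forall x y, x != y -> (dot (p x) (p y) == 0) = G x y.
Hypothesis pd : forall a a', \sum_x w x * (vcomp (p x) a * vcomp (p x) a') = d`_a *+ (a == a').

(** With [B] the matrix of the vectors scaled by the square roots of the weights,
    [B B^T] has the zero pattern of the complement, and its nonzero eigenvalues
    are those of [B^T B], which is diagonal. *)
Lemma q_graph_compl_frame (S : seq R) :
  {subset 0 :: d <= S} -> (q_graph R (compl_graph G) <= size S)%N.
Proof.
move=> dS; pose B : 'M[R]_(n, 3) := \matrix_(x, a) (Num.sqrt (w x) * vcomp (p x) a).
have BB : B^T *m B = diag_mx (\row_a d`_a).
  apply/matrixP => a a'; rewrite !mxE -pd; apply: eq_bigr => x _; rewrite !mxE.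
  by rewrite mulrACA -expr2 sqr_sqrtr // ltW.
have GA : SG R (compl_graph G) (B *m B^T).
  split=> [|x y xy]; first by rewrite trmx_mul trmxK.
  rewrite /= /compl_rel xy -pG // dot_vcomp.
  have -> : (B *m B^T) x y = (Num.sqrt (w x) * Num.sqrt (w y)) * \sum_a vcomp (p x)
    a * vcomp (p y) a.
    by rewrite mulr_sumr !mxE; apply: eq_bigr => a _; rewrite !mxE mulrACA.
  have sw z : (Num.sqrt (w z) == 0) = false by rewrite gt_eqF // sqrtr_gt0.
  by rewrite 2!mulf_eq0 !sw.
apply: leq_trans (q_graph_le GA) _; apply: q_mx_le_roots => l /eigenvalueP[v vA v0].
apply: dS; rewrite inE; have [//|l0] := eqVneq l 0.
pose u := v *m B.
have uD : u *m diag_mx (\row_a d`_a) = l *: u by rewrite -BB mulmxA -(mulmxA v) vA -scalemxAl.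
have u0 : u != 0.
  apply: contraNneq v0 => u0; have : l *: v = 0 by rewrite -vA mulmxA -/u u0 mul0mx.
  by move/eqP; rewrite scaler_eq0 (negPf l0).
have [a ua] : exists a, u 0 a != 0.
  apply/existsP; apply: contraNT u0 => /existsPn h.
  by apply/eqP/rowP => a; rewrite [RHS]mxE; have := h a; rewrite negbK => /eqP.
have /rowP/(_ a) := uD; rewrite mul_mx_diag !mxE -/u => e.
have {e} : u 0 a * d`_a = l * u 0 a by move: e; rewrite !mxE.
by rewrite mulrC => /(mulIf ua) <-; rewrite orbC mem_nth // d3.
Qed.

End FrameMatrix.

End Frames.

(** * Explicit frames on six vertices *)

Section SixVertices.
Variable R : realType.
Local Notation vec := (vec R).

Definition frame_realizes (P : seq vec) (e : nat -> nat -> bool) : Prop :=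
  forall i j, (i < j < 6)%N ->
    (dot (nth (vec0 R) P i) (nth (vec0 R) P j) == 0) = e i j /\
    cross (nth (vec0 R) P i) (nth (vec0 R) P j) != vec0 R.

(** The coefficients [t x y z] write the square of the linear form [(x, y, z)] in
    terms of the six given squares. *)
Lemma frame_base_check (P : seq vec) (c d : seq R) (t : R -> R -> R -> seq R) :
  size P = 6%N -> size c = 6%N /\ size d = 3%N -> all (fun x => 0 < x) c ->
  (forall a a', \sum_(k <- iota 0 6) c`_k *
     (vcomp (nth (vec0 R) P k) a * vcomp (nth (vec0 R) P k) a') = d`_a *+ (a == a')) ->
  (forall x y z a a', \sum_(k <- iota 0 6) (t x y z)`_k *
     (vcomp (nth (vec0 R) P k) a * vcomp (nth (vec0 R) P k) a')
     = vcomp (x, y, z) a * vcomp (x, y, z) a') ->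
  frame_base P c d.
Proof.
move=> hP hcd c0 cd ht; split=> // -[[x y] z].
by exists (fun k => (t x y z)`_k) => a a'; exact: ht.
Qed.

Ltac check_frame_base t :=
  apply: (@frame_base_check _ _ _ t) => //;
  [ by rewrite /= ?andbT; repeat (apply/andP; split); lra
  | by move=> [[|[|[|a]]] ha] [[|[|[|a']]] ha'] //; rewrite unlock /vcomp /=; ring
  | by move=> x y z [[|[|[|a]]] ha] [[|[|[|a']]] ha'] //; rewrite unlock /vcomp /=; field ].

Ltac check_frame_realizes :=
  move=> [|[|[|[|[|[|i]]]]]] [|[|[|[|[|[|j]]]]]]; rewrite /= ?andbF // => _;
  (split; last by apply/eqP; rewrite /cross /vec0 /= => -[h1 h2 h3]; lra);
  rewrite /dot /=; first [apply/eqP; ring | apply/negbTE/eqP => h; lra].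

(** Here the positive combination is a scalar, so that the Gram matrix has a
    single nonzero eigenvalue. *)
Definition path_frame : seq vec :=
  [:: (1, 0, 1); (-1, -2, 1); (-2, 1, 0); (0, 0, -1); (-1, 0, 0); (0, -1, -1)].

Lemma path_frame_base :
  frame_base path_frame [:: 1; 1; 1; 3; 1; 2] [:: 7; 7; 7].
Proof.
check_frame_base (fun x y z : R =>
  [:: (2 * (y * y) + (x * y) + 14 * (x * z) - 2 * (y * z)) / 14;
  (2 * (y * y) + (x * y) - 2 * (y * z)) / 14;
  ((y * y) - 3 * (x * y) - (y * z)) / 7;
  (-4 * (y * y) + 7 * (z * z) - 2 * (x * y) - 7 * (x * z) - 3 * (y * z)) / 7;
  (7 * (x * x) - 6 * (y * y) + 11 * (x * y) - 7 * (x * z) + 6 * (y * z)) / 7;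
  (2 * (y * y) + (x * y) + 5 * (y * z)) / 7]).
Qed.

Lemma path_frame_realizes : frame_realizes path_frame path_pattern.
Proof. check_frame_realizes. Qed.

Definition isolated_frame : seq vec :=
  [:: (2, 1, -1); (0, -1, -1); (1, 0, 0); (0, 1, 0); (1, 0, 1); (2, -1, 0)].

Lemma isolated_frame_base :
  frame_base isolated_frame [:: 1; 1; 2; 1; 2; 1] [:: 12; 4; 4].
Proof.
check_frame_base (fun x y z : R =>
  [:: ((z * z) - (x * z) - (y * z)) / 4;
  ((z * z) - (x * z) + 3 * (y * z)) / 4;
  (2 * (x * x) - 5 * (z * z) + 4 * (x * y) + 3 * (x * z) + 5 * (y * z)) / 2;
  (4 * (y * y) - 3 * (z * z) + 2 * (x * y) + 3 * (x * z) - (y * z)) / 4;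
  ((z * z) + (x * z) - (y * z)) / 2;
  ((z * z) - 2 * (x * y) - (x * z) - (y * z)) / 4]).
Qed.

Lemma isolated_frame_realizes : frame_realizes isolated_frame (isolated_pattern 6).
Proof. check_frame_realizes. Qed.

Definition leaf1_frame : seq vec :=
  [:: (0, -1, 0); (-1, 0, 1); (1, -1, 1); (0, -1, -1); (-1, -1, 1); (-1, -1, -1)].

Lemma leaf1_frame_base :
  frame_base leaf1_frame [:: 2; 2; 2; 2; 1; 1] [:: 6; 8; 8].
Proof.
check_frame_base (fun x y z : R =>
  [:: (2 * (x * x) + 2 * (y * y) - 3 * (z * z) - (x * y) - (x * z) + (y * z)) / 2;
  (2 * (x * x) - (z * z) - (x * y) - (x * z) + (y * z)) / 2;
  ((z * z) - (x * y) + (x * z) - (y * z)) / 4;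
  -1 * (x * x) + (z * z);
  (-1 * (x * x) + (z * z) + (x * y) - (y * z)) / 2;
  (2 * (x * x) - (z * z) + (x * y) + (x * z) + (y * z)) / 4]).
Qed.

Lemma leaf1_frame_realizes : frame_realizes leaf1_frame (leaf_pattern 6 1).
Proof. check_frame_realizes. Qed.

Definition leaf2_frame : seq vec :=
  [:: (0, -1, 1); (0, -1, -1); (1, -1, 1); (1, 1, 0); (1, -1, 0); (-1, 0, 1)].

Lemma leaf2_frame_base :
  frame_base leaf2_frame [:: 1; 2; 1; 2; 1; 1] [:: 5; 7; 5].
Proof.
check_frame_base (fun x y z : R =>
  [:: (-1 * (x * x) + (y * y) - (x * z) - (y * z)) / 2;
  (-1 * (x * x) + (y * y) + 2 * (z * z) + (x * z) + 3 * (y * z)) / 6;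
  ((x * x) - (y * y) + (z * z) + 2 * (x * z)) / 3;
  (2 * (x * x) + (y * y) - (z * z) + 3 * (x * y) + (x * z)) / 6;
  ((y * y) - (z * z) - (x * y) - (x * z)) / 2;
  ((x * x) - (y * y) + (z * z) - (x * z)) / 3]).
Qed.

Lemma leaf2_frame_realizes : frame_realizes leaf2_frame (leaf_pattern 6 2).
Proof. check_frame_realizes. Qed.

Definition chord0_frame : seq vec :=
  [:: (-1, 0, -1); (1, 2, -1); (-1, 1, 1); (1, 1, 0); (-1, 1, -1); (0, 1, 1)].

Lemma chord0_frame_base :
  frame_base chord0_frame [:: 2; 1; 2; 1; 1; 1] [:: 7; 9; 7].
Proof.
check_frame_base (fun x y z : R =>
  [:: ((x * x) - 3 * (y * y) + 4 * (z * z) + 2 * (x * y) - (x * z) - (y * z)) / 4;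
  (-1 * (x * x) - (y * y) + 4 * (z * z) + 2 * (x * y) - 3 * (x * z) - 3 * (y * z)) / 12;
  (2 * (x * x) - (y * y) + (z * z) - (x * y) - 3 * (x * z)) / 6;
  ((x * x) + (y * y) - 2 * (z * z) + (x * z) + (y * z)) / 2;
  ((y * y) - (z * z) - (x * y) + (x * z)) / 2;
  (-1 * (x * x) + (y * y) + (x * z) + (y * z)) / 2]).
Qed.

Lemma chord0_frame_realizes : frame_realizes chord0_frame (chord_pattern 0).
Proof. check_frame_realizes. Qed.

Definition chord1_frame : seq vec :=
  [:: (0, 1, 1); (0, 1, -1); (2, -1, -1); (1, 1, 1); (1, 0, -1); (-1, 0, -1)].

Lemma chord1_frame_base :
  frame_base chord1_frame [:: 1; 4; 1; 2; 1; 1] [:: 8; 8; 10].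
Proof.
check_frame_base (fun x y z : R =>
  [:: (-1 * (x * x) + (z * z) - (x * y) + (y * z)) / 2;
  ((y * y) - (y * z)) / 2;
  ((x * x) + (y * y) - (z * z) - (x * y)) / 6;
  ((x * x) + (y * y) - (z * z) + 2 * (x * y)) / 3;
  (-1 * (y * y) + (z * z) + (x * y) - (x * z)) / 2;
  (-1 * (y * y) + (z * z) - (x * y) + (x * z)) / 2]).
Qed.

Lemma chord1_frame_realizes : frame_realizes chord1_frame (chord_pattern 1).
Proof. check_frame_realizes. Qed.

(** Mirror image of [leaf1_frame], for a branching vertex near the end of the
    path; likewise [chord2_frame] and [chord3_frame] for [chord1_frame] and
    [chord0_frame]. *)
Definition leaf3_frame : seq vec :=
  [:: (-1, -1, 1); (0, -1, -1); (1, -1, 1); (-1, 0, 1); (0, -1, 0); (-1, -1, -1)].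

Lemma leaf3_frame_base :
  frame_base leaf3_frame [:: 1; 2; 2; 2; 2; 1] [:: 6; 8; 8].
Proof.
check_frame_base (fun x y z : R =>
  [:: (-1 * (x * x) + (z * z) + (x * y) - (y * z)) / 2;
  -1 * (x * x) + (z * z);
  ((z * z) - (x * y) + (x * z) - (y * z)) / 4;
  (2 * (x * x) - (z * z) - (x * y) - (x * z) + (y * z)) / 2;
  (2 * (x * x) + 2 * (y * y) - 3 * (z * z) - (x * y) - (x * z) + (y * z)) / 2;
  (2 * (x * x) - (z * z) + (x * y) + (x * z) + (y * z)) / 4]).
Qed.

Lemma leaf3_frame_realizes : frame_realizes leaf3_frame (leaf_pattern 6 3).
Proof. check_frame_realizes. Qed.

Definition chord2_frame : seq vec :=
  [:: (-1, 0, -1); (1, 0, -1); (1, 1, 1); (2, -1, -1); (0, 1, -1); (0, 1, 1)].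

Lemma chord2_frame_base :
  frame_base chord2_frame [:: 1; 1; 2; 1; 4; 1] [:: 8; 8; 10].
Proof.
check_frame_base (fun x y z : R =>
  [:: (-1 * (y * y) + (z * z) - (x * y) + (x * z)) / 2;
  (-1 * (y * y) + (z * z) + (x * y) - (x * z)) / 2;
  ((x * x) + (y * y) - (z * z) + 2 * (x * y)) / 3;
  ((x * x) + (y * y) - (z * z) - (x * y)) / 6;
  ((y * y) - (y * z)) / 2;
  (-1 * (x * x) + (z * z) - (x * y) + (y * z)) / 2]).
Qed.

Lemma chord2_frame_realizes : frame_realizes chord2_frame (chord_pattern 2).
Proof. check_frame_realizes. Qed.

Definition chord3_frame : seq vec :=
  [:: (0, 1, 1); (-1, 1, -1); (1, 1, 0); (-1, 1, 1); (1, 2, -1); (-1, 0, -1)].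

Lemma chord3_frame_base :
  frame_base chord3_frame [:: 1; 1; 1; 2; 1; 2] [:: 7; 9; 7].
Proof.
check_frame_base (fun x y z : R =>
  [:: (-1 * (x * x) + (y * y) + (x * z) + (y * z)) / 2;
  ((y * y) - (z * z) - (x * y) + (x * z)) / 2;
  ((x * x) + (y * y) - 2 * (z * z) + (x * z) + (y * z)) / 2;
  (2 * (x * x) - (y * y) + (z * z) - (x * y) - 3 * (x * z)) / 6;
  (-1 * (x * x) - (y * y) + 4 * (z * z) + 2 * (x * y) - 3 * (x * z) - 3 * (y * z)) / 12;
  ((x * x) - 3 * (y * y) + 4 * (z * z) + 2 * (x * y) - (x * z) - (y * z)) / 4]).
Qed.

Lemma chord3_frame_realizes : frame_realizes chord3_frame (chord_pattern 3).
Proof. check_frame_realizes. Qed.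

End SixVertices.

(** * Growing a frame along a path *)

Section Growth.
Variables (R : realType) (n : nat) (G : sgraph n) (x0 : 'I_n) (s : seq 'I_n).
Hypotheses (us : uniq s) (ss : size s = n).
Local Notation vec := (vec R).

Let E : rel nat := fun i j => G (nth x0 s i) (nth x0 s j).

Let E_sym : symmetric E.
Proof. by move=> i j; rewrite /E adj_sym. Qed.

Lemma realizes_sub (D D' : pred nat) (p : nat -> vec) :
  realizes n E D p -> (forall y, D' y -> D y) -> realizes n E D' p.
Proof. by move=> Dp DD i j iN jN Di Dj; apply: Dp => //; exact: DD. Qed.

Definition window (sp : pred nat) (a b : nat) : pred nat :=
  [pred y | (a <= y < b)%N || sp y].

Section Window.
Variables (sp : pred nat) (N a b : nat).
Hypotheses (ab : (a.+1 < b)%N) (bN : (b <= N)%N) (Nn : (N <= n)%N).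
Hypothesis spN : forall y, sp y -> (N <= y)%N.
(** Outside the window every vertex is only adjacent to its two neighbours on the
    path, of which just one has been placed when its turn comes. *)
Hypothesis E_out : forall v y, (v < N)%N -> ~~ (a <= v < b)%N -> (y < n)%N -> E v y ->
  (y < N)%N && ((y.+1 == v) || (v.+1 == y)).

Let grow_right (p : nat -> vec) k : realizes n E (window sp a b) p -> (b + k <= N)%N ->
  exists2 p' : nat -> vec, (forall y, window sp a b y -> p' y = p y) &
    realizes n E (window sp a (b + k)) p'.
Proof.
move=> Dp; elim: k => [|k IH] bk; first by exists p; rewrite ?addn0.
have [|p1 p1p D1] := IH; first by lia.
have vN : (b + k < N)%N by lia.
have [|||||||p2 p2p D2] := @realizes_extend R n E E_sym _ p1 (b + k)%N a a.+1 D1.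
- by lia.
- by lia.
- by rewrite /window inE; lia.
- by rewrite /window inE; lia.
- by lia.
- by rewrite /window inE; apply/negP => /orP[|/spN]; lia.
- exists (b + k).-1 => y yn; rewrite /window inE => Dy Ey.
  have := E_out vN _ yn Ey; case/orP: Dy => [|/spN] h; lia.
exists p2 => [y Dy|].
  rewrite p2p ?p1p //; move: Dy; rewrite /window !inE => /orP[h|->]; last by rewrite orbT.
  by apply/orP; left; lia.
apply: realizes_sub D2 _ => y; rewrite /window !inE => /orP[h|->]; last by rewrite !orbT.
by rewrite orbA; apply/orP; left; lia.
Qed.

Let grow_left (p : nat -> vec) k : realizes n E (window sp a N) p -> (k <= a)%N ->
  exists2 p' : nat -> vec, (forall y, window sp a N y -> p' y = p y) &
    realizes n E (window sp (a - k) N) p'.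
Proof.
move=> Dp; elim: k => [|k IH] ka; first by exists p; rewrite ?subn0.
have [|p1 p1p D1] := IH; first by lia.
have vN : (a - k.+1 < N)%N by lia.
have [|||||||p2 p2p D2] := @realizes_extend R n E E_sym _ p1 (a - k.+1)%N a a.+1 D1.
- by lia.
- by lia.
- by rewrite /window inE; lia.
- by rewrite /window inE; lia.
- by lia.
- by rewrite /window inE; apply/negP => /orP[|/spN]; lia.
- exists (a - k)%N => y yn; rewrite /window inE => Dy Ey.
  have := E_out vN _ yn Ey; case/orP: Dy => [|/spN] h; lia.
exists p2 => [y Dy|].
  rewrite p2p ?p1p //; move: Dy; rewrite /window !inE => /orP[h|->]; last by rewrite orbT.
  by apply/orP; left; lia.
apply: realizes_sub D2 _ => y; rewrite /window !inE => /orP[h|->]; last by rewrite !orbT.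
by rewrite orbA; apply/orP; left; lia.
Qed.

Lemma realizes_grow (p : nat -> vec) : realizes n E (window sp a b) p ->
  exists2 p' : nat -> vec, (forall y, window sp a b y -> p' y = p y) &
    realizes n E (window sp 0 N) p'.
Proof.
move=> Dp; have [|p1 p1p D1] := grow_right (k := N - b) Dp; first by lia.
rewrite subnKC // in D1; have [p2 p2p D2] := grow_left D1 (leqnn a).
rewrite subnn in D2; exists p2 => // y Dy; rewrite p2p ?p1p //.
move: Dy; rewrite /window !inE => /orP[h|->]; last by rewrite orbT.
by apply/orP; left; lia.
Qed.

End Window.

(** Six vertices of the enumeration carry an explicit frame. The others are placed
    one at a time on both sides of it, and the weights of the frame are adapted so
    that the total remains diagonal with the same entries. *)
Lemma q_graph_compl_window (sp : pred nat) (N a b : nat) (idx : seq nat)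
    (P : seq vec) (c d S : seq R) (e6 : nat -> nat -> bool) :
  (a.+1 < b)%N -> (b <= N)%N -> (N <= n)%N ->
  (forall y, (y < n)%N -> sp y = (N <= y)%N) ->
  (forall v y, (v < N)%N -> ~~ (a <= v < b)%N -> (y < n)%N -> E v y ->
    (y < N)%N && ((y.+1 == v) || (v.+1 == y))) ->
  uniq idx -> size idx = 6%N -> (forall y, (y \in idx) = (y < n)%N && window sp a b y) ->
  frame_base P c d -> frame_realizes P e6 ->
  (forall i j, (i < j < 6)%N -> E (nth 0%N idx i) (nth 0%N idx j) = e6 i j) ->
  {subset 0 :: d <= S} -> (q_graph R (compl_graph G) <= size S)%N.
Proof.
move=> ab bN Nn spE E_out ui si idxE Pb Pe e6E dS.
pose sp' y := (N <= y < n)%N.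
pose p0 y := nth (vec0 R) P (index y idx).
have i6 i : (i < 6)%N -> index (nth 0%N idx i) idx = i by move=> i6; rewrite index_uniq ?si.
have D0 : realizes n E (window sp' a b) p0.
  have lt y : (y < n)%N -> window sp' a b y -> exists2 k, (k < 6)%N & y = nth 0%N idx k.
    move=> yn Dy; have yi : y \in idx.
      by rewrite idxE yn; move: Dy; rewrite /window !inE spE // /sp' yn andbT.
    by exists (index y idx); rewrite ?nth_index // -si index_mem.
  move=> i j iN jN /(lt i iN)[k k6 ->] /(lt j jN)[l l6 ->] kl; rewrite /p0 !i6 //.
  have {kl} : k != l by apply: contraNneq kl => ->.
  case: (ltngtP k l) => // [h|h] _.
    by have [] := Pe k l; rewrite ?h // -e6E // h.
  have [] := Pe l k; rewrite ?h // -e6E ?h // => h1 h2.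
  by rewrite dotC h1 E_sym; split=> //; exact: cross_neq0C.
have sp'N y : sp' y -> (N <= y)%N by case/andP.
have [p pp Dp] := realizes_grow ab bN Nn sp'N E_out D0.
have pall : realizes n E predT p.
  move=> i j iN jN _ _ ij; apply: Dp => //; rewrite /window inE /sp' ?iN ?jN andbT; lia.
have idn : {subset idx <= iota 0 n}.
  by move=> y; rewrite idxE mem_iota add0n => /andP[->].
have pP k : (k < 6)%N -> p (nth 0%N idx k) = nth (vec0 R) P k.
  move=> k6; have : nth 0%N idx k \in idx by rewrite mem_nth ?si.
  rewrite idxE => /andP[yn Dy]; rewrite pp /p0 ?i6 //.
  by move: Dy; rewrite /window !inE spE // /sp' yn andbT.
have [w w0 wd] := frame_weights Pb ui si idn pP.
have [_ [_ d3] _ _ _] := Pb.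
have xs x : x \in s.
  have /subset_cardP/(_ (subset_predT _)) : #|s| = #|'I_n| by rewrite (card_uniqP us)
    ss card_ord.
  by move=> ->.
have xn x : (index x s < n)%N by apply: leq_trans (_ : index x s < size s)%N _;
  rewrite ?index_mem // ss.
apply: (@q_graph_compl_frame R n G (fun x => p (index x s)) (fun x => w (index x s)) d) => //.
- move=> x y xy; have [] := pall (index x s) (index y s) (xn x) (xn y) isT isT.
    by apply: contraNneq xy => h; rewrite -(nth_index x0 (xs x)) h nth_index.
  by move=> -> _; rewrite /E !nth_index.
- move=> k k'; rewrite -wd -(big_mkord xpredT (fun i =>
    w i * (vcomp (p i) k * vcomp (p i) k'))).
  pose F x := w (index x s) * (vcomp (p (index x s)) k * vcomp (p (index x s)) k').
  transitivity (\sum_(x <- s) F x).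
    rewrite [RHS](perm_big (index_enum 'I_n)) //.
    apply: uniq_perm => //; first exact: index_enum_uniq.
    by move=> x; rewrite xs mem_index_enum.
  rewrite (big_nth x0) ss; apply: eq_big_nat => i /andP[_ iN].
  by rewrite /F index_uniq ?ss.
Qed.

End Growth.

Section Complements.
Variables (R : realType) (n : nat) (G : sgraph n) (x0 : 'I_n) (s : seq 'I_n).
Variable e : nat -> nat -> bool.
Hypotheses (us : uniq s) (ss : size s = n) (n6 : (6 <= n)%N).
Hypothesis he : forall i j, (i < j < n)%N -> G (nth x0 s i) (nth x0 s j) = e i j.

Let adj_e v y : (v < n)%N -> (y < n)%N -> G (nth x0 s v) (nth x0 s y) ->
  ((v < y)%N && e v y) || ((y < v)%N && e y v).
Proof.
move=> vn yn; case: (ltngtP v y) => [h|h|->] /=; last by rewrite adj_irr.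
  by rewrite he ?h // orbF.
by rewrite adj_sym he ?h.
Qed.

Lemma q_graph_compl_path : e =2 path_pattern -> (q_graph R (compl_graph G) <= 2)%N.
Proof.
move=> ee; apply: (@q_graph_compl_window R n G x0 s us ss pred0 n 0 6 (iota 0 6)
  (path_frame R) _ _ [:: 0; 7] path_pattern) => //.
- by move=> y yn /=; rewrite leqNgt yn.
- move=> v y vn _ yn /(adj_e vn yn); rewrite !ee /path_pattern; lia.
- by move=> y; rewrite mem_iota /window !inE orbF; lia.
- exact: path_frame_base.
- exact: path_frame_realizes.
- by move=> i j ij; rewrite !nth_iota; [rewrite he ?ee //; lia | lia | lia].
- by move=> x; rewrite !inE => /or4P[] ->; rewrite ?orbT.
Qed.

Lemma q_graph_compl_isolated : e =2 isolated_pattern n -> (q_graph R (compl_graph G) <= 3)%N.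
Proof.
move=> ee; apply: (@q_graph_compl_window R n G x0 s us ss (pred1 n.-1)
  n.-1 0 5 (iota 0 5 ++ [:: n.-1])
  (isolated_frame R) _ _ [:: 0; 12; 4] (isolated_pattern 6)) => //.
- by lia.
- by lia.
- by move=> y yn /=; lia.
- move=> v y vn _ yn /(adj_e _ yn); rewrite !ee /isolated_pattern; lia.
- by rewrite cats1 rcons_uniq mem_iota iota_uniq andbT; lia.
- by move=> y; rewrite mem_cat mem_iota /window !inE; lia.
- exact: isolated_frame_base.
- exact: isolated_frame_realizes.
- move=> i j ij; rewrite !nth_cat size_iota.
  have i5 : (i < 5)%N by lia.
  rewrite i5 nth_iota // add0n; case: ifP => j5.
    by rewrite nth_iota // add0n he ?ee /isolated_pattern; lia.
  have -> : j = 5%N by lia.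
  by rewrite /= he ?ee /isolated_pattern /= ?eqxx //; lia.
- by move=> x; rewrite !inE => /or4P[] ->; rewrite ?orbT.
Qed.

(** The window of six consecutive vertices places the chord at [k'], as far left as
    the order of the graph allows. *)
Let chord_window k k' (P : seq (vec R)) (c d S : seq R) : e =2 chord_pattern k ->
  (k' <= k)%N -> (k' <= 3)%N -> (k - k' + 6 <= n)%N ->
  frame_base P c d -> frame_realizes P (chord_pattern k') ->
  {subset 0 :: d <= S} -> (q_graph R (compl_graph G) <= size S)%N.
Proof.
move=> ee kk k3 kn Pb Pe dS; set a := (k - k')%N in kn.
apply: (@q_graph_compl_window R n G x0 s us ss pred0 n a (a + 6) (iota a 6)
  P _ _ S (chord_pattern k')) => //.
- by lia.
- by move=> y yn /=; rewrite leqNgt yn.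
- move=> v y vn vw yn /(adj_e vn yn); rewrite !ee /chord_pattern /a in vw *; lia.
- exact: iota_uniq.
- by move=> y; rewrite mem_iota /window !inE orbF; lia.
- exact: Pb.
- move=> i j ij; rewrite !nth_iota; try lia.
  by rewrite he ?ee /chord_pattern /a; lia.
- exact: dS.
Qed.

Lemma q_graph_compl_chord k : (k.+2 < n)%N -> e =2 chord_pattern k ->
  (q_graph R (compl_graph G) <= 3)%N.
Proof.
move=> kn ee; have [k0|k0] := leqP (k + 6) n.
  apply: (chord_window (k' := 0) (S := [:: 0; 7; 9]) ee _ _ _ (chord0_frame_base R)
    (chord0_frame_realizes R)); try lia.
  by move=> x; rewrite !inE => /or4P[] ->; rewrite ?orbT.
have [k1|k1] := leqP (k + 5) n.
  apply: (chord_window (k' := 1) (S := [:: 0; 8; 10]) ee _ _ _ (chord1_frame_base R)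
    (chord1_frame_realizes R)); try lia.
  by move=> x; rewrite !inE => /or4P[] ->; rewrite ?orbT.
have [k2|k2] := leqP (k + 4) n.
  apply: (chord_window (k' := 2) (S := [:: 0; 8; 10]) ee _ _ _ (chord2_frame_base R)
    (chord2_frame_realizes R)); try lia.
  by move=> x; rewrite !inE => /or4P[] ->; rewrite ?orbT.
apply: (chord_window (k' := 3) (S := [:: 0; 7; 9]) ee _ _ _ (chord3_frame_base R)
  (chord3_frame_realizes R)); try lia.
by move=> x; rewrite !inE => /or4P[] ->; rewrite ?orbT.
Qed.

(** The window has five consecutive vertices of the path, with the branching vertex
    at [k'], and the leaf. *)
Let leaf_window k k' (P : seq (vec R)) (c d S : seq R) : e =2 leaf_pattern n k ->
  (k' <= k)%N -> (k' <= 4)%N -> (k - k' + 6 <= n)%N ->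
  frame_base P c d -> frame_realizes P (leaf_pattern 6 k') ->
  {subset 0 :: d <= S} -> (q_graph R (compl_graph G) <= size S)%N.
Proof.
move=> ee kk k4 kn Pb Pe dS; set a := (k - k')%N in kn.
apply: (@q_graph_compl_window R n G x0 s us ss (pred1 n.-1) n.-1 a (a + 5)
  (iota a 5 ++ [:: n.-1])
  P _ _ S (leaf_pattern 6 k')) => //.
- by lia.
- by lia.
- by lia.
- by move=> y yn /=; lia.
- move=> v y vn vw yn /(adj_e _ yn); rewrite !ee /leaf_pattern /a in vw *.
  have vn' : (v < n)%N by lia.
  move=> /(_ vn'); have -> : (v == n.-1) = false by lia.
  by case: (y =P n.-1) => h; lia.
- by rewrite cats1 rcons_uniq mem_iota iota_uniq andbT; lia.
- by move=> y; rewrite mem_cat mem_iota /window !inE; lia.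
- exact: Pb.
- move=> i j ij; rewrite !nth_cat size_iota.
  have i5 : (i < 5)%N by lia.
  rewrite i5 nth_iota //; case: ifP => j5.
    rewrite nth_iota // he ?ee /leaf_pattern; last by lia.
    have -> : (a + j == n.-1)%N = false by lia.
    have -> : (j == 5)%N = false by lia.
    by lia.
  have -> : j = 5%N by lia.
  rewrite /= he ?ee /leaf_pattern /= ?eqxx /a; lia.
- exact: dS.
Qed.

Lemma q_graph_compl_leaf k : (0 < k)%N -> (k.+2 < n)%N -> e =2 leaf_pattern n k ->
  (q_graph R (compl_graph G) <= 3)%N.
Proof.
move=> k_gt0 kn ee; have [k1|k1] := leqP (k + 5) n.
  apply: (leaf_window (k' := 1) (S := [:: 0; 6; 8]) ee _ _ _ (leaf1_frame_base R)
    (leaf1_frame_realizes R)); try lia.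
  by move=> x; rewrite !inE => /or4P[] ->; rewrite ?orbT.
have [k2|k2] := leqP (k + 4) n.
  apply: (leaf_window (k' := 2) (S := [:: 0; 5; 7]) ee _ _ _ (leaf2_frame_base R)
    (leaf2_frame_realizes R)); try lia.
  by move=> x; rewrite !inE => /or4P[] ->; rewrite ?orbT.
apply: (leaf_window (k' := 3) (S := [:: 0; 6; 8]) ee _ _ _ (leaf3_frame_base R)
  (leaf3_frame_realizes R)); try lia.
by move=> x; rewrite !inE => /or4P[] ->; rewrite ?orbT.
Qed.

End Complements.

(** * The bound *)

Definition enumerated n (G : sgraph n) (e : nat -> nat -> bool) : Prop :=
  exists x0 : 'I_n, exists s, [/\ uniq s, size s = n &
    forall i j, (i < j < n)%N -> G (nth x0 s i) (nth x0 s j) = e i j].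

Lemma enumerated_iso n (G H : sgraph n) (e : nat -> nat -> bool) :
  (forall i j : 'I_n, (i < j)%N -> H i j = e i j) -> enumerated G e -> graph_iso G H.
Proof.
move=> He [x0 [s [us ss Ge]]].
have xs x : x \in s.
  have /subset_cardP/(_ (subset_predT _)) : #|s| = #|'I_n| by rewrite (card_uniqP us)
    ss card_ord.
  by move=> ->.
have xn x : (index x s < n)%N.
  by apply: leq_trans (_ : index x s < size s)%N _; rewrite ?index_mem // ss.
exists (fun x => Ordinal (xn x)); split.
  exists (fun i : 'I_n => nth x0 s i) => [x|i] /=; first by rewrite nth_index.
  by apply: val_inj; rewrite /= index_uniq // ss.
move=> x y; transitivity (G (nth x0 s (index x s)) (nth x0 s (index y s)));
  last by rewrite !nth_index.
case: (ltngtP (index x s) (index y s)) => h.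
- by rewrite He // Ge // h xn.
- by rewrite adj_sym He // adj_sym Ge // h xn.
- rewrite (_ : Ordinal (xn x) = Ordinal (xn y)); last exact: val_inj.
  by rewrite h !adj_irr.
Qed.

Lemma graph_iso_compl m n (G : sgraph m) (H : sgraph n) :
  graph_iso (compl_graph G) H -> graph_iso G (compl_graph H).
Proof.
move=> [f [fb fG]]; exists f; split=> // x y.
rewrite /= /compl_rel fG /= /compl_rel negb_and !negbK (inj_eq (bij_inj fb)).
by have [->|] := eqVneq x y; rewrite ?adj_irr.
Qed.

Lemma q_graph_ext (R : realType) n (G H : sgraph n) : (forall x y, G x y = H x y) ->
  q_graph R G = q_graph R H.
Proof.
have le (G1 G2 : sgraph n) : (forall x y, G1 x y = G2 x y) -> (q_graph R G1 <= q_graph R G2)%N.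
  move=> GH; rewrite {2}/q_graph; case: ex_minnP => k /asboolP[A [As GA] <-] _.
  by apply: q_graph_le; split=> // i j ij; rewrite GH GA.
by move=> GH; apply/eqP; rewrite eqn_leq !le // => x y; rewrite GH.
Qed.

Lemma q_graph_le_order (R : realType) n (G : sgraph n) : (q_graph R G <= n)%N.
Proof.
have [k /asboolP[A GA _]] := SG_neq0 R G.
have := @q_mx_multiplicities R n A [::] isT; rewrite big_nil !addn0.
exact: leq_trans (q_graph_le GA).
Qed.

Lemma q_graph_structure (R : realType) n (G : sgraph n) : (0 < n)%N ->
  ~ (q_graph R G + 2 <= n)%N ->
  [\/ enumerated G path_pattern,
      exists2 k, (k.+2 < n)%N & enumerated G (chord_pattern k),
      exists2 k, (0 < k)%N && (k.+2 < n)%N & enumerated G (leaf_pattern n k)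
    | (1 < n)%N /\ enumerated G (isolated_pattern n)].
Proof.
move=> n0 tight; have [P hP] := longest_path_exists G.
have [s [us [ss [e [Ge he]]]]] := @longest_path_structure R n G (Ordinal n0) P tight hP.
have enum e' : e =2 e' -> enumerated G e'.
  by move=> ee; exists (Ordinal n0), s; split=> // i j ij; rewrite Ge // ee.
case: he => [h|[k kn h]|[k kn h]|[n1 h]].
- by constructor 1; exact: enum.
- by constructor 2; exists k => //; exact: enum.
- by constructor 3; exists k => //; exact: enum.
- by constructor 4; split=> //; exact: enum.
Qed.

(** The exceptional graphs other than paths contain a triangle, a claw or an
    isolated vertex, hence have a double eigenvalue. *)
Lemma q_graph_lt_order (R : realType) n (G : sgraph n) : (0 < n)%N ->
  (q_graph R G + 1 <= n)%N \/ enumerated G path_pattern.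
Proof.
move=> n0; have [h|/negP tight] := boolP (q_graph R G + 2 <= n)%N; first by left; lia.
have neq (x0 : 'I_n) s i j : uniq s -> size s = n -> (i < n)%N -> (j < n)%N -> i != j ->
    nth x0 s i != nth x0 s j.
  by move=> us ss iN jN ij; rewrite nth_uniq // ss.
case: (q_graph_structure n0 tight) => [|[k kn]|[k /andP[k0 kn]]|[n1]] h; first by right.
- left; case: h => x0 [s [us ss Ge]].
  suff /(q_graph_triangle_or_claw R)[] : has_triangle_or_claw G
    [:: nth x0 s k; nth x0 s k.+1; nth x0 s k.+2] by [].
  rewrite /has_triangle_or_claw !Ge /chord_pattern ?eqxx ?orbT ?andbT /=; try lia.
  by distinct; apply: neq => //; lia.
- left; case: h => x0 [s [us ss Ge]].
  suff /(q_graph_triangle_or_claw R)[] : has_triangle_or_claw G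
    [:: nth x0 s k; nth x0 s k.-1; nth x0 s k.+1; nth x0 s n.-1] by [].
  rewrite /has_triangle_or_claw (adj_sym _ _ (nth x0 s k.-1)) !Ge /leaf_pattern; try lia.
  have [-> ->] : (k == n.-1) = false /\ (k.+1 == n.-1) = false by lia.
  rewrite !eqxx prednK // eqxx !andbT.
  by distinct; apply: neq => //; lia.
- left; case: h => x0 [s [us ss Ge]].
  apply: (@q_graph_isolated1 R n G (nth x0 s n.-1) (nth x0 s 0)); last by apply: neq => //; lia.
  move=> y; have ys : y \in s.
    have /subset_cardP/(_ (subset_predT _)) : #|s| = #|'I_n| by rewrite (card_uniqP us)
      ss card_ord.
    by move=> ->.
  have yn : (index y s < n)%N.
    by apply: leq_trans (_ : index y s < size s)%N _; rewrite ?index_mem // ss.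
  rewrite -(nth_index x0 ys) adj_sym; have [->|yl] := eqVneq (index y s) n.-1.
    by rewrite adj_irr.
  by rewrite Ge /isolated_pattern ?eqxx //; lia.
Qed.

Lemma compl_graphK n (G : sgraph n) x y : compl_graph (compl_graph G) x y = G x y.
Proof.
by rewrite /= /compl_rel /= /compl_rel negb_and !negbK; have [->|] := eqVneq x y;
  rewrite ?adj_irr.
Qed.

Definition sym_pattern (e : nat -> nat -> bool) (i j : nat) : bool :=
  if (i < j)%N then e i j else e j i.

Lemma compl_enumeration n (G : sgraph n) (e : nat -> nat -> bool) x0 s a b :
  uniq s -> size s = n -> (forall i j, (i < j < n)%N -> G (nth x0 s i) (nth x0 s j) = e i j) ->
  (a < n)%N -> (b < n)%N -> a != b ->
  compl_graph G (nth x0 s a) (nth x0 s b) = ~~ sym_pattern e a b.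
Proof.
move=> us ss Ge an bn ab; rewrite /= /compl_rel nth_uniq ?ss // ab /= /sym_pattern.
by case: (ltngtP a b) ab => // h _; [rewrite Ge ?h | rewrite adj_sym Ge ?h].
Qed.

Lemma enumerated_compl n (G : sgraph n) (e e' : nat -> nat -> bool) (t : seq nat) :
  uniq t -> size t = n -> all (fun i => (i < n)%N) t ->
  (forall i j, (i < j < n)%N -> ~~ sym_pattern e (nth 0 t i) (nth 0 t j) = e' i j) ->
  enumerated G e -> enumerated (compl_graph G) e'.
Proof.
move=> ut st /allP tn te [x0 [s [us ss Ge]]]; exists x0, (map (nth x0 s) t).
have tn' i : (i < n)%N -> (nth 0 t i < n)%N by move=> iN; apply: tn; rewrite mem_nth ?st.
split; rewrite ?size_map //.
  rewrite map_inj_in_uniq // => i j /tn iN /tn jN /eqP.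
  by rewrite nth_uniq ?ss // => /eqP.
move=> i j ij; have [iN jN] : (i < n)%N /\ (j < n)%N by lia.
rewrite !(nth_map 0) ?st // (compl_enumeration us ss Ge) ?tn' ?te //.
by rewrite nth_uniq ?st //; lia.
Qed.

Lemma enumerated_ext n (G H : sgraph n) e : (forall x y, G x y = H x y) ->
  enumerated G e -> enumerated H e.
Proof.
by move=> GH [x0 [s [us ss Ge]]]; exists x0, s; split=> // i j ij; rewrite -GH Ge.
Qed.

(** The path on four vertices is self-complementary. *)
Lemma path4_compl (G : sgraph 4) : enumerated (compl_graph G) path_pattern ->
  enumerated G path_pattern.
Proof.
move=> h; apply: enumerated_ext (@compl_graphK 4 G) _.
apply: (@enumerated_compl 4 _ _ _ [:: 1; 3; 0; 2]) h => //.
by move=> [|[|[|[|i]]]] [|[|[|[|j]]]]; rewrite /= ?andbF.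
Qed.

(** So is the path on five vertices with its middle chord. *)
Lemma bull_compl (G : sgraph 5) : enumerated (compl_graph G) (chord_pattern 1) ->
  enumerated G (chord_pattern 1).
Proof.
move=> h; apply: enumerated_ext (@compl_graphK 5 G) _.
apply: (@enumerated_compl 5 _ _ _ [:: 3; 0; 2; 4; 1]) h => //.
by move=> [|[|[|[|[|i]]]]] [|[|[|[|[|j]]]]]; rewrite /= ?andbF.
Qed.

(** In the complement of each of these graphs on five vertices there is a cycle
    of length four. *)
Lemma q_graph_compl_order5 (R : realType) (G : sgraph 5) e :
  e = chord_pattern 0 \/ e = chord_pattern 2 \/ e = leaf_pattern 5 1 \/
  e = leaf_pattern 5 2 \/ e = isolated_pattern 5 ->
  enumerated G e -> (q_graph R (compl_graph G) <= 3)%N.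
Proof.
move=> he [x0 [s [us ss Ge]]].
have cyc t : uniq t -> size t = 4%N -> all (fun i => (i < 5)%N) t ->
    cycle (fun i j => (i != j) && ~~ sym_pattern e i j) t -> (q_graph R (compl_graph G) <= 3)%N.
  move=> ut st tn ct.
  have := @q_graph_cycle R 5 (compl_graph G) (map (nth x0 s) t).
  rewrite size_map st => h; rewrite -(leq_add2r 2); apply: h => //.
    rewrite map_inj_in_uniq // => i j /(allP tn) iN /(allP tn) jN /eqP.
    by rewrite nth_uniq ?ss // => /eqP.
  rewrite cycle_map; apply: sub_in_cycle tn ct => i j iN jN /andP[ij eij].
  by have h1 := compl_enumeration us ss Ge iN jN ij; rewrite eij in h1.
case: he => [|[|[|[|]]]] he; subst e.
- exact: (cyc [:: 0; 3; 1; 4]%N).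
- exact: (cyc [:: 0; 3; 1; 4]%N).
- exact: (cyc [:: 4; 2; 0; 3]%N).
- exact: (cyc [:: 0; 3; 1; 4]%N).
- exact: (cyc [:: 0; 3; 1; 4]%N).
Qed.

(** If [q G <= n - 2] the bound is immediate. Otherwise [G] is one of the four
    exceptional graphs. On at least six vertices the complement of a path, whose [q]
    may be [n], has [q] at most 2; for the others [q G <= n - 1], and the complement
    has [q] at most 3. On five vertices the latter comes from a cycle of length four
    in the complement, which exists except for the path and the path with its middle
    chord. On four vertices both graphs satisfy [q <= n - 1], neither being a path. *)
Lemma nordhaus_gaddum_compl_le4 (R : realType) n (G : sgraph n) :
  (n = 4%N -> ~ enumerated G path_pattern /\ ~ enumerated (compl_graph G) path_pattern) ->
  (n = 5%N -> ~ enumerated G path_pattern /\ ~ enumerated G (chord_pattern 1)) ->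
  (q_graph R (compl_graph G) <= 4)%N ->
  (q_graph R G + q_graph R (compl_graph G) <= n + 2)%N.
Proof.
move=> h4 h5 q4.
have qn := q_graph_le_order R G; have qcn := q_graph_le_order R (compl_graph G).
have [n2|n3] := leqP n 2; first by lia.
have n0 : (0 < n)%N by lia.
have lt H := q_graph_lt_order R H n0.
have [/eqP n3'|n_3] := boolP (n == 3)%N.
  case: (lt G) => [h|[x0 [s [us ss Ge]]]]; first by lia.
  suff : (q_graph R (compl_graph G) + 1 <= n)%N by lia.
  apply: (@q_graph_isolated1 R n _ (nth x0 s 1) (nth x0 s 0));
    last by rewrite nth_uniq ?ss //; lia.
  move=> y; have ys : y \in s.
    have /subset_cardP/(_ (subset_predT _)) : #|s| = #|'I_n| by rewrite (card_uniqP us)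
      ss card_ord.
    by move=> ->.
  have yn : (index y s < n)%N.
    by apply: leq_trans (_ : index y s < size s)%N _; rewrite ?index_mem // ss.
  rewrite -(nth_index x0 ys); have [->|y1] := eqVneq 1%N (index y s); first by rewrite adj_irr.
  rewrite (compl_enumeration us ss Ge) //; last by rewrite n3'.
  rewrite negbK /sym_pattern /path_pattern; move: (index y s) yn y1; rewrite n3'.
  by move=> [|[|[|]]].
have [/eqP n4|n_4] := boolP (n == 4)%N.
  have [nG nGc] := h4 n4; case: (lt G) => // h; case: (lt (compl_graph G)) => // h'; lia.
have [/negP tight|] := boolP (~~ (q_graph R G + 2 <= n)%N); last by rewrite negbK; lia.
have [/eqP n5|n_5] := boolP (n == 5)%N.
  have [nP nB] := h5 n5; have qG : (q_graph R G <= 4)%N by case: (lt G) => // h; lia.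
  suff : (q_graph R (compl_graph G) <= 3)%N by lia.
  have := q_graph_structure n0 tight; subst n.
  case=> [//|[k k3 h]|[k /andP[k0 k3] h]|[_ h]].
  - case: k k3 h => [|[|[|//]]] _ h //.
      by apply: (@q_graph_compl_order5 R G _ _ h); left.
    by apply: (@q_graph_compl_order5 R G _ _ h); right; left.
  - case: k k0 k3 h => [|[|[|//]]] // _ _ h.
      by apply: (@q_graph_compl_order5 R G _ _ h); do 2 right; left.
    by apply: (@q_graph_compl_order5 R G _ _ h); do 3 right; left.
  - by apply: (@q_graph_compl_order5 R G _ _ h); do 4 right.
have n6 : (6 <= n)%N by lia.
have path_le2 : enumerated G path_pattern -> (q_graph R (compl_graph G) <= 2)%N.
  move=> [x0 [s [us ss Ge]]].
  exact: (q_graph_compl_path R us ss n6 Ge (fun _ _ => erefl)).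
case: (q_graph_structure n0 tight) => [h|[k kn h]|[k /andP[k0 kn] h]|[n1 h]];
  case: (h) => x0 [s [us ss Ge]].
- by have := q_graph_compl_path R us ss n6 Ge (fun _ _ => erefl); lia.
- have := q_graph_compl_chord R us ss n6 Ge kn (fun _ _ => erefl).
  by case: (lt G) => [|/path_le2]; lia.
- have := q_graph_compl_leaf R us ss n6 Ge k0 kn (fun _ _ => erefl).
  by case: (lt G) => [|/path_le2]; lia.
- have := q_graph_compl_isolated R us ss n6 Ge (fun _ _ => erefl).
  by case: (lt G) => [|/path_le2]; lia.
Qed.

Theorem corollary5p4 (R : realType) (n : nat) (G : sgraph n) :
  ~ graph_iso G (path_graph 4) ->
  ~ graph_iso G (path_graph 5) ->
  ~ graph_iso G (compl_graph (path_graph 5)) ->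
  ~ graph_iso G T22_graph ->
  (q_graph R G <= 4)%N \/ (q_graph R (compl_graph G) <= 4)%N ->
  (q_graph R G + q_graph R (compl_graph G) <= n + 2)%N.
Proof.
move=> nP4 nP5 nP5c nB.
have path_iso (H : sgraph n) : enumerated H path_pattern -> graph_iso H (path_graph n).
  by apply: enumerated_iso => i j ij; rewrite /= /path_rel /path_pattern eq_sym; lia.
have noP4 : n = 4%N -> ~ enumerated G path_pattern /\ ~ enumerated (compl_graph G) path_pattern.
  move=> n4; subst n; have nP : ~ enumerated G path_pattern by move=> /path_iso.
  by split=> // /path4_compl.
have noB : n = 5%N -> ~ enumerated G (chord_pattern 1).
  move=> n5; subst n => h; apply: nB; apply: enumerated_iso h => i j ij.
  by rewrite /= /T22_rel /path_rel /chord_pattern; move: ij; case: i => [[|[|[|[|[|//]]]]] ?];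
    case: j => [[|[|[|[|[|//]]]]] ?].
case=> q4; last first.
  apply: nordhaus_gaddum_compl_le4 => // n5; split; last exact: noB.
  by subst n => /path_iso.
have GE := @compl_graphK n G.
rewrite addnC -(q_graph_ext R GE); apply: nordhaus_gaddum_compl_le4.
- move=> n4; have [nG nGc] := noP4 n4; split=> // h; apply: nG.
  exact: enumerated_ext GE h.
- move=> n5; subst n; split=> [/path_iso h|h].
    by apply: nP5c; exact: graph_iso_compl.
  by apply: (noB erefl); exact: bull_compl.
- by rewrite (q_graph_ext R GE).
Qed.
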